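(* Let $G$ be a non-archimedean, Roelcke precompact, Polish group and let $G \curvearrowright (\Omega, \mu)$ be a non-singular action on a $\sigma$-finite measure space. Then $\Omega$ can be represented as a disjoint countable union $\bigsqcup_i \Omega_i$ of $G$-invariant subsets such that, for each $i$, the action of $G$ on $\Omega_i$ is isomorphic to an induced action $\mathrm{Ind}_{V_i}^G(\alpha_i)$ for some open subgroup $V_i \leq G$ and some probability measure-preserving action $\alpha_i$ of $V_i$. In particular, there exists a $\sigma$-finite measure equivalent to $\mu$ which is preserved by $G$.
   Context: A topological group $G$ is non-archimedean if it admits a basis at $1_G$ consisting of open subgroups. It is Roelcke precompact if for every neighborhood $U$ of $1_G$ there is a finite $F \subseteq G$ with $G = UFU$. For a $\sigma$-finite measure space $(\Omega, \mathcal{B}, \mu)$, $\mathrm{MALG}(\mu)$ is the Boolean algebra $\mathcal{B}$ modulo the ideal of null sets, $\mathrm{Aut}^*(\mu)$ is the group of automorphisms of the Boolean algebra $\mathrm{MALG}(\mu)$ (equivalently, bi-measurable bijections of $\Omega$ preserving the null ideal, modulo equality on a co-null set), and $\mathrm{Aut}(\mu)$ is its subgroup of elements which also preserve $\mu$. $\mathrm{Aut}^*(\mu)$ carries the topology induced by its embedding in the unitary group of $L^2(\Omega,\mu)$ (strong operator topology) via the Koopman representation $(g \cdot f)(x) = \big(\frac{\mathrm{d} g_*\mu}{\mathrm{d}\mu}\big)^{1/2}(x)\, f(g^{-1}\cdot x)$. A non-singular action of a topological group $G$ on $(\Omega, \mu)$ is a continuous homomorphism $G \to \mathrm{Aut}^*(\mu)$;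 it preserves $\mu$ if its image is contained in $\mathrm{Aut}(\mu)$; it is probability measure-preserving (pmp) if in addition $\mu$ is a probability measure. Invariant subsets are understood as elements of $\mathrm{MALG}(\mu)$ fixed by $G$, and two actions are isomorphic if there is a $G$-equivariant isomorphism between the measure algebras. Induced action: let $V \leq G$ be an open subgroup of countable index, $\xi$ the counting measure on $G/V$, and $\sigma$ a non-singular action of $V$ on $(X, \mu)$. Let $s \colon G/V \to G$ satisfy $s(gV) \in gV$ for all $g$, and put $c(g,hV) = s(ghV)^{-1} g\, s(hV) \in V$. Then $\mathrm{Ind}_V^G(\sigma)$ is the action of $G$ on $\mathrm{MALG}(G/V \times X, \xi\otimes\mu)$ determined by $g \cdot (\{hV\} \times A) = \{ghV\} \times \sigma(c(g,hV))\cdot A$ for $g,h \in G$, $A \in \mathrm{MALG}(\mu)$. Up to isomorphism it does not depend on $s$. *)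

(* Defs.v *)
From HB Require Import structures.
From mathcomp Require Import all_boot all_order all_algebra.
From mathcomp Require Import all_classical all_reals all_analysis.
From mathcomp Require Import complex.

Set Implicit Arguments.
Unset Strict Implicit.
Unset Printing Implicit Defensive.

Import Order.Theory GRing.Theory Num.Theory.
Import numFieldTopology.Exports.

Local Open Scope ring_scope.
Local Open Scope classical_set_scope.
Local Open Scope quotient_scope.

HB.mixin Record isTopologicalGroup G & Group G & Topological G := {
  mulg_continuous : continuous (fun xy : G * G => (xy.1 * xy.2)%g);
  invg_continuous : continuous (fun x : G => (x^-1)%g)
}.

#[short(type="topologicalGroupType")]
HB.structure Definition TopologicalGroup :=
  {G of Group G & Topological G & isTopologicalGroup G}.

Definition separable_space (T : topologicalType) :=
  exists2 D : set T, countable D & dense D.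

Definition completely_metrizable (R : realType) (T : topologicalType) :=
  exists d : T -> T -> R,
    [/\ forall x y, (d x y = 0%R) <-> (x = y),
        forall x y, d x y = d y x,
        forall x y z, (d x z <= d x y + d y z)%R,
        forall (x : T) (U : set T), nbhs x U <->
          exists2 e : R, (0 < e)%R & [set y | (d x y < e)%R] `<=` U
      & forall u : nat -> T,
          (forall e : R, (0 < e)%R -> exists N : nat, forall m n : nat,
             (N <= m)%N -> (N <= n)%N -> (d (u m) (u n) < e)%R) ->
          exists l : T, u @ \oo --> l].

Definition polish (R : realType) (T : topologicalType) :=
  separable_space T /\ completely_metrizable R T.

Record openSubgroup (G : topologicalGroupType) := OpenSubgroup {
  osg_set :> set G;
  osg_open : open osg_set;
  osg1 : osg_set 1%g;
  osgM : forall x y, osg_set x -> osg_set y -> osg_set (x * y)%g;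
  osgV : forall x, osg_set x -> osg_set (x^-1)%g
}.

Definition non_archimedean (G : topologicalGroupType) :=
  forall U : set G, nbhs 1%g U ->
    exists V : openSubgroup G, V `<=` U.

Definition set_mul (G : magmaType) (A B : set G) : set G :=
  [set (a * b)%g | a in A & b in B].

Definition roelcke_precompact (G : topologicalGroupType) :=
  forall U : set G, nbhs 1%g U ->
    exists2 F : set G, finite_set F &
      [set: G] = set_mul (set_mul U F) U.

Section OpenSubgroupType.
Variables (G : topologicalGroupType) (V : openSubgroup G).

Definition subgroup_type : Type := set_type (osg_set V).

HB.instance Definition _ := SubChoice.on subgroup_type.
HB.instance Definition _ := Topological.copy subgroup_type (set_type (osg_set V)).

Fact osg_group_closed :
  group_closed (fun x : G => x \in osg_set V).
Proof.
split=> [|x y]; first by apply/mem_set; exact: osg1.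
move=> /set_mem Vx /set_mem Vy; apply/mem_set; apply: osgM => //.
exact: osgV.
Qed.

HB.instance Definition _ :=
  SubChoice_isSubGroup.Build G (fun x => x \in osg_set V) subgroup_type
    osg_group_closed.

Let val_continuous : continuous (val : subgroup_type -> G).
Proof. exact: (@initial_continuous (set_type (osg_set V)) G set_val). Qed.

Let to_subgroup_continuous (T : topologicalType) (f : T -> subgroup_type) :
  continuous (val \o f) -> continuous f.
Proof.
by move=> cf; apply/(@continuous_comp_initial (set_type (osg_set V)) T G set_val f).
Qed.

Fact subgroup_mul_continuous :
  continuous (fun xy : subgroup_type * subgroup_type => (xy.1 * xy.2)%g).
Proof.
apply: to_subgroup_continuous => -[x y].
rewrite /comp.
have -> : (fun xy : subgroup_type * subgroup_type => val (xy.1 * xy.2)%g) =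
  (fun ab : G * G => (ab.1 * ab.2)%g) \o
  (fun xy : subgroup_type * subgroup_type => (val xy.1, val xy.2)).
  by apply/funext => -[a b].
apply: continuous_comp; last exact: mulg_continuous.
apply: cvg_pair => /=.
- apply: (cvg_comp _ _ cvg_fst); exact: val_continuous.
- apply: (cvg_comp _ _ cvg_snd); exact: val_continuous.
Qed.

Fact subgroup_inv_continuous : continuous (fun x : subgroup_type => (x^-1)%g).
Proof.
apply: to_subgroup_continuous => x.
have -> : val \o (fun x : subgroup_type => (x^-1)%g) =
  (fun a : G => (a^-1)%g) \o (val : subgroup_type -> G).
  by apply/funext => a.
apply: continuous_comp; [exact: val_continuous|exact: invg_continuous].
Qed.

HB.instance Definition _ := isTopologicalGroup.Build subgroup_type
  subgroup_mul_continuous subgroup_inv_continuous.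

End OpenSubgroupType.

Section MeasureAlgebra.
Context d (T : measurableType d) (R : realType).
Variable mu : {measure set T -> \bar R}.

Definition measurable_sets : Type := set_type (@measurable d T).
HB.instance Definition _ := SubChoice.on measurable_sets.

Definition malg_rel (A B : measurable_sets) : bool :=
  `[< mu (val A `+` val B) = 0%E >].

Let msetP (A : measurable_sets) : measurable (val A).
Proof. exact/set_mem/(valP A). Qed.

Let measurableY (A B : set T) :
  measurable A -> measurable B -> measurable (A `+` B).
Proof. by move=> mA mB; apply: measurableU; exact: measurableD. Qed.

Let malg_relE (A B : measurable_sets) :
  reflect (\forall x \ae mu, val A x <-> val B x) (malg_rel A B).
Proof.
have mAB := measurableY (msetP A) (msetP B).
have E : ~` [set x | val A x <-> val B x] = val A `+` val B.
  apply/seteqP; split => x /=.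
    by move=> nAB; case: (pselect (val A x)) => a; case: (pselect (val B x)) => b;
      [exfalso; tauto|left|right|exfalso; tauto].
  by case=> -[a b] AB; tauto.
rewrite /malg_rel; apply: (iffP (asboolP _)) => [AB0|].
  by rewrite /almost_everywhere /prop_near1 /nbhs/= E; exact/negligibleP.
by rewrite /prop_near1 /nbhs/= /almost_everywhere E => /negligibleP; exact.
Qed.

Let malg_rel_refl : reflexive malg_rel.
Proof. by move=> A; apply/malg_relE; exact: nearW. Qed.

Let malg_rel_sym : symmetric malg_rel.
Proof. by move=> A B; rewrite /malg_rel setYC. Qed.

Let malg_rel_trans : transitive malg_rel.
Proof.
move=> B A C /malg_relE AB /malg_relE BC; apply/malg_relE.
by apply: filterS2 AB BC => x; tauto.
Qed.

Canonical malg_rel_equiv :=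
  EquivRel malg_rel malg_rel_refl malg_rel_sym malg_rel_trans.

Definition MALG : Type := {eq_quot malg_rel}.
HB.instance Definition _ := Choice.on MALG.
HB.instance Definition _ := EqQuotient.on MALG.

Definition malg_set (a : MALG) : set T := val (repr a).

Definition empty_mset : measurable_sets := exist _ set0 (mem_set measurable0).

(** Meaningful only when [A] is measurable. *)
Definition malg_class (A : set T) : MALG := \pi_MALG (insubd empty_mset A).

Lemma measurable_malg_set (a : MALG) : measurable (malg_set a).
Proof. exact: msetP. Qed.

Lemma malg_eqP (a b : MALG) :
  a = b <-> \forall x \ae mu, malg_set a x <-> malg_set b x.
Proof.
split=> [->|ab]; first exact: nearW.
by rewrite -[a]reprK -[b]reprK; apply/eqP; rewrite eqmodE; exact/malg_relE.
Qed.

Lemma malg_classK (A : set T) : measurable A ->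
  \forall x \ae mu, malg_set (malg_class A) x <-> A x.
Proof.
move=> mA.
have /malg_relE : malg_rel (repr (malg_class A)) (insubd empty_mset A).
  by rewrite -eqmodE reprK.
by rewrite insubdK //; apply/mem_set.
Qed.

Lemma malg_setK (a : MALG) : malg_class (malg_set a) = a.
Proof.
apply/malg_eqP; exact/malg_classK/measurable_malg_set.
Qed.

Lemma malg_class_eqP (A B : set T) : measurable A -> measurable B ->
  malg_class A = malg_class B <-> mu (A `+` B) = 0%E.
Proof.
move=> mA mB; rewrite /malg_class; split.
  move=> /eqP; rewrite eqmodE => /asboolP.
  by rewrite !insubdK //; apply/mem_set.
move=> AB0; apply/eqP; rewrite eqmodE; apply/asboolP.
by rewrite !insubdK //; apply/mem_set.
Qed.

Definition malg_meet (a b : MALG) := malg_class (malg_set a `&` malg_set b).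
Definition malg_join (a b : MALG) := malg_class (malg_set a `|` malg_set b).
Definition malg_compl (a : MALG) := malg_class (~` malg_set a).
Definition malg_bot := malg_class set0.
Definition malg_top := malg_class setT.

Lemma malg_set_meet a b : \forall x \ae mu,
  malg_set (malg_meet a b) x <-> malg_set a x /\ malg_set b x.
Proof. by apply: malg_classK; apply: measurableI; exact: measurable_malg_set. Qed.

Lemma malg_set_join a b : \forall x \ae mu,
  malg_set (malg_join a b) x <-> malg_set a x \/ malg_set b x.
Proof. by apply: malg_classK; apply: measurableU; exact: measurable_malg_set. Qed.

Lemma malg_set_compl a : \forall x \ae mu,
  malg_set (malg_compl a) x <-> ~ malg_set a x.
Proof. by apply: malg_classK; apply: measurableC; exact: measurable_malg_set. Qed.

Lemma malg_set_bot : \forall x \ae mu, ~ malg_set malg_bot x.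
Proof.
by have := malg_classK measurable0; apply: filterS => x [+ _]; exact.
Qed.

Lemma malg_set_top : \forall x \ae mu, malg_set malg_top x.
Proof.
by have := malg_classK measurableT; apply: filterS => x [_]; exact.
Qed.


Let aeI (P Q : T -> Prop) :
  (\forall x \ae mu, P x) -> (\forall x \ae mu, Q x) ->
  \forall x \ae mu, P x /\ Q x.
Proof. by apply: filterS2. Qed.

Fact malg_meetC : commutative malg_meet.
Proof. by move=> a b; rewrite /malg_meet setIC. Qed.

Fact malg_joinC : commutative malg_join.
Proof. by move=> a b; rewrite /malg_join setUC. Qed.

Fact malg_meetA : associative malg_meet.
Proof.
move=> a b c; apply/malg_eqP.
move: (aeI (aeI (malg_set_meet a (malg_meet b c)) (malg_set_meet b c))
  (aeI (malg_set_meet (malg_meet a b) c) (malg_set_meet a b))).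
by apply: filterS => x /=; tauto.
Qed.

Fact malg_joinA : associative malg_join.
Proof.
move=> a b c; apply/malg_eqP.
move: (aeI (aeI (malg_set_join a (malg_join b c)) (malg_set_join b c))
  (aeI (malg_set_join (malg_join a b) c) (malg_set_join a b))).
by apply: filterS => x /=; tauto.
Qed.

Fact malg_joinKI (b a : MALG) : malg_meet a (malg_join a b) = a.
Proof.
apply/malg_eqP.
move: (aeI (malg_set_meet a (malg_join a b)) (malg_set_join a b)).
by apply: filterS => x /=; tauto.
Qed.

Fact malg_meetKU (b a : MALG) : malg_join a (malg_meet a b) = a.
Proof.
apply/malg_eqP.
move: (aeI (malg_set_join a (malg_meet a b)) (malg_set_meet a b)).
by apply: filterS => x /=; tauto.
Qed.

Fact malg_meetUl : left_distributive malg_meet malg_join.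
Proof.
move=> a b c; apply/malg_eqP.
move: (aeI (aeI (malg_set_meet (malg_join a b) c) (malg_set_join a b))
  (aeI (malg_set_join (malg_meet a c) (malg_meet b c))
    (aeI (malg_set_meet a c) (malg_set_meet b c)))).
by apply: filterS => x /=; tauto.
Qed.

Fact malg_meetxx : idempotent_op malg_meet.
Proof. by move=> a; rewrite /malg_meet setIid malg_setK. Qed.

Fact malg_display : Order.disp_t. Proof. exact: Order.Disp tt tt. Qed.

HB.instance Definition _ := Order.isMeetJoinDistrLattice.Build malg_display MALG
  (fun _ _ => erefl) (fun _ _ => erefl)
  malg_meetC malg_joinC malg_meetA malg_joinA malg_joinKI malg_meetKU
  malg_meetUl malg_meetxx.

Fact malg_le0x (a : MALG) : (malg_bot <= a)%O.
Proof.
rewrite leEmeet; apply/eqP/malg_eqP.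
move: (aeI (malg_set_meet malg_bot a) malg_set_bot).
by apply: filterS => x /=; tauto.
Qed.

Fact malg_lex1 (a : MALG) : (a <= malg_top)%O.
Proof.
rewrite leEmeet; apply/eqP/malg_eqP.
move: (aeI (malg_set_meet a malg_top) malg_set_top).
by apply: filterS => x /=; tauto.
Qed.

HB.instance Definition _ := Order.hasBottom.Build malg_display MALG malg_le0x.
HB.instance Definition _ := Order.hasTop.Build malg_display MALG malg_lex1.

Fact malg_joinxC (a : MALG) : (a `|` malg_compl a)%O = \top%O.
Proof.
apply/malg_eqP.
move: (aeI (malg_set_join a (malg_compl a))
  (aeI (malg_set_compl a) malg_set_top)).
by apply: filterS => x /=; case: (pselect (malg_set a x)); tauto.
Qed.

Fact malg_meetxC (a : MALG) : (a `&` malg_compl a)%O = \bot%O.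
Proof.
apply/malg_eqP.
move: (aeI (malg_set_meet a (malg_compl a))
  (aeI (malg_set_compl a) malg_set_bot)).
by apply: filterS => x /=; tauto.
Qed.

HB.instance Definition _ :=
  Order.TBDistrLattice_hasComplement.Build malg_display MALG
    malg_joinxC malg_meetxC.

End MeasureAlgebra.

Arguments malg_class {d T R} mu A.

Definition boolean_isomorphism d1 d2 (A : ctbDistrLatticeType d1)
    (B : ctbDistrLatticeType d2) (F : A -> B) :=
  [/\ bijective F,
      {morph F : x y / (x `&` y)%O},
      {morph F : x y / (x `|` y)%O}
    & {morph F : x / (~` x)%O}].

(** For [w] the class of a measurable set [W], the algebra [below w] is the
    measure algebra of [W] with the restricted measure. *)

Section RelativeAlgebra.
Context d (L : ctbDistrLatticeType d).
Variable w : L.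

Definition below : Type := {a : L | (a <= w)%O}.
HB.instance Definition _ := SubChoice.on below.

Implicit Types a b c : below.

Fact below_meet_le a b : (val a `&` val b <= w)%O.
Proof. by rewrite leIxl //; exact: (valP a). Qed.
Fact below_join_le a b : (val a `|` val b <= w)%O.
Proof. by rewrite leUx; apply/andP; split; [exact: (valP a)|exact: (valP b)]. Qed.

Definition mk_below (a : L) (aw : (a <= w)%O) : below :=
  exist (fun x : L => (x <= w)%O) a aw.

Definition below_meet a b := mk_below (below_meet_le a b).
Definition below_join a b := mk_below (below_join_le a b).
Definition below_compl a := mk_below (leBx w (val a)).
Definition below_bot := mk_below (le0x w).
Definition below_top := mk_below (lexx w).

Fact below_meetC : commutative below_meet.
Proof. by move=> a b; apply/val_inj; exact: meetC. Qed.
Fact below_joinC : commutative below_join.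
Proof. by move=> a b; apply/val_inj; exact: joinC. Qed.
Fact below_meetA : associative below_meet.
Proof. by move=> a b c; apply/val_inj; exact: meetA. Qed.
Fact below_joinA : associative below_join.
Proof. by move=> a b c; apply/val_inj; exact: joinA. Qed.
Fact below_joinKI b a : below_meet a (below_join a b) = a.
Proof. by apply/val_inj; exact: joinKI. Qed.
Fact below_meetKU b a : below_join a (below_meet a b) = a.
Proof. by apply/val_inj; exact: meetKU. Qed.
Fact below_meetUl : left_distributive below_meet below_join.
Proof. by move=> a b c; apply/val_inj; exact: meetUl. Qed.
Fact below_meetxx : idempotent_op below_meet.
Proof. by move=> a; apply/val_inj; exact: meetxx. Qed.

HB.instance Definition _ := Order.isMeetJoinDistrLattice.Build d below
  (fun _ _ => erefl) (fun _ _ => erefl)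
  below_meetC below_joinC below_meetA below_joinA below_joinKI below_meetKU
  below_meetUl below_meetxx.

Fact below_le0x a : (below_bot <= a)%O.
Proof. by rewrite leEmeet; apply/eqP/val_inj; exact: meet0x. Qed.
Fact below_lex1 a : (a <= below_top)%O.
Proof. by rewrite leEmeet; apply/eqP/val_inj; apply/meet_idPl; exact: (valP a). Qed.

HB.instance Definition _ := Order.hasBottom.Build d below below_le0x.
HB.instance Definition _ := Order.hasTop.Build d below below_lex1.

Fact below_joinxC a : (a `|` below_compl a)%O = \top%O.
Proof.
by apply/val_inj; apply: leBKU; exact: (valP a).
Qed.
Fact below_meetxC a : (a `&` below_compl a)%O = \bot%O.
Proof. by apply/val_inj; exact: diffKI. Qed.

HB.instance Definition _ := Order.TBDistrLattice_hasComplement.Build d below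
  below_joinxC below_meetxC.

End RelativeAlgebra.

Section Autstar.
Context d (T : measurableType d) (R : realType).
Variable mu : {measure set T -> \bar R}.

Definition Autstar : Type :=
  {f : MALG mu -> MALG mu | `[< boolean_isomorphism f >]}.
HB.instance Definition _ := SubChoice.on Autstar.

Definition autstar_fun (g : Autstar) : MALG mu -> MALG mu := val g.
Coercion autstar_fun : Autstar >-> Funclass.

Lemma autstar_iso (g : Autstar) : boolean_isomorphism g.
Proof. exact/asboolP/(valP g). Qed.

Definition mk_autstar f (fP : boolean_isomorphism f) : Autstar :=
  exist (fun f : MALG mu -> MALG mu => `[< boolean_isomorphism f >])
    f (asboolT fP).

Lemma autstarP (g h : Autstar) : g =1 h -> g = h.
Proof. by move=> gh; apply/val_inj/funext. Qed.

Fact autstar_one_iso : boolean_isomorphism (@id (MALG mu)).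
Proof. by split=> //; exists id. Qed.

Fact autstar_mul_iso (g h : Autstar) : boolean_isomorphism (g \o h).
Proof.
have [gb gI gU gC] := autstar_iso g; have [hb hI hU hC] := autstar_iso h.
split; first exact: bij_comp.
- by move=> x y /=; rewrite hI gI.
- by move=> x y /=; rewrite hU gU.
- by move=> x /=; rewrite hC gC.
Qed.

Definition autstar_inv_fun (g : Autstar) (b : MALG mu) : MALG mu :=
  xget b [set a | g a = b].

Fact autstar_invK (g : Autstar) : cancel (autstar_inv_fun g) g.
Proof.
move=> b; rewrite /autstar_inv_fun; case: xgetP => [a _ //|nab].
have [[f _ fK] _ _ _] := autstar_iso g.
by case: (nab (f b)); exact: fK.
Qed.

Fact autstar_Kinv (g : Autstar) : cancel g (autstar_inv_fun g).
Proof.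
have [/bij_inj gi _ _ _] := autstar_iso g.
by move=> a; apply: gi; rewrite autstar_invK.
Qed.

Fact autstar_inv_iso (g : Autstar) : boolean_isomorphism (autstar_inv_fun g).
Proof.
have [/bij_inj gi gI gU gC] := autstar_iso g.
split; first by exists g; [exact: autstar_invK|exact: autstar_Kinv].
- by move=> x y; apply: gi; rewrite gI !autstar_invK.
- by move=> x y; apply: gi; rewrite gU !autstar_invK.
- by move=> x; apply: gi; rewrite gC !autstar_invK.
Qed.

Definition autstar_one := mk_autstar autstar_one_iso.
Definition autstar_mul (g h : Autstar) := mk_autstar (autstar_mul_iso g h).
Definition autstar_inv (g : Autstar) := mk_autstar (autstar_inv_iso g).

Fact autstar_mulA : associative autstar_mul.
Proof. by move=> f g h; apply: autstarP. Qed.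
Fact autstar_mul1g : left_id autstar_one autstar_mul.
Proof. by move=> g; apply: autstarP. Qed.
Fact autstar_mulg1 : right_id autstar_one autstar_mul.
Proof. by move=> g; apply: autstarP. Qed.
Fact autstar_mulVg : left_inverse autstar_one autstar_inv autstar_mul.
Proof. by move=> g; apply: autstarP => a; exact: autstar_Kinv. Qed.
Fact autstar_mulgV : right_inverse autstar_one autstar_inv autstar_mul.
Proof. by move=> g; apply: autstarP => a; exact: autstar_invK. Qed.

HB.instance Definition _ := isGroup.Build Autstar
  autstar_mulA autstar_mul1g autstar_mulg1 autstar_mulVg autstar_mulgV.

(** [f \o g^-1] for a measurable [f : T -> R]: the function [h], unique up to
    a.e. equality, such that [h @^-1` B] represents [g . [f @^-1` B]] for every
    Borel set [B]. *)
Definition transport (g : Autstar) (f : T -> R) : T -> R :=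
  xget (cst 0) [set h : T -> R | measurable_fun setT h /\
    forall B : set R, measurable B ->
      malg_class mu (h @^-1` B) = g (malg_class mu (f @^-1` B))].

(** The Radon-Nikodym derivative of [g_* mu : A |-> mu (g^-1 . A)]. *)
Definition RN_derivative (g : Autstar) : T -> R :=
  xget (cst 0) [set r : T -> R | [/\ measurable_fun setT r,
    forall x, 0 <= r x &
    forall A : set T, measurable A ->
      (\int[mu]_(x in A) (r x)%:E)%E =
        mu (malg_set ((g^-1%g : Autstar) (malg_class mu A)))]].

(** Complex [L^2 (T, mu)]; its elements are handled through representatives. *)
Definition L2norm (f : T -> R[i]) : \bar R :=
  Lnorm mu 2%:E (fun x => (Normc.normc (f x))%:E).

Definition L2 : set (T -> R[i]) :=
  [set f | [/\ measurable_fun setT (fun x => complex.Re (f x)),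
               measurable_fun setT (fun x => complex.Im (f x))
             & (L2norm f < +oo)%E]].

Definition koopman (g : Autstar) (f : T -> R[i]) : T -> R[i] :=
  fun x => ((Num.sqrt (RN_derivative g x))%:C *
    (transport g (fun y => complex.Re (f y)) x +i*
     transport g (fun y => complex.Im (f y)) x))%C.

(** The pullback along [koopman] of the strong operator topology, for which
    the sets [{u | ||u f - h|| < e}] form a subbasis. *)
Definition koopman_sot_subbasis : set (set Autstar) :=
  [set U | exists f h (e : R), [/\ L2 f, L2 h, 0 < e &
    U = [set g | (L2norm (fun x => (koopman g f x - h x)%R) < e%:E)%E]]].

HB.instance Definition _ :=
  isSubBaseTopological.Build Autstar koopman_sot_subbasis id.

End Autstar.

Record nonsingular_action (G : topologicalGroupType) d (T : measurableType d)
    (R : realType) (mu : {measure set T -> \bar R}) := NonsingularAction {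
  nsa_fun :> G -> Autstar mu;
  nsa_mul : {morph nsa_fun : x y / (x * y)%g};
  nsa_continuous : continuous nsa_fun
}.

(** [nu] need not be [mu], but should be absolutely continuous with respect to
    [mu], so that it is well defined on [MALG mu]. *)
Definition preserves_measure (G : topologicalGroupType) d (T : measurableType d)
    (R : realType) (mu : {measure set T -> \bar R})
    (phi : nonsingular_action G mu) (nu : set T -> \bar R) :=
  forall (g : G) (a : MALG mu), nu (malg_set (phi g a)) = nu (malg_set a).

Definition isomorphic_actions (G : Type) d1 d2 (A : ctbDistrLatticeType d1)
    (B : ctbDistrLatticeType d2) (phi : G -> A -> A) (psi : G -> B -> B) :=
  exists2 F : A -> B, boolean_isomorphism F &
    forall g a, F (phi g a) = psi g (F a).

Section Restriction.
Context (G : topologicalGroupType) d (T : measurableType d) (R : realType).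
Context (mu : {measure set T -> \bar R}) (phi : nonsingular_action G mu).

Definition invariant_element (w : MALG mu) := forall g : G, phi g w = w.

Variables (w : MALG mu) (winv : invariant_element w).

Fact restrict_le (g : G) (a : below w) : (phi g (val a) <= w)%O.
Proof.
have [_ phiI _ _] := autstar_iso (phi g).
apply/meet_idPl; rewrite -[X in (_ `&` X)%O](winv g) -phiI;
  congr (phi g _); apply/meet_idPl; exact: (valP a).
Qed.

Definition restrict_action (g : G) (a : below w) : below w :=
  mk_below (restrict_le g a).

End Restriction.

Section LeftCosets.
Context (G : topologicalGroupType) (V : openSubgroup G).

Definition lcoset_rel (x y : G) : bool := (x^-1 * y)%g \in osg_set V.

Let lcoset_rel_refl : reflexive lcoset_rel.
Proof. by move=> x; rewrite /lcoset_rel mulVg; apply/mem_set; exact: osg1. Qed.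

Let lcoset_rel_inv x y : lcoset_rel x y -> lcoset_rel y x.
Proof.
move=> /set_mem /(@osgV _ V) Vyx; apply/mem_set.
by rewrite invgM invgK in Vyx.
Qed.

Let lcoset_rel_sym : symmetric lcoset_rel.
Proof. by move=> x y; apply/idP/idP; exact: lcoset_rel_inv. Qed.

Let lcoset_rel_trans : transitive lcoset_rel.
Proof.
move=> y x z /set_mem Vxy /set_mem Vyz; apply/mem_set.
by have := osgM Vxy Vyz; rewrite -mulgA mulVKg.
Qed.

Canonical lcoset_rel_equiv :=
  EquivRel lcoset_rel lcoset_rel_refl lcoset_rel_sym lcoset_rel_trans.

Definition lcosets : Type := {eq_quot lcoset_rel}.
HB.instance Definition _ := Choice.on lcosets.
HB.instance Definition _ := EqQuotient.on lcosets.
HB.instance Definition _ := isPointed.Build lcosets (\pi_lcosets 1%g).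
HB.instance Definition _ := @isMeasurable.Build default_measure_display lcosets
  discrete_measurable discrete_measurable0
  (@discrete_measurableC _) (@discrete_measurableU _).

Definition lcoset_act (g : G) (c : lcosets) : lcosets :=
  \pi_lcosets (g * repr c)%g.

Lemma lcoset_eqP (x y : G) :
  \pi_lcosets x = \pi_lcosets y <-> osg_set V (x^-1 * y)%g.
Proof.
split=> [/eqP|Vxy]; first by rewrite eqmodE => /set_mem.
by apply/eqP; rewrite eqmodE; apply/mem_set.
Qed.

Lemma lcoset_act_pi (g h : G) :
  lcoset_act g (\pi_lcosets h) = \pi_lcosets (g * h)%g.
Proof.
apply/lcoset_eqP; rewrite invgM -mulgA mulKg; apply/lcoset_eqP.
by rewrite reprK.
Qed.

Record coset_section := CosetSection {
  sec_fun :> lcosets -> G;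
  sec_pi : cancel sec_fun \pi_lcosets
}.

Variable s : coset_section.

Fact cocycle_subproof (g : G) (c : lcosets) :
  ((s (lcoset_act g c))^-1 * g * s c)%g \in osg_set V.
Proof.
apply/mem_set; rewrite -mulgA; apply/lcoset_eqP.
by rewrite sec_pi -lcoset_act_pi sec_pi.
Qed.

Definition cocycle (g : G) (c : lcosets) : subgroup_type V :=
  exist (fun x : G => x \in osg_set V) _ (cocycle_subproof g c).

Context d (X : measurableType d) (R : realType).
Variable nu : {sigma_finite_measure set X -> \bar R}.

Definition coset_counting : {measure set lcosets -> \bar R} := @counting lcosets R.

Definition ind_measure : {measure set (lcosets * X) -> \bar R} :=
  (coset_counting \x nu)%E.

Definition slice (c : lcosets) (a : MALG nu) : MALG ind_measure :=
  malg_class ind_measure ([set c] `*` malg_set a).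

Lemma slice_class (c : lcosets) (A : set X) : measurable A ->
  slice c (malg_class nu A) = malg_class ind_measure ([set c] `*` A).
Proof.
move=> mA; set A' := malg_set (malg_class nu A).
have mA' : measurable A' by exact: measurable_malg_set.
have AA' : nu (A' `+` A) = 0%E.
  by apply/malg_class_eqP => //; rewrite malg_setK.
have mc : measurable [set c] by [].
apply/malg_class_eqP; [exact: measurableX|exact: measurableX|].
have -> : ([set c] `*` A') `+` ([set c] `*` A) = [set c] `*` (A' `+` A).
  by apply/seteqP; split=> -[x y] /=; rewrite /setY /=; tauto.
rewrite /ind_measure/= product_measure1E //; last first.
  by apply: measurableU; exact: measurableD.
by rewrite AA' mule0.
Qed.

(** [beta] is [Ind_V^G (alpha)], computed with the section [s]. The equation
    determines [beta] as soon as [G/V] is countable. *)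
Definition is_induced (alpha : nonsingular_action (subgroup_type V) nu)
    (beta : nonsingular_action G ind_measure) :=
  forall (g : G) (c : lcosets) (a : MALG nu),
    beta g (slice c a) = slice (lcoset_act g c) (alpha (cocycle g c) a).

End LeftCosets.

(* Main.v *)
From HB Require Import structures.
From mathcomp Require Import all_boot all_order all_algebra.
From mathcomp Require Import all_classical all_reals all_analysis.
From mathcomp Require Import measurable_realfun complex ring lra.
Require Import Defs.

Set Implicit Arguments.
Unset Strict Implicit.
Unset Printing Implicit Defensive.

Import Order.TTheory GRing.Theory Num.Theory.
Import numFieldTopology.Exports numFieldNormedType.Exports.

Local Open Scope ring_scope.
Local Open Scope classical_set_scope.

(** Call [k' = g k] the image of [k >= 0] in L^2(mu) under the Koopman operator
    of [g]: the measure [k'^2 mu] is the push-forward of [k^2 mu]. These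
    operators preserve inner products and depend continuously on [g].

    Let [w] be a non-null invariant set. A vector of minimal norm in a suitable
    convex set is a nonzero [f >= 0] supported in [w] and fixed by an open
    subgroup, so by Roelcke precompactness the inner products [<g f, f>] form a
    finite set [D]. If [k] has minimal nonzero norm among the weak limits of
    translates of [f], then all [<g k, k>] lie in [D]; hence the stabilizer of
    [k] is open and, by minimality, only finitely many translates of [k] are not
    orthogonal to [k]. Intersecting the supports of a maximal family of
    translates of [k] with non-null intersection gives a set [A <= w] each of
    whose translates is either [A] or disjoint from [A]. Its stabilizer [V] is
    open, and the squares of the members of the family sum up to a finite
    [V]-invariant measure in the class of [mu] on [A]. The action of [G] on the
    saturation of [A] is thus induced from a probability measure-preserving
    action of [V], and a maximal disjoint family of such saturations exhausts
    the space. *)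

(** * Measure algebras *)

(** Everything takes place among nonnegative functions. Koopman operators preserve this cone, an
    element [k] of it is determined by the finite measure [k ^ 2 mu], and two elements are
    orthogonal exactly when their supports are disjoint up to a null set: so finiteness of inner
    products turns into combinatorics of sets. Subtraction leaves the cone, hence distances are
    written through inner products.

    The vector [f] alone would not do: infinitely many translates of [f] that are not orthogonal to
    it may converge weakly to a shorter nonzero vector. A shortest nonzero limit [k] excludes this,
    and it exists because squared norms of weak limits stay in the finite set [D].

    The strong operator topology enters in two directions. Continuity of the given action makes
    [g k] tend to [k]. Continuity of the new actions, on a cell and on [G/V x X], has to be proved;
    as they preserve a measure, it is enough that [psi h b] contains nearly all of [b], for [b] of
    finite measure and [h] near the identity, and this is inherited from the given action. *)

Section AlmostEverywhere.
Context d (T : measurableType d) (R : realType).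
Implicit Types (mu nu : {measure set T -> \bar R}).

Lemma ae_and mu (P Q : T -> Prop) :
  (\forall x \ae mu, P x) -> (\forall x \ae mu, Q x) ->
  \forall x \ae mu, P x /\ Q x.
Proof. by apply: filterS2. Qed.

Lemma dominates0 nu mu A : nu `<< mu -> measurable A ->
  mu A = 0%E -> nu A = 0%E.
Proof. by move=> /null_content_dominatesP; exact. Qed.

Lemma dominates_ae nu mu (P : T -> Prop) : nu `<< mu ->
  (\forall x \ae mu, P x) -> \forall x \ae nu, P x.
Proof.
move=> numu [A [mA A0 PA]]; exists A; split => //.
exact: dominates0 A0.
Qed.

Lemma dominates_refl mu : mu `<< mu. Proof. by []. Qed.

Lemma ae_measure_eq mu (A B : set T) : measurable A -> measurable B ->
  (\forall x \ae mu, A x <-> B x) -> mu A = mu B.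
Proof.
move=> mA mB [N [mN N0 NAB]].
have mNC : measurable (~` N) by exact: measurableC.
have H C : measurable C -> mu C = mu (C `&` ~` N).
  move=> mC; rewrite -[in LHS](setIT C) -(setUv N) setIUr measureU//.
  - rewrite [X in (X + _)%E](_ : _ = 0%E) ?add0e//.
    by apply: (subset_measure0 _ _ _ N0) => //; exact: measurableI.
  - exact: measurableI.
  - exact: measurableI.
  - by rewrite setIACA setICr setI0.
rewrite (H _ mA) (H _ mB); congr (mu _); apply/seteqP.
have AB x : ~ N x -> (A x <-> B x) by move=> nN; apply: contrapT => /NAB.
by split => x [] h nN; split=> //; apply/(AB x).
Qed.

Lemma measure0_aeP mu (A : set T) : measurable A ->
  mu A = 0%E <-> \forall x \ae mu, ~ A x.
Proof.
move=> mA; split=> [A0|[N [mN N0 NA]]].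
  by exists A; split => // x /=; exact: contrapT.
by apply: (subset_measure0 mA mN _ N0) => x Ax; apply: NA => /(_ Ax).
Qed.

(** Representatives of disjoint elements of a measure algebra may overlap in null sets. Making them
    disjoint changes each by a null set only, so countable additivity survives. *)
Lemma ae_disjoint_cvg_measure mu (S : nat -> set T) :
  (forall n, measurable (S n)) ->
  (forall i j, i != j -> \forall x \ae mu, ~ (S i x /\ S j x)) ->
  (fun n => \sum_(0 <= i < n) mu (S i))%E @ \oo --> mu (\bigcup_n S n).
Proof.
move=> mS dS; have mD := seqDU_measurable mS.
have := @measure_semi_sigma_additive _ _ _ mu (seqDU S) mD
  (trivIset_seqDU S) (bigcup_measurable (fun n _ => mD n)).
rewrite -seqDU_bigcup_eq.
under eq_fun do under eq_bigr => i _ do [idtac].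
rewrite [X in X @ _ --> _ -> _](_ : _ = (fun n => \sum_(0 <= i < n) mu (S i))%E)//.
apply/funext => n; apply: eq_bigr => i _; apply: ae_measure_eq => //.
have : \forall x \ae mu, forall j, j != i -> ~ (S i x /\ S j x).
  apply: ae_foralln => j; have [->|ji] := eqVneq j i; first exact: aeW.
  by apply: filterS (dS i j _) => //; rewrite eq_sym.
apply: filterS => x nS; split; first exact: subset_seqDU.
move=> Six; split => //; rewrite -bigcup_mkord => -[j /= ji Sjx].
by apply: (nS j); rewrite ?ltn_eqF.
Qed.

End AlmostEverywhere.

Section MalgBasics.
Context d (T : measurableType d) (R : realType) (mu : {measure set T -> \bar R}).
Implicit Types (a b : MALG mu) (A B : set T).

Lemma malg_class_aeP A B : measurable A -> measurable B ->
  malg_class mu A = malg_class mu B <-> \forall x \ae mu, A x <-> B x.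
Proof.
move=> mA mB; rewrite malg_eqP.
have hAB := ae_and (malg_classK mu mA) (malg_classK mu mB).
by split; apply: filterS2 hAB => x; tauto.
Qed.

Lemma malg_leP a b :
  (a <= b)%O <-> \forall x \ae mu, malg_set a x -> malg_set b x.
Proof.
rewrite leEmeet; split=> [/eqP/malg_eqP|ab]; last apply/eqP/malg_eqP.
  by apply: filterS2 (malg_set_meet a b) => x; tauto.
by apply: filterS2 (malg_set_meet a b) ab => x; rewrite /Order.meet/=; tauto.
Qed.

Lemma malg_classI A B : measurable A -> measurable B ->
  malg_class mu (A `&` B) = (malg_class mu A `&` malg_class mu B)%O.
Proof.
move=> mA mB; rewrite [RHS]/Order.meet/= /malg_meet.
apply/malg_class_aeP; [exact: measurableI|
  by apply: measurableI; exact: measurable_malg_set|].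
apply: filterS2 (malg_classK mu mA) (malg_classK mu mB) => x /=.
by rewrite /setI/=; tauto.
Qed.

Lemma malg_classC A : measurable A ->
  malg_class mu (~` A) = (~` malg_class mu A)%O.
Proof.
move=> mA; rewrite [RHS]/Order.compl/= /malg_compl.
apply/malg_class_aeP; [exact: measurableC|
  by apply: measurableC; exact: measurable_malg_set|].
by apply: filterS (malg_classK mu mA) => x /=; rewrite /setC/=; tauto.
Qed.

Lemma malg_class0 : malg_class mu set0 = \bot%O. Proof. by []. Qed.

Lemma malg_classT : malg_class mu setT = \top%O. Proof. by []. Qed.

Lemma malg_class_eq0 A : measurable A -> malg_class mu A = \bot%O <-> mu A = 0%E.
Proof.
move=> mA; rewrite -malg_class0 malg_class_aeP// measure0_aeP//.
by split; apply: filterS => x /=; tauto.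
Qed.

Lemma malg_bot_aeP a : a = \bot%O <-> \forall x \ae mu, ~ malg_set a x.
Proof.
have ma := measurable_malg_set a.
by rewrite -{1}[a]malg_setK malg_class_eq0// measure0_aeP.
Qed.

(** The countable join. Chosen representatives appear in the formula, but [malg_sup_ub] and
    [malg_sup_lub] characterize the result as a least upper bound. *)
Definition malg_sup (a : nat -> MALG mu) := malg_class mu (\bigcup_n malg_set (a n)).

Lemma malg_set_sup (a : nat -> MALG mu) : \forall x \ae mu,
  malg_set (malg_sup a) x <-> exists n, malg_set (a n) x.
Proof.
have : measurable (\bigcup_n malg_set (a n)).
  by apply: bigcup_measurable => n _; exact: measurable_malg_set.
move=> /(malg_classK mu); apply: filterS => x ->; split=> [[n _ h]|[n h]].
  by exists n.
by exists n.
Qed.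

Lemma malg_sup_ub (a : nat -> MALG mu) n : (a n <= malg_sup a)%O.
Proof.
by apply/malg_leP; apply: filterS (malg_set_sup a) => x ->; exists n.
Qed.

Lemma malg_sup_lub (a : nat -> MALG mu) b :
  (forall n, a n <= b)%O -> (malg_sup a <= b)%O.
Proof.
move=> ab; apply/malg_leP.
have /ae_foralln : forall n, \forall x \ae mu, malg_set (a n) x -> malg_set b x.
  by move=> n; apply/malg_leP.
by apply: filterS2 (malg_set_sup a) => x -> h [n]; exact: h.
Qed.

Lemma malg_class_bigcup (A : nat -> set T) : (forall n, measurable (A n)) ->
  malg_class mu (\bigcup_n A n) = malg_sup (fun n => malg_class mu (A n)).
Proof.
move=> mA; apply/malg_class_aeP.
- exact: bigcup_measurable.
- by apply: bigcup_measurable => n _; exact: measurable_malg_set.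
- have /ae_foralln := fun n => malg_classK mu (mA n).
  by apply: filterS => x h; split => -[n _ /h An]; exists n.
Qed.

Lemma malg_meet_sup a (b : nat -> MALG mu) :
  (a `&` malg_sup b)%O = malg_sup (fun n => (a `&` b n)%O).
Proof.
apply/malg_eqP.
have /ae_foralln := fun n => malg_set_meet a (b n).
have := ae_and (malg_set_meet a (malg_sup b))
  (ae_and (malg_set_sup b) (malg_set_sup (fun n => (a `&` b n)%O))).
apply: filterS2 => x [-> [-> ->]] h; split=> [[ax [n bx]]|[n /h[ax bx]]].
  by exists n; apply/h.
by split=> //; exists n.
Qed.

End MalgBasics.

(** * Homomorphisms of measure algebras and pull-back of measures *)

Section SigmaHom.
Context d1 (T1 : measurableType d1) d2 (T2 : measurableType d2) (R : realType).
Context (mu1 : {measure set T1 -> \bar R}) (mu2 : {measure set T2 -> \bar R}).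

(** What pulling back a measure requires: disjointness and countable joins are preserved. *)
Definition sigma_hom (J : MALG mu1 -> MALG mu2) :=
  [/\ J \bot%O = \bot%O, {morph J : a b / (a `&` b)%O}
    & forall a : nat -> MALG mu1, J (malg_sup a) = malg_sup (J \o a)].

(** A countable join is a least upper bound, which an order isomorphism preserves. *)
Lemma boolean_isomorphism_sigma_hom (J : MALG mu1 -> MALG mu2) :
  boolean_isomorphism J -> sigma_hom J.
Proof.
move=> [[K JK KJ] JI JU JC].
have Jle a b : (J a <= J b)%O = (a <= b)%O.
  rewrite !leEmeet -JI; apply/eqP/eqP => [/(can_inj JK)//|->//].
split=> // [|a].
  by apply/eqP; rewrite -lex0 -(KJ \bot%O) Jle le0x.
apply/eqP; rewrite eq_le; apply/andP; split.
  rewrite -[X in (_ <= X)%O]KJ Jle; apply: malg_sup_lub => n.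
  by rewrite -Jle KJ; exact: malg_sup_ub.
by apply: malg_sup_lub => n /=; rewrite Jle; exact: malg_sup_ub.
Qed.

Variables (J : MALG mu1 -> MALG mu2) (hJ : sigma_hom J).
Variables (m : {measure set T2 -> \bar R}) (hm : m `<< mu2).

(** With [J] the inverse of an automorphism [g], this is the push-forward of [m] by [g]. *)
Definition pullback_measure (A : set T1) : \bar R :=
  m (malg_set (J (malg_class mu1 A))).

(** The proof arguments let the measure instance below be inferred. *)
Definition pullback_measure_of of sigma_hom J & m `<< mu2 := pullback_measure.

Local Notation pm := (pullback_measure_of hJ hm).

Let pm0 : pm set0 = 0%E.
Proof.
rewrite /pullback_measure_of /pullback_measure malg_class0.
have [-> _ _] := hJ.
apply: (dominates0 hm); first exact: measurable_malg_set.
apply/measure0_aeP; first exact: measurable_malg_set.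
exact: malg_set_bot.
Qed.

Let pm_ge0 A : (0 <= pm A)%E.
Proof. exact: measure_ge0. Qed.

Let pm_sigma_additive : semi_sigma_additive pm.
Proof.
move=> F mF tF mUF; rewrite /pullback_measure_of /pullback_measure.
have [J0 JI JS] := hJ.
rewrite malg_class_bigcup// JS.
have mS n : measurable (malg_set (J (malg_class mu1 (F n)))).
  exact: measurable_malg_set.
rewrite [X in _ --> X](_ : _ = m (\bigcup_n malg_set (J (malg_class mu1 (F n))))); last first.
  have mU : measurable (\bigcup_n malg_set (J (malg_class mu1 (F n)))).
    by apply: bigcup_measurable => n _; exact: mS.
  apply: ae_measure_eq => //; first exact: measurable_malg_set.
  by apply: (dominates_ae hm); exact: malg_classK.
apply: ae_disjoint_cvg_measure => // i j ij.
apply: (dominates_ae hm).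
have := malg_set_meet (J (malg_class mu1 (F i))) (J (malg_class mu1 (F j))).
have -> : malg_meet (J (malg_class mu1 (F i))) (J (malg_class mu1 (F j))) = \bot%O.
  rewrite -[LHS]JI -malg_classI//.
  by move/trivIsetP : tF => -> //.
by apply: filterS2 (malg_set_bot mu2) => x; tauto.
Qed.

HB.instance Definition _ := isMeasure.Build _ _ _ pm pm0 pm_ge0 pm_sigma_additive.

Lemma pullback_measureE a : pm (malg_set a) = m (malg_set (J a)).
Proof. by rewrite /pullback_measure_of /pullback_measure malg_setK. Qed.

Lemma pullback_measure_dominates : pm `<< mu1.
Proof.
apply/null_content_dominatesP => A mA A0.
rewrite /pullback_measure_of /pullback_measure.
by have -> : malg_class mu1 A = malg_class mu1 set0;
  [exact/malg_class_eq0|exact: pm0].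
Qed.

End SigmaHom.

Section NonnegInduction.
Local Open Scope ereal_scope.
Context d (T : measurableType d) (R : realType).

Import HBNNSimple.

(** A nonnegative measurable function is an increasing limit of simple functions, and these are sums
    of nonnegative multiples of indicators. *)
Lemma nonneg_measurable_ind (P : (T -> \bar R) -> Prop) :
  (forall B, measurable B -> P (fun x => (\1_B x)%:E)) ->
  (forall (c : R) (f : T -> \bar R), (0 <= c)%R -> measurable_fun setT f -> (forall x, 0 <= f x) ->
     P f -> P (fun x => c%:E * f x)) ->
  (forall f g : T -> \bar R, measurable_fun setT f -> (forall x, 0 <= f x) ->
     measurable_fun setT g -> (forall x, 0 <= g x) ->
     P f -> P g -> P (fun x => f x + g x)) ->
  (forall f : nat -> T -> \bar R, (forall n, measurable_fun setT (f n)) ->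
     (forall n x, 0 <= f n x) -> (forall x, nondecreasing_seq (f ^~ x)) ->
     (forall n, P (f n)) -> P (fun x => limn (f ^~ x))) ->
  forall f, measurable_fun setT f -> (forall x, 0 <= f x) -> P f.
Proof.
move=> P1 PZ PD PL f mf f0; pose f_ := nnsfun_approx measurableT mf.
have -> : f = fun x => limn (fun n => (f_ n x)%:E).
  apply/funext => x; apply/esym/cvg_lim => //.
  by apply: cvg_nnsfun_approx => // y _; exact: f0.
apply: PL => [n|n x|x m n mn|n].
- exact/measurable_EFinP/measurable_funP.
- by rewrite lee_fin.
- by rewrite lee_fin; exact/lefP/nd_nnsfun_approx.
set h := f_ n.
have -> : (fun x => (h x)%:E) = (fun x =>
    \sum_(k <- finmap.enum_fset (fset_set (range h))) (k * \1_(h @^-1` [set k]) x)%:E).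
  by apply/funext => x; rewrite [in LHS]fimfunE -fsumEFin// fsbig_finite.
have r0 k : k \in finmap.enum_fset (fset_set (range h)) -> (0 <= k)%R.
  by rewrite in_fset_set// => /set_mem[x _ <-].
elim: (finmap.enum_fset (fset_set (range h))) r0 => [|k s IH] r0.
  under eq_fun do rewrite big_nil.
  have -> : (fun=> 0) = (fun x : T => (\1_(@set0 T) x)%:E) :> (T -> \bar R).
    by apply/funext => x; rewrite indic0.
  exact: P1.
under eq_fun do rewrite big_cons.
have s0 j : j \in s -> (0 <= j)%R by move=> js; apply: r0; rewrite inE js orbT.
have k0 : (0 <= k)%R by apply: r0; rewrite mem_head.
have mi j : measurable_fun setT (fun x => (j * \1_(h @^-1` [set j]) x)%:E).
  by apply/measurable_EFinP; exact: measurable_funM.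
apply: PD => //.
- by move=> x; rewrite lee_fin mulr_ge0.
- exact: emeasurable_sum.
- by move=> x; rewrite big_seq; apply: sume_ge0 => j /s0 j0; rewrite lee_fin mulr_ge0.
- under eq_fun do rewrite EFinM.
  apply: PZ => //; first exact/measurable_EFinP.
  exact: P1.
- exact: IH.
Qed.

End NonnegInduction.

(** * Measures given by a density *)

Section Density.
Local Open Scope ereal_scope.
Context d (T : measurableType d) (R : realType) (mu : {measure set T -> \bar R}).
Variables (f : T -> R) (mf : measurable_fun setT f) (f0 : forall x, (0 <= f x)%R).

Definition density (A : set T) : \bar R := \int[mu]_(x in A) (f x)%:E.

(** As for [pullback_measure_of], the proof arguments let the measure instance be inferred. *)
Definition density_of of measurable_fun setT f & (forall x, (0 <= f x)%R) := density.

Local Notation fmu := (density_of mf f0).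

Let density0 : fmu set0 = 0. Proof. exact: integral_set0. Qed.

Let density_ge0 A : 0 <= fmu A.
Proof. by apply: integral_ge0 => x _; rewrite lee_fin. Qed.

Let density_sigma_additive : semi_sigma_additive fmu.
Proof.
apply: semi_sigma_additive_nng_induced; first exact/measurable_EFinP.
by move=> x; rewrite lee_fin.
Qed.

HB.instance Definition _ :=
  isMeasure.Build _ _ _ fmu density0 density_ge0 density_sigma_additive.

Lemma density_dominates : fmu `<< mu.
Proof.
apply/null_content_dominatesP => A mA A0.
rewrite /density_of /density.
rewrite (eq_integral (fun x => `|(f x)%:E|)); last first.
  by move=> x _; rewrite /= ger0_norm.
by apply: integral_abs_eq0 => //; apply: measurable_funTS; exact/measurable_EFinP.
Qed.

Lemma integral_densityT (h : T -> \bar R) : measurable_fun setT h ->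
  (forall x, 0 <= h x) -> \int[fmu]_x h x = \int[mu]_x (h x * (f x)%:E).
Proof.
have mfE : measurable_fun setT (EFin \o f) by exact/measurable_EFinP.
apply: (nonneg_measurable_ind (P := fun h => \int[fmu]_x h x = \int[mu]_x (h x * (f x)%:E))).
- move=> B mB; rewrite integral_indic// setIT.
  rewrite /= /density_of /density integral_mkcond; apply: eq_integral => x _.
  by rewrite patchE indicE; case: ifPn; rewrite ?mul1e ?mul0e.
- move=> c g c0 mg g0 IH; rewrite ge0_integralZl_EFin// IH.
  under [RHS]eq_integral do rewrite -muleA.
  rewrite ge0_integralZl_EFin//.
  + by move=> x _; rewrite mule_ge0// lee_fin.
  + exact: emeasurable_funM.
- move=> g1 g2 mg1 g10 mg2 g20 IH1 IH2; rewrite ge0_integralD// IH1 IH2.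
  under [RHS]eq_integral do rewrite ge0_muleDl//.
  by rewrite ge0_integralD//; do ?[exact: emeasurable_funM];
    move=> x _; rewrite mule_ge0// lee_fin.
- move=> g mg g0 ndg IH; rewrite monotone_convergence//.
  rewrite (eq_integral (fun x => limn (fun n => g n x * (f x)%:E))); last first.
    move=> x _; rewrite limeMr//; apply: ereal_nondecreasing_is_cvgn.
    exact: ndg.
  rewrite monotone_convergence//.
  + by congr (limn _); apply/funext => n.
  + by move=> n; exact: emeasurable_funM.
  + by move=> n x _; rewrite mule_ge0// lee_fin.
  + by move=> x _ m n mn; rewrite lee_wpmul2r ?lee_fin//; exact: ndg.
Qed.

Lemma integral_density (h : T -> \bar R) B : measurable B ->
  measurable_fun setT h -> (forall x, 0 <= h x) ->
  \int[fmu]_(x in B) h x = \int[mu]_(x in B) (h x * (f x)%:E).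
Proof.
move=> mB mh h0; rewrite [LHS]integral_mkcond [LHS]integral_densityT.
- rewrite [RHS]integral_mkcond; apply: eq_integral => x _.
  by rewrite !patchE; case: ifPn; rewrite ?mul0e.
- exact/(measurable_restrictT _ _).1/measurable_funTS.
- by move=> x; rewrite patchE; case: ifPn.
Qed.

End Density.

(** * Transport of functions by automorphisms *)

Section Transport.
Context d (T : measurableType d) (R : realType) (mu : {measure set T -> \bar R}).
Implicit Types (g : Autstar mu) (f h : T -> R).

Lemma autstar_sigma_hom g : sigma_hom g.
Proof. exact/boolean_isomorphism_sigma_hom/autstar_iso. Qed.

Lemma autstarI g : {morph g : a b / (a `&` b)%O}.
Proof. by have [] := autstar_iso g. Qed.

Lemma autstarC g : {morph g : a / (~` a)%O}.
Proof. by have [] := autstar_iso g. Qed.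

Lemma autstar0 g : g \bot%O = \bot%O.
Proof. by have [] := autstar_sigma_hom g. Qed.

Lemma autstar1 g : g \top%O = \top%O.
Proof. by rewrite -(@Order.CTBDistrLatticeTheory.compl0 _ (MALG mu)) autstarC autstar0. Qed.

Lemma autstar_sup g (a : nat -> MALG mu) :
  g (malg_sup a) = malg_sup (fun n => g (a n)).
Proof. by have [_ _ ->] := autstar_sigma_hom g. Qed.

Lemma autstar_le g a b : (g a <= g b)%O = (a <= b)%O.
Proof.
have [/bij_inj gi _ _ _] := autstar_iso g.
by rewrite !leEmeet -autstarI (inj_eq gi).
Qed.

Lemma autstarVK g a : (g^-1%g : Autstar mu) (g a) = a.
Proof. exact: autstar_Kinv. Qed.

Lemma autstarKV g a : g ((g^-1%g : Autstar mu) a) = a.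
Proof. exact: autstar_invK. Qed.

Definition is_transport g f h := measurable_fun setT h /\
  forall B : set R, measurable B ->
    malg_class mu (h @^-1` B) = g (malg_class mu (f @^-1` B)).

Lemma measurable_preimage f (B : set R) :
  measurable_fun setT f -> measurable B -> measurable (f @^-1` B).
Proof. by move=> mf mB; rewrite -[X in measurable X]setTI; exact: mf. Qed.

Lemma measurable_ray (t : R) : measurable [set y | y < t].
Proof. by have := @measurable_itv R `]-oo, t[%R; rewrite set_itvE. Qed.

(** The Borel sets satisfying the identity form a sigma-algebra, because [g] commutes with
    complements and countable joins; open rays generate. *)
Lemma is_transport_rays g f h : measurable_fun setT f -> measurable_fun setT h ->
  (forall t : R, malg_class mu (h @^-1` [set y | y < t]) =
    g (malg_class mu (f @^-1` [set y | y < t]))) ->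
  is_transport g f h.
Proof.
move=> mf mh hyp; split => // B mB.
pose S := [set C : set R | measurable C /\
  malg_class mu (h @^-1` C) = g (malg_class mu (f @^-1` C))].
suff : S B by case.
move: mB; rewrite -[measurable B]/((@ocitv R).-sigma.-measurable B).
rewrite RGenInftyO.measurableE; apply: smallest_sub.
- split => [|C [mC eC]|F SF].
  + by split => //; rewrite !preimage_set0 malg_class0 autstar0.
  + split; first by rewrite setTD; exact: measurableC.
    have [mhC mfC] := (measurable_preimage mh mC, measurable_preimage mf mC).
    rewrite setTD -[h @^-1` _]/(~` (h @^-1` C)) -[f @^-1` _]/(~` (f @^-1` C)).
    by rewrite (malg_classC mu mhC) (malg_classC mu mfC) eC autstarC.
  + split; first by apply: bigcup_measurable => n _; exact: (SF n).1.
    rewrite !preimage_bigcup !malg_class_bigcup ?autstar_sup.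
    * by congr malg_sup; apply/funext => n; exact: (SF n).2.
    * by move=> n; apply: measurable_preimage => //; exact: (SF n).1.
    * by move=> n; apply: measurable_preimage => //; exact: (SF n).1.
- by move=> _ [t ->]; rewrite set_itvE; split; [exact: measurable_ray|exact: hyp].
Qed.

Let ratn (n : nat) : R := ratr (odflt 0 (unpickle n : option rat)).

Let ratnP (s t : R) : s < t -> exists n, s < ratn n < t.
Proof.
move=> /rat_in_itvoo[q]; rewrite in_itv/= => qst.
by exists (pickle q); rewrite /ratn pickleK.
Qed.

(** [h x] is the infimum of the rationals [q] with [x] in [g {f < q}]. *)
Lemma transport_exists g f : measurable_fun setT f -> exists h, is_transport g f h.
Proof.
move=> mf.
pose L t : set T := f @^-1` [set y | y < t].
have mL t : measurable (L t) by apply: measurable_preimage => //; exact: measurable_ray.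
pose A n := malg_set (g (malg_class mu (L (ratn n)))).
have mA n : measurable (A n) by exact: measurable_malg_set.
pose phi n x : \bar R := if `[< A n x >] then (ratn n)%:E else +oo%E.
pose h' x := einfs (phi ^~ x) 0.
have mh' : measurable_fun setT h'.
  apply: measurable_fun_einfs => n; apply: measurable_fun_ifT => //.
  apply: (@measurable_fun_bool _ _ _ _ true).
  rewrite setTI [X in measurable X](_ : _ = A n)//.
  by apply/seteqP; split => x /asboolP.
have h'_lt x t : (h' x < t%:E)%E <-> exists2 n, ratn n < t & A n x.
  split.
    move=> /ereal_inf_lt[_ [n _ <-]]; rewrite /phi; case: asboolP => // An.
    by rewrite lte_fin => nt; exists n.
  move=> [n nt An]; rewrite (@le_lt_trans _ _ (ratn n)%:E) ?lte_fin//.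
  by apply: ereal_inf_lbound; exists n => //; rewrite /phi asboolT.
(* Both sublevel sets are countable unions over the rationals below [t], and [g] commutes with such
   unions. *)
have cl_lt t : malg_class mu [set x | (h' x < t%:E)%E] = g (malg_class mu (L t)).
  pose D n : set R := if ratn n < t then [set y | y < ratn n] else set0.
  have mD n : measurable (f @^-1` (D n)).
    by apply: measurable_preimage => //; rewrite /D; case: ifP => // _; exact: measurable_ray.
  have -> : [set x | (h' x < t%:E)%E] =
      \bigcup_n (if ratn n < t then A n else set0).
    apply/seteqP; split => x /=.
      by move=> /h'_lt[n nt An]; exists n => //; rewrite nt.
    by move=> [n _]; case: ifPn => // nt An; apply/h'_lt; exists n.
  have -> : L t = \bigcup_n (f @^-1` D n).
    apply/seteqP; split => x /=.
      move=> /ratnP[n /andP[fn nt]].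
      by exists n => //; rewrite /D /preimage/= nt.
    move=> [n _]; rewrite /D /preimage/=; case: ifPn => //= nt.
    by move=> fn; exact: lt_trans nt.
  rewrite !malg_class_bigcup//; last by move=> n; case: ifPn.
  rewrite autstar_sup; congr malg_sup; apply/funext => n.
  rewrite /D; case: ifPn => _; first by rewrite malg_setK.
  by rewrite preimage_set0 malg_class0 autstar0.
(* As [f] is real-valued, the sets [f < n] cover the space and so do the complements of the sets
   [f < - n]; their images under [g] still do, up to null sets. *)
have h'fin : \forall x \ae mu, h' x \is a fin_num.
  have h1 : \forall x \ae mu, exists n : nat, (h' x < n%:R%:E)%E.
    have mlt n : measurable [set x | (h' x < n%:R%:E)%E].
      by rewrite -[X in measurable X]setTI; exact: emeasurable_fun_infty_o.
    have : malg_class mu (\bigcup_n [set x | (h' x < n%:R%:E)%E]) =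
        malg_class mu setT.
      rewrite malg_class_bigcup// malg_classT -(autstar1 g) -malg_classT.
      rewrite (_ : setT = \bigcup_n L n%:R); last first.
        apply/seteqP; split => // x _; exists (Num.truncn `|f x|).+1 => //.
        rewrite /L /preimage/=.
        by rewrite (le_lt_trans (ler_norm _))// truncnS_gt.
      rewrite malg_class_bigcup// autstar_sup; congr malg_sup.
      by apply/funext => n; exact: cl_lt.
    move/malg_class_aeP => /(_ (bigcup_measurable (fun n _ => mlt n)) measurableT).
    by apply: filterS => x [_ /(_ I)[n _ hn]]; exists n.
  have h2 : \forall x \ae mu, exists n : nat, ~ (h' x < (- n%:R)%:E)%E.
    have mlt n : measurable [set x | (h' x < (- n%:R)%:E)%E].
      by rewrite -[X in measurable X]setTI; exact: emeasurable_fun_infty_o.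
    have : malg_class mu (\bigcup_n ~` [set x | (h' x < (- n%:R)%:E)%E]) =
        malg_class mu setT.
      rewrite malg_class_bigcup//; last by move=> n; exact: measurableC.
      rewrite malg_classT -(autstar1 g) -malg_classT.
      rewrite (_ : setT = \bigcup_n ~` L (- n%:R)); last first.
        apply/seteqP; split => // x _; exists (Num.truncn `|f x|).+1 => //.
        rewrite /L /preimage/=; apply/negP; rewrite -leNgt lerNl.
        by rewrite (le_trans (ler_norm _))// normrN ltW// truncnS_gt.
      rewrite malg_class_bigcup//; last by move=> n; exact: measurableC.
      rewrite autstar_sup; congr malg_sup; apply/funext => n.
      by rewrite !malg_classC// autstarC cl_lt.
    move/malg_class_aeP => /(_ (bigcup_measurable (fun n _ => measurableC (mlt n)))
      measurableT).
    by apply: filterS => x [_ /(_ I)[n _ hn]]; exists n.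
  apply: filterS2 h1 h2 => x [n hn] [m hm].
  by move: hn hm; case: (h' x) => //= _ []; rewrite ltNyr.
have mfine : measurable_fun setT (fine \o h') by exact: measurableT_comp.
exists (fine \o h'); apply: is_transport_rays => //.
move=> t; rewrite -/(L t) -cl_lt; apply/malg_class_aeP.
- by apply: measurable_preimage => //; exact: measurable_ray.
- by rewrite -[X in measurable X]setTI; exact: emeasurable_fun_infty_o.
- apply: filterS h'fin => x fx; rewrite /preimage/=.
  by rewrite -lte_fin fineK.
Qed.

Lemma transportP g f : measurable_fun setT f -> is_transport g f (transport g f).
Proof.
move=> mf; rewrite /transport; case: xgetP => [h -> //|nh].
by have [h hP] := transport_exists g mf; case: (nh h).
Qed.

(** Two reals are equal as soon as they lie below the same rationals, which makes countably many
    conditions. *)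
Lemma is_transport_uniq g f h h' :
  is_transport g f h -> is_transport g f h' -> \forall x \ae mu, h x = h' x.
Proof.
move=> [mh hP] [mh' h'P].
have /ae_foralln : forall n, \forall x \ae mu, (h x < ratn n) <-> (h' x < ratn n).
  move=> n; have mr : measurable [set y | y < ratn n] by exact: measurable_ray.
  have := (hP _ mr); rewrite -h'P// => /malg_class_aeP.
  move=> /(_ (measurable_preimage mh mr) (measurable_preimage mh' mr)).
  by apply: filterS => x; rewrite /preimage/=.
apply: filterS => x hx; apply/eqP; rewrite eq_le !leNgt; apply/andP; split.
  apply/negP => /ratnP[n /andP[a b]].
  by move/hx: a; rewrite ltNge (ltW b).
apply/negP => /ratnP[n /andP[a b]].
by move/hx: a; rewrite ltNge (ltW b).
Qed.

Variables (M1 M2 : {measure set T -> \bar R}).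
Variables (dM1 : M1 `<< mu) (dM2 : M2 `<< mu) (g : Autstar mu).
Hypothesis gM : forall a : MALG mu, M1 (malg_set (g a)) = M2 (malg_set a).

Lemma integral_transport f h (theta : R -> \bar R) a : measurable_fun setT f ->
  is_transport g f h ->
  measurable_fun setT theta -> (forall x, (0 <= theta x)%E) ->
  (\int[M1]_(x in malg_set (g a)) theta (h x) =
   \int[M2]_(x in malg_set a) theta (f x))%E.
Proof.
move=> mf [mh hP] mt t0; move: theta mt t0.
have mga := measurable_malg_set (g a); have ma := measurable_malg_set a.
have mI (k : T -> R) (th : R -> \bar R) D : measurable_fun setT k ->
    measurable_fun setT th -> measurable_fun D (th \o k).
  by move=> mk mth; apply: measurable_funTS; exact: measurableT_comp.
apply: (nonneg_measurable_ind (P := fun theta =>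
  (\int[M1]_(x in malg_set (g a)) theta (h x) =
   \int[M2]_(x in malg_set a) theta (f x))%E)).
- move=> B mB.
  have mhB := measurable_preimage mh mB; have mfB := measurable_preimage mf mB.
  rewrite (integral_indic M1 mga mhB) (integral_indic M2 ma mfB).
  transitivity (M1 (malg_set (g (malg_class mu (f @^-1` B `&` malg_set a))))).
    apply: ae_measure_eq.
    + exact: measurableI.
    + exact: measurable_malg_set.
    apply: (dominates_ae dM1).
    rewrite malg_classI// autstarI malg_setK -hP//.
    apply: filterS2 (malg_set_meet (malg_class mu (h @^-1` B)) (g a))
      (malg_classK mu mhB) => x.
    by rewrite /Order.meet/= /setI/=; tauto.
  rewrite gM; apply: ae_measure_eq.
  + exact: measurable_malg_set.
  + exact: measurableI.
  by apply: (dominates_ae dM2); apply: malg_classK; exact: measurableI.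
- move=> c th c0 mth th0 IH.
  by rewrite !ge0_integralZl_EFin ?IH//; exact: mI.
- move=> t1 t2 mt1 t10 mt2 t20 IH1 IH2.
  by rewrite !ge0_integralD ?IH1 ?IH2//; exact: mI.
- move=> th mth th0 ndth IH; rewrite !monotone_convergence//;
    do ?[by move=> n; exact: mI|by move=> x _ m n mn; exact: ndth].
  by congr (limn _); apply/funext => n.
Qed.

Lemma integral_transportT f h (theta : R -> \bar R) : measurable_fun setT f ->
  is_transport g f h ->
  measurable_fun setT theta -> (forall x, (0 <= theta x)%E) ->
  (\int[M1]_x theta (h x) = \int[M2]_x theta (f x))%E.
Proof.
move=> mf hP mt t0; have /= := integral_transport \top%O mf hP mt t0.
have mI (k : T -> R) D : measurable_fun setT k ->
    measurable_fun D (theta \o k).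
  by move=> mk; apply: measurable_funTS; exact: measurableT_comp.
have intT (M : {measure set T -> \bar R}) (k : T -> R) : M `<< mu ->
    measurable_fun setT k ->
    (\int[M]_(x in malg_set (\top%O : MALG mu)) theta (k x) =
     \int[M]_x theta (k x))%E.
  move=> dM mk; rewrite [LHS]integral_mkcond.
  have mT := measurable_malg_set (\top%O : MALG mu).
  apply: ge0_ae_eq_integral => //.
  - exact/(measurable_restrictT _ mT).1/mI.
  - exact: mI.
  - by move=> x _; rewrite patchE; case: ifPn.
  - apply: (dominates_ae dM); apply: filterS (malg_set_top mu) => x hx _.
    by rewrite patchE mem_set.
rewrite autstar1 !intT//; by case: hP.
Qed.

End Transport.

(** * The positive cone of L^2 *)

Section L2Cone.
Context d (T : measurableType d) (R : realType) (mu : {measure set T -> \bar R}).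
Implicit Types (k l : T -> R).

Definition L2cone k := [/\ measurable_fun setT k, forall x, 0 <= k x
  & (\int[mu]_x (k x ^+ 2)%:E < +oo)%E].

Definition ip k l : R := \int[mu]_x (k x * l x).

(** The squared L^2 distance, expanded so that only inner products of elements of the cone occur;
    [sqdistE] gives the integral. *)
Definition sqdist k l : R := ip k k - 2 * ip k l + ip l l.

Lemma L2cone_sqr_integrable k : L2cone k ->
  mu.-integrable setT (EFin \o (fun x => k x ^+ 2)).
Proof.
move=> [mk k0 ki]; apply/integrableP; split.
  by apply/measurable_EFinP; exact: measurable_funX.
rewrite (eq_integral (fun x => (k x ^+ 2)%:E))// => x _ /=.
by rewrite ger0_norm// sqr_ge0.
Qed.

Lemma L2cone_integrable k l : L2cone k -> L2cone l ->
  mu.-integrable setT (EFin \o (fun x => k x * l x)).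
Proof.
move=> hk hl; have [mk k0 ki] := hk; have [ml l0 li] := hl.
have := integrableD measurableT (L2cone_sqr_integrable hk) (L2cone_sqr_integrable hl).
apply: le_integrable => //.
  by apply/measurable_EFinP; exact: measurable_funM.
move=> x _ /=; rewrite lee_fin !ger0_norm ?addr_ge0 ?sqr_ge0 ?mulr_ge0//.
by have := sqr_ge0 (k x - l x); have := sqr_ge0 (k x + l x); nra.
Qed.

Lemma L2cone_integrable_prod k l : L2cone k -> L2cone l ->
  (\int[mu]_x (k x * l x)%:E = (ip k l)%:E)%E.
Proof.
move=> hk hl; rewrite /ip /Rintegral fineK//.
by apply: integrable_fin_num => //; exact: L2cone_integrable.
Qed.

Lemma L2coneD k l : L2cone k -> L2cone l -> L2cone (fun x => k x + l x).
Proof.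
move=> hk hl; have [mk k0 ki] := hk; have [ml l0 li] := hl; split.
- exact: measurable_funD.
- by move=> x; rewrite addr_ge0.
- have h := integrableD measurableT (L2cone_sqr_integrable hk)
    (L2cone_sqr_integrable hl).
  have /integrable_lty : mu.-integrable setT
      (EFin \o (fun x => (k x + l x) ^+ 2)).
    apply: (le_integrable measurableT _ _ (integrableZl measurableT 2 h)).
      by apply/measurable_EFinP; apply: measurable_funX; exact: measurable_funD.
    move=> x _ /=; rewrite lee_fin !ger0_norm ?mulr_ge0 ?addr_ge0 ?sqr_ge0//.
    by have := sqr_ge0 (k x - l x); nra.
  by apply.
Qed.

Lemma L2coneZ c k : 0 <= c -> L2cone k -> L2cone (fun x => c * k x).
Proof.
move=> c0 hk; have [mk k0 ki] := hk; split.
- exact: measurable_funM.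
- by move=> x; rewrite mulr_ge0.
- have /integrable_lty := integrableZl measurableT (c ^+ 2) (L2cone_sqr_integrable hk).
  by move/(_ measurableT); under eq_integral do rewrite /= -EFinM -exprMn.
Qed.

Lemma L2cone_le k l : measurable_fun setT k -> (forall x, 0 <= k x <= l x) ->
  L2cone l -> L2cone k.
Proof.
move=> mk kl hl; have [ml l0 li] := hl; split=> //; first by move=> x; case/andP: (kl x).
apply: le_lt_trans li; apply: ge0_le_integral => //.
- by move=> x _; rewrite lee_fin sqr_ge0.
- by apply/measurable_EFinP; exact: measurable_funX.
- by apply/measurable_EFinP; exact: measurable_funX.
- move=> x _; rewrite lee_fin; have /andP[kx klx] := kl x.
  by rewrite ler_sqr ?nnegrE.
Qed.

Lemma ipC k l : ip k l = ip l k.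
Proof. by apply: eq_Rintegral => x _; rewrite mulrC. Qed.

Lemma ipDl k l m : L2cone k -> L2cone l -> L2cone m ->
  ip (fun x => k x + l x) m = ip k m + ip l m.
Proof.
move=> hk hl hm; rewrite /ip.
under eq_Rintegral do rewrite mulrDl.
by rewrite RintegralD//; exact: L2cone_integrable.
Qed.

Lemma ipZl c k l : L2cone k -> L2cone l -> ip (fun x => c * k x) l = c * ip k l.
Proof.
move=> hk hl; rewrite /ip.
under eq_Rintegral do rewrite -mulrA.
by rewrite RintegralZl//; exact: L2cone_integrable.
Qed.

Lemma ipDr k l m : L2cone k -> L2cone l -> L2cone m ->
  ip m (fun x => k x + l x) = ip m k + ip m l.
Proof. by move=> hk hl hm; rewrite ipC ipDl// ![ip m _]ipC. Qed.

Lemma ipZr c k l : L2cone k -> L2cone l -> ip l (fun x => c * k x) = c * ip l k.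
Proof. by move=> hk hl; rewrite ipC ipZl// ipC. Qed.

Lemma ip_ge0 k l : L2cone k -> L2cone l -> 0 <= ip k l.
Proof.
move=> [_ k0 _] [_ l0 _]; apply: Rintegral_ge0 => x _; exact: mulr_ge0.
Qed.

Lemma ip_ae k k' l l' : L2cone k -> L2cone k' -> L2cone l -> L2cone l' ->
  (\forall x \ae mu, k x = k' x) -> (\forall x \ae mu, l x = l' x) ->
  ip k l = ip k' l'.
Proof.
move=> [mk k0 _] [mk' k'0 _] [ml l0 _] [ml' l'0 _] kk' ll'; congr fine.
apply: ge0_ae_eq_integral => //.
- by apply/measurable_EFinP; exact: measurable_funM.
- by apply/measurable_EFinP; exact: measurable_funM.
- by move=> x _; rewrite lee_fin mulr_ge0.
- by move=> x _; rewrite lee_fin mulr_ge0.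
- by apply: filterS2 kk' ll' => x -> ->.
Qed.

Lemma sqdistE k l : L2cone k -> L2cone l ->
  mu.-integrable setT (EFin \o (fun x => (k x - l x) ^+ 2)) /\
  sqdist k l = \int[mu]_x ((k x - l x) ^+ 2).
Proof.
move=> hk hl.
have -> : (fun x => (k x - l x) ^+ 2) =
    (fun x => (k x ^+ 2 - 2 * (k x * l x)) + l x ^+ 2).
  by apply/funext => x; ring.
have ik := L2cone_sqr_integrable hk; have il := L2cone_sqr_integrable hl.
have ikl : mu.-integrable setT (EFin \o (fun x => 2 * (k x * l x))).
  exact: (integrableZl measurableT 2 (L2cone_integrable hk hl)).
have iB : mu.-integrable setT (EFin \o (fun x => k x ^+ 2 - 2 * (k x * l x))).
  exact: (integrableB measurableT ik ikl).
split; first exact: (integrableD measurableT iB il).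
rewrite RintegralD// RintegralB// RintegralZl//; first exact: L2cone_integrable.
Qed.

Lemma sqdist_ge0 k l : L2cone k -> L2cone l -> 0 <= sqdist k l.
Proof.
move=> hk hl; have [_ ->] := sqdistE hk hl.
by apply: Rintegral_ge0 => x _; exact: sqr_ge0.
Qed.

Lemma ip_eq0 k : L2cone k -> ip k k = 0 -> \forall x \ae mu, k x = 0.
Proof.
move=> hk k0; have [mk kp _] := hk.
have /(ae_eq_integral_abs mu measurableT) : measurable_fun setT (fun x => (k x * k x)%:E).
  by apply/measurable_EFinP; exact: measurable_funM.
case=> + _; case.
  rewrite (eq_integral (fun x => (k x * k x)%:E)); last first.
    by move=> x _ /=; rewrite ger0_norm ?mulr_ge0.
  by rewrite L2cone_integrable_prod// k0.
move=> N [mN N0 NE]; exists N; split => // x /= kx; apply: NE => /= /(_ I)[].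
by move/eqP; rewrite mulf_eq0 orbb => /eqP.
Qed.

Lemma sqdist_eq0 k l : L2cone k -> L2cone l -> sqdist k l = 0 ->
  \forall x \ae mu, k x = l x.
Proof.
move=> hk hl; have [ikl ->] := sqdistE hk hl => h0.
have /(ae_eq_integral_abs mu measurableT) := measurable_int _ ikl.
case=> + _; case.
  rewrite (eq_integral (fun x => ((k x - l x) ^+ 2)%:E)); last first.
    by move=> x _ /=; rewrite ger0_norm ?sqr_ge0.
  by move: h0; rewrite /Rintegral => h0; rewrite -[LHS]fineK ?h0//;
    exact: integrable_fin_num.
move=> N [mN N0 NE]; exists N; split => // x /= kx; apply: NE => /= /(_ I)[].
by move/eqP; rewrite sqrf_eq0 subr_eq0 => /eqP.
Qed.

Lemma sqdistC k l : sqdist k l = sqdist l k.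
Proof. by rewrite /sqdist ipC; ring. Qed.

(** The polynomial [q] is the squared distance from [k] to [t * l]. Only [t >= 0] stays in the cone,
    which suffices because [ip k l >= 0]. *)
Lemma ip_cauchy_schwarz k l : L2cone k -> L2cone l ->
  ip k l ^+ 2 <= ip k k * ip l l.
Proof.
move=> hk hl.
have q t : 0 <= t -> 0 <= ip k k - 2 * t * ip k l + t ^+ 2 * ip l l.
  move=> t0; have htl := L2coneZ t0 hl.
  have := sqdist_ge0 hk htl; rewrite /sqdist.
  rewrite (ipZr t hl hk) (ipZl t hl htl) (ipZr t hl hl).
  by congr (_ <= _); ring.
have a0 := ip_ge0 hk hk; have b0 := ip_ge0 hk hl; have c0 := ip_ge0 hl hl.
have [c_eq0|c_neq0] := eqVneq (ip l l) 0.
  have [->|b_neq0] := eqVneq (ip k l) 0; first by rewrite expr0n mulr_ge0.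
  have bp : 0 < ip k l by rewrite lt0r b_neq0.
  (* Here [q] is affine in [t], and at this value it would be [- ip k k - 2]. *)
  have tp : 0 <= (ip k k + 1) / ip k l by rewrite divr_ge0// addr_ge0.
  have := q _ tp; rewrite c_eq0 !mulr0 addr0.
  by rewrite -mulrA divfK//; nra.
have cp : 0 < ip l l by rewrite lt0r c_neq0.
have := q (ip k l / ip l l); rewrite divr_ge0// => /(_ isT).
rewrite -(pmulr_lge0 _ cp).
have -> : (ip k k - 2 * (ip k l / ip l l) * ip k l +
   (ip k l / ip l l) ^+ 2 * ip l l) * ip l l = ip k k * ip l l - ip k l ^+ 2.
  by field.
by rewrite subr_ge0.
Qed.

(** Cauchy-Schwarz for [m] and the difference [k - l], which need not be in the cone: [q t] is the
    squared distance from [k] to [l + t m], and for [t < 0] the roles of [k] and [l] are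
    exchanged. *)
Lemma ip_le_sqdist k l m : L2cone k -> L2cone l -> L2cone m ->
  (ip k m - ip l m) ^+ 2 <= sqdist k l * ip m m.
Proof.
move=> hk hl hm.
have q t : 0 <= sqdist k l - 2 * t * (ip k m - ip l m) + t ^+ 2 * ip m m.
  wlog t0 : k l hk hl t / 0 <= t.
    move=> W; have [/W|/ltW t0] := leP 0 t; first exact.
    have := W _ _ hl hk (- t); rewrite sqdistC oppr_ge0 => /(_ t0).
    by congr (_ <= _); ring.
  have htm := L2coneZ t0 hm; have hltm := L2coneD hl htm.
  have := sqdist_ge0 hk hltm; rewrite /sqdist.
  rewrite (ipDr hl htm hk) (ipZr t hm hk) (ipDl hl htm hltm) (ipDr hl htm hl).
  rewrite (ipZr t hm hl) (ipZl t hm hltm) (ipDr hl htm hm) (ipZr t hm hm) [ip m l]ipC.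
  by congr (_ <= _); ring.
have s0 := sqdist_ge0 hk hl; have c0 := ip_ge0 hm hm.
set s := sqdist k l in q s0 *; set c := ip m m in q c0 *.
set b := ip k m - ip l m in q *.
have [c_eq0|c_neq0] := eqVneq c 0.
  have [->|b_neq0] := eqVneq b 0; first by rewrite expr0n mulr_ge0.
  have := q ((s + 1) / b); rewrite c_eq0 !mulr0 addr0.
  by rewrite -mulrA divfK//; lra.
have cp : 0 < c by rewrite lt0r c_neq0.
have := q (b / c); rewrite -(pmulr_lge0 _ cp).
have -> : (s - 2 * (b / c) * b + (b / c) ^+ 2 * c) * c = s * c - b ^+ 2.
  by field.
by rewrite subr_ge0.
Qed.

End L2Cone.

(** * The Koopman operators on the positive cone *)

Section RealRadonNikodym.
Context d (T : measurableType d) (R : realType).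

Lemma measurable_sqrt : measurable_fun setT (@Num.sqrt R).
Proof. by apply: continuous_measurable_fun; exact: sqrt_continuous. Qed.

Lemma measurable_funV0 (f : T -> R) : measurable_fun setT f ->
  (forall x, 0 <= f x) -> measurable_fun setT (fun x => (f x)^-1).
Proof.
move=> mf f0; rewrite (_ : (fun x => _) = (@powR R ^~ (-1)) \o f).
  by apply: measurableT_comp => //; exact: measurable_powR.
by apply/funext => x /=; rewrite powR_inv1.
Qed.

Lemma density_ae (mu : {measure set T -> \bar R}) (f : T -> R) (A B : set T) :
  measurable_fun setT f -> (forall x, 0 <= f x) ->
  measurable A -> measurable B -> (\forall x \ae mu, A x <-> B x) ->
  density mu f A = density mu f B.
Proof.
move=> mf f0 mA mB AB.
apply: (@ae_measure_eq _ _ _ (density_of mu mf f0)) => //.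
by apply: dominates_ae AB; exact: density_dominates.
Qed.

Lemma density_ae_eq (mu : {measure set T -> \bar R}) (f g : T -> R) :
  measurable_fun setT f -> (forall x, 0 <= f x) ->
  measurable_fun setT g -> (forall x, 0 <= g x) ->
  (density mu f setT < +oo)%E ->
  (forall A, measurable A -> density mu f A = density mu g A) ->
  \forall x \ae mu, f x = g x.
Proof.
move=> mf f0 mg g0 foo fg.
have : ae_eq mu setT (EFin \o f) (EFin \o g).
  apply: integral_ae_eq => //.
  - apply/integrableP; split; first exact/measurable_EFinP.
    rewrite (eq_integral (EFin \o f))// => x _.
    by rewrite /= ger0_norm.
  - exact/measurable_EFinP.
  - by move=> A _ mA; exact: fg.
by apply: filterS => x /(_ I)[].
Qed.

Lemma density_indic (mu : {measure set T -> \bar R}) (f : T -> R) (A B : set T) :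
  density mu (fun x => f x * \1_B x) A = density mu f (A `&` B).
Proof.
rewrite /density setIC [RHS]integral_mkcondl; apply: eq_integral => x _.
by rewrite patchE indicE; case: ifPn => xB; rewrite ?mulr1 ?mulr0.
Qed.

Lemma sqr_indic (f : T -> R) (B : set T) :
  (fun x => (f x * \1_B x) ^+ 2) = (fun x => f x ^+ 2 * \1_B x).
Proof.
apply/funext => x; rewrite exprMn; congr (_ * _).
by rewrite indicE; case: (_ \in _); rewrite ?expr1n ?expr0n.
Qed.

Lemma L2cone_mul_indic (mu : {measure set T -> \bar R}) (f : T -> R) (B : set T) :
  measurable B -> L2cone mu f -> L2cone mu (fun x => f x * \1_B x).
Proof.
move=> mB hf; have [mf f0 _] := hf; apply: L2cone_le hf.
  exact: measurable_funM.
by move=> x; rewrite mulr_ge0//= ler_piMr// indicE; case: (_ \in _).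
Qed.

Lemma radon_nikodym_real (mu : {sigma_finite_measure set T -> \bar R})
    (nu : {measure set T -> \bar R}) : (nu setT < +oo)%E -> nu `<< mu ->
  exists f : T -> R, [/\ measurable_fun setT f, forall x, 0 <= f x
    & forall A, measurable A -> nu A = density mu f A].
Proof.
move=> nuoo numu; pose nu' := mfrestr measurableT nuoo.
have nu'E A : nu' A = nu A by rewrite /nu' /mfrestr /mrestr setIT.
have nu'mu : nu' `<< mu.
  by apply/null_content_dominatesP => A mA A0; rewrite nu'E; exact: dominates0 numu mA A0.
have [f [f0 ff fi fE]] := radon_nikodym_sigma_finite nu'mu.
exists (fine \o f); split.
- by apply: measurableT_comp => //; exact: measurable_int fi.
- by move=> x; rewrite fine_ge0.
- move=> A mA; rewrite -nu'E [LHS]fE//; apply: eq_integral => x _ /=.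
  by rewrite fineK.
Qed.

(** This provides the finite measure [e ^ 2 mu], which has the same null sets as [mu]. *)
Lemma sigma_finite_positive_L2 (mu : {sigma_finite_measure set T -> \bar R}) :
  exists e, L2cone mu e /\ forall x, 0 < e x.
Proof.
have [F TF /all_and2[mF Foo]] := sigma_finiteT mu.
(* The factor [1 / 2 ^ n.+1] bounds the series pointwise by 1; the division by [1 + mu (F n)] bounds
   its integral by 1. *)
pose c n : R := (1 / (2 ^ n.+1)%:R) / (1 + fine (mu (F n))).
have p2 n : 0 < (2 ^ n.+1)%:R :> R by rewrite ltr0n expn_gt0.
have p1 n : 0 < 1 + fine (mu (F n)) by rewrite ltr_pwDl// fine_ge0.
have c0 n : 0 < c n by rewrite !divr_gt0.
have cle n : c n <= 1 / (2 ^ n.+1)%:R.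
  rewrite ler_pdivrMr//; apply: ler_peMr; first by rewrite divr_ge0// ltW.
  by rewrite lerDl fine_ge0.
pose f x : \bar R := (\sum_(n <oo) (c n * \1_(F n) x)%:E)%E.
have t0 n x : (0 <= (c n * \1_(F n) x)%:E)%E by rewrite lee_fin mulr_ge0// ltW.
have f_lt x : (f x < +oo)%E.
  apply: (@le_lt_trans _ _ 1%:E); last exact: ltry.
  apply: (le_trans _ (epsilon_trick0 xpredT ler01)).
  apply: lee_nneseries => // n _; rewrite lee_fin (le_trans _ (cle n))//.
  by rewrite ler_piMr ?(ltW (c0 n))// indicE; case: (_ \in _).
have f_ge0 x : (0 <= f x)%E by exact: nneseries_ge0.
have f_fin x : f x \is a fin_num by rewrite ge0_fin_numE.
have mt n : measurable_fun setT (fun x => (c n * \1_(F n) x)%:E).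
  by apply/measurable_EFinP; exact: measurable_funM.
have mf : measurable_fun setT f.
  apply: (ge0_emeasurable_sum (P := xpredT)) => //.
have f_gt0 x : (0 < f x)%E.
  have : setT x by [].
  rewrite TF => -[n _ Fnx].
  apply: (@lt_le_trans _ _ (\sum_(0 <= i < n.+1) (c i * \1_(F i) x)%:E)%E).
    rewrite big_nat_recr//= indicE mem_set// mulr1 (@lt_le_trans _ _ (c n)%:E)//.
      by rewrite lte_fin.
    by rewrite leeDr// sume_ge0.
  exact: nneseries_lim_ge.
have if_lt : (\int[mu]_x f x < +oo)%E.
  rewrite integral_nneseries//.
  apply: (@le_lt_trans _ _ 1%:E); last exact: ltry.
  apply: (le_trans _ (epsilon_trick0 xpredT ler01)).
  apply: lee_nneseries => [n _ _|n _]; first exact: integral_ge0.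
  under eq_integral do rewrite EFinM.
  rewrite ge0_integralZl_EFin ?(ltW (c0 n))//; last exact/measurable_EFinP.
  rewrite integral_indic// setIT [X in (_ * X)%E](_ : _ = (fine (mu (F n)))%:E); last first.
    by rewrite fineK// ge0_fin_numE//; exact: Foo.
  have -> : ((c n)%:E * (fine (mu (F n)))%:E)%E =
      ((1 / (2 ^ n.+1)%:R) * (fine (mu (F n)) / (1 + fine (mu (F n)))))%:E.
    by rewrite -EFinM /c mulrA mulrAC.
  rewrite lee_fin; apply: ler_piMr; first by rewrite divr_ge0// ltW.
  by rewrite ler_pdivrMr// mul1r lerDr.
exists (fun x => Num.sqrt (fine (f x))); split; last first.
  by move=> x; rewrite sqrtr_gt0 fine_gt0// f_gt0/=.
split; last 2 first.
- by move=> x; exact: sqrtr_ge0.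
- rewrite (eq_integral f)// => x _; rewrite sqr_sqrtr ?fine_ge0//.
  by rewrite fineK.
- apply: measurableT_comp; [exact: measurable_sqrt|exact: measurableT_comp].
Qed.

End RealRadonNikodym.

Section KoopmanAction.
Context d (T : measurableType d) (R : realType).
Context (mu : {sigma_finite_measure set T -> \bar R}).
Implicit Types (g : Autstar mu) (k l : T -> R).

(** [k'] is the image of [k] under the Koopman operator of [g]: the measure
    [k' ^ 2 mu] is the push-forward of [k ^ 2 mu]. *)
Definition is_act g k k' := L2cone mu k' /\ forall a : MALG mu,
  density mu (fun x => k' x ^+ 2) (malg_set (g a)) =
  density mu (fun x => k x ^+ 2) (malg_set a).

Definition act g k : T -> R := xget (cst 0) [set k' | is_act g k k'].

Lemma L2cone_density k : L2cone mu k ->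
  exists m : {measure set T -> \bar R},
    [/\ m `<< mu, (m setT < +oo)%E & m = density mu (fun x => k x ^+ 2) :> (set T -> \bar R)].
Proof.
move=> [mk k0 ki].
have mk2 : measurable_fun setT (fun x => k x ^+ 2) by exact: measurable_funX.
have k20 x : 0 <= k x ^+ 2 by exact: sqr_ge0.
by exists (density_of mu mk2 k20); split => //; exact: density_dominates.
Qed.

(** The push-forward of the finite measure [k ^ 2 mu] is again dominated by [mu]; the root of its
    density is [k']. *)
Lemma act_exists g k : L2cone mu k -> exists k', is_act g k k'.
Proof.
move=> hk; have [m [dm moo mE]] := L2cone_density hk.
have hV := autstar_sigma_hom (g^-1%g : Autstar mu).
pose N : {measure set T -> \bar R} := pullback_measure_of hV dm.
have Noo : (N setT < +oo)%E.
  apply: le_lt_trans moo; apply: le_measure; rewrite ?inE//.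
  exact: measurable_malg_set.
have [f [mf f0 fE]] := radon_nikodym_real Noo (pullback_measure_dominates hV dm).
have sqE : (fun x => Num.sqrt (f x) ^+ 2) = f.
  by apply/funext => x; rewrite sqr_sqrtr.
exists (fun x => Num.sqrt (f x)); split; first split.
- by apply: measurableT_comp => //; exact: measurable_sqrt.
- by move=> x; exact: sqrtr_ge0.
- by under eq_integral do rewrite sqr_sqrtr//; rewrite -[X in (X < _)%E]/(density mu f setT) -fE.
- move=> a; rewrite sqE -fE; last exact: measurable_malg_set.
  by rewrite [LHS]pullback_measureE autstarVK mE.
Qed.

Lemma actP g k : L2cone mu k -> is_act g k (act g k).
Proof.
move=> hk; rewrite /act; case: xgetP => [k' -> //|nk].
by have [k' hk'] := act_exists g hk; case: (nk k').
Qed.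

Lemma L2cone_act g k : L2cone mu k -> L2cone mu (act g k).
Proof. by move=> /(actP g)[]. Qed.

(** The square of the image is a density, hence unique, and the image is its nonnegative root. *)
Lemma is_act_ae g k1 k2 l1 l2 : L2cone mu k1 -> L2cone mu k2 ->
  (\forall x \ae mu, k1 x = k2 x) -> is_act g k1 l1 -> is_act g k2 l2 ->
  \forall x \ae mu, l1 x = l2 x.
Proof.
move=> [mk1 k10 ik1] [mk2 k20 ik2] k12 [[ml1 l10 il1] hl1] [[ml2 l20 il2] hl2].
have m2 (l : T -> R) : measurable_fun setT l -> measurable_fun setT (fun x => l x ^+ 2).
  by move=> ml; exact: measurable_funX.
have s0 (l : T -> R) x : 0 <= l x ^+ 2 by exact: sqr_ge0.
have : \forall x \ae mu, l1 x ^+ 2 = l2 x ^+ 2.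
  apply: density_ae_eq => //; [exact: m2|exact: m2|].
  move=> A mA; pose a := (g^-1%g : Autstar mu) (malg_class mu A).
  have hA (l : T -> R) : measurable_fun setT l ->
      density mu (fun x => l x ^+ 2) A =
      density mu (fun x => l x ^+ 2) (malg_set (g a)).
    move=> ml; apply: density_ae => //; first exact: m2.
      exact: measurable_malg_set.
    rewrite autstarKV; apply: filterS (malg_classK mu mA) => x; tauto.
  rewrite !hA// hl1 hl2; apply: ge0_ae_eq_integral => //.
  - exact: measurable_malg_set.
  - by apply: measurable_funTS; apply/measurable_EFinP; exact: m2.
  - by apply: measurable_funTS; apply/measurable_EFinP; exact: m2.
  - by move=> x _; rewrite lee_fin.
  - by move=> x _; rewrite lee_fin.
  - by apply: filterS k12 => x ->.
by apply: filterS => x /eqP; rewrite eqrXn2// => /eqP.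
Qed.

Lemma is_act_mul g h k k' k'' : is_act h k k' -> is_act g k' k'' ->
  is_act (g * h)%g k k''.
Proof.
move=> [_ hk'] [hk'' gk'']; split => // a.
by rewrite -hk' -gk''.
Qed.

Lemma is_act1 k : L2cone mu k -> is_act 1%g k k.
Proof. by move=> hk; split. Qed.

Lemma act_ae g k l : L2cone mu k -> L2cone mu l ->
  (\forall x \ae mu, k x = l x) -> \forall x \ae mu, act g k x = act g l x.
Proof.
by move=> hk hl kl; apply: (is_act_ae hk hl kl); exact: actP.
Qed.

Lemma act_mul g h k : L2cone mu k ->
  \forall x \ae mu, act (g * h)%g k x = act g (act h k) x.
Proof.
move=> hk; apply: (is_act_ae hk hk _ (actP _ hk)); first exact: aeW.
by apply: (is_act_mul (actP h hk)); apply: actP; exact: L2cone_act.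
Qed.

Lemma act1 k : L2cone mu k -> \forall x \ae mu, act 1%g k x = k x.
Proof.
move=> hk; apply: (is_act_ae hk hk _ (actP _ hk) (is_act1 hk)).
exact: aeW.
Qed.

(** Restricting [k ^ 2 mu] to [A] restricts its push-forward to [g A]. *)
Lemma is_act_indic g k k' A : L2cone mu k -> measurable A -> is_act g k k' ->
  is_act g (fun x => k x * \1_A x)
    (fun x => k' x * \1_(malg_set (g (malg_class mu A))) x).
Proof.
move=> hk mA [hk' gk]; have [mk k0 _] := hk; have [mk' k'0 _] := hk'.
have mgA := measurable_malg_set (g (malg_class mu A)).
split=> [|a]; first exact: L2cone_mul_indic.
rewrite !sqr_indic !density_indic.
have ma := measurable_malg_set a; have mga := measurable_malg_set (g a).
transitivity (density mu (fun x => k x ^+ 2) (malg_set (a `&` malg_class mu A)%O)).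
  rewrite -gk; apply: density_ae.
  - exact: measurable_funX.
  - by move=> x; exact: sqr_ge0.
  - exact: measurableI.
  - exact: measurable_malg_set.
  - rewrite autstarI; apply: filterS (malg_set_meet (g a) (g (malg_class mu A))) => x.
    by rewrite /Order.meet/= /setI/=; tauto.
apply: density_ae.
- exact: measurable_funX.
- by move=> x; exact: sqr_ge0.
- exact: measurable_malg_set.
- exact: measurableI.
- apply: filterS2 (malg_classK mu mA) (malg_set_meet a (malg_class mu A)) => x.
  by rewrite /Order.meet/= /setI/=; tauto.
Qed.

(** With [l = rho k] on the support [S] of [k], the inner product is the integral of [rho] against
    [k ^ 2 mu]. The transport [h] of [rho] satisfies [l' = h k'] on [g S], so the other inner
    product is the integral of [h] against the push-forward [k' ^ 2 mu]. *)
Lemma is_act_ip g k l k' l' : L2cone mu k -> L2cone mu l ->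
  is_act g k k' -> is_act g l l' -> ip mu k' l' = ip mu k l.
Proof.
move=> hk hl hgk hgl; have [hk' gk] := hgk; have [hl' gl] := hgl.
have [mk k0 ik] := hk; have [ml l0 il] := hl.
have [mk' k'0 ik'] := hk'; have [ml' l'0 il'] := hl'.
have m2 (f : T -> R) : measurable_fun setT f -> measurable_fun setT (fun x => f x ^+ 2).
  by move=> mf; exact: measurable_funX.
have s0 (f : T -> R) x : 0 <= f x ^+ 2 by exact: sqr_ge0.
(* Division by 0 gives 0, so [rho] vanishes off the support of [k]. *)
pose rho x := l x / k x.
have mrho : measurable_fun setT rho by apply: measurable_funM => //; exact: measurable_funV0.
have rho0 x : 0 <= rho x by rewrite divr_ge0.
pose h := transport g rho; have hP : is_transport g rho h := transportP g mrho.
have [mh _] := hP.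
pose M1 : {measure set T -> \bar R} := density_of mu (m2 _ mk') (s0 k').
pose M2 : {measure set T -> \bar R} := density_of mu (m2 _ mk) (s0 k).
have dM1 : M1 `<< mu by exact: density_dominates.
have dM2 : M2 `<< mu by exact: density_dominates.
pose S0 := [set x | k x != 0]; pose S := malg_class mu S0.
have mS0 : measurable S0.
  rewrite (_ : S0 = ~` (k @^-1` [set 0])).
    by apply: measurableC; exact: measurable_preimage.
  by apply/seteqP; split => x /eqP.
have mS' := measurable_malg_set (g S).
have kS0 : (fun x => k x * \1_S0 x) = k.
  apply/funext => x; rewrite indicE; have [->|kx] := eqVneq (k x) 0.
    by rewrite mul0r.
  by rewrite mem_set ?mulr1.
have k'S : \forall x \ae mu, k' x = k' x * \1_(malg_set (g S)) x.
  have := is_act_indic hk mS0 hgk; rewrite kS0.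
  by apply: (is_act_ae hk hk _ hgk); exact: aeW.
have lact := is_act_indic hl mS0 hgl.
pose lS x := l' x * \1_(malg_set (g S)) x.
have [[mlS lS_ge0 ilS] lSg] : is_act g (fun x => l x * \1_S0 x) lS := lact.
(* Both sides are densities of the push-forward of [(l 1_S) ^ 2 mu = rho ^ 2 k ^ 2 mu]. *)
have eq1 : \forall x \ae mu, lS x ^+ 2 = h x ^+ 2 * k' x ^+ 2.
  apply: density_ae_eq => //.
  - exact: measurable_funX.
  - by apply: measurable_funM; exact: measurable_funX.
  - by move=> x; rewrite mulr_ge0.
  - move=> A mA; pose a := (g^-1%g : Autstar mu) (malg_class mu A).
    have hA (f : T -> R) : measurable_fun setT f -> (forall x, 0 <= f x) ->
        density mu f A = density mu f (malg_set (g a)).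
      move=> mf f0; apply: density_ae => //; first exact: measurable_malg_set.
      rewrite autstarKV; apply: filterS (malg_classK mu mA) => x; tauto.
    rewrite hA//; last exact: measurable_funX.
    rewrite hA; last 2 first.
    + by apply: measurable_funM; exact: measurable_funX.
    + by move=> x; rewrite mulr_ge0.
    have mth : measurable_fun setT (fun t : R => (t ^+ 2)%:E).
      by apply/measurable_EFinP; exact: exprn_measurable.
    have th0 (t : R) : (0 <= (t ^+ 2)%:E)%E by rewrite lee_fin sqr_ge0.
    have := integral_transport dM1 dM2 gk a mrho hP mth th0.
    rewrite (integral_density mu (m2 _ mk') (s0 k'))//; last 2 first.
    + exact: measurable_malg_set.
    + by apply/measurable_EFinP; exact: measurable_funX.
    rewrite (integral_density mu (m2 _ mk) (s0 k))//; last 2 first.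
    + exact: measurable_malg_set.
    + by apply/measurable_EFinP; exact: measurable_funX.
    move=> eqA; rewrite lSg; apply: etrans (esym eqA); apply: eq_integral => x _.
    rewrite -EFinM; congr EFin; rewrite -exprMn; congr (_ ^+ 2).
    rewrite /rho indicE; have [kx|kx] := eqVneq (k x) 0.
      by rewrite kx mulr0 memNset ?mulr0//= /S0/= kx eqxx.
    by rewrite mem_set// mulr1 divfK.
(* The absolute value is taken because [h], a transport of the nonnegative [rho], is itself
   nonnegative only almost everywhere. *)
have mth : measurable_fun setT (fun t : R => (`|t|)%:E).
  by apply/measurable_EFinP; exact: normr_measurable.
have th0 (t : R) : (0 <= (`|t|)%:E)%E by rewrite lee_fin.
have := integral_transportT dM1 dM2 gk mrho hP mth th0.
rewrite (integral_densityT mu (m2 _ mk') (s0 k'))//; last first.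
  by apply/measurable_EFinP; exact: measurableT_comp.
rewrite (integral_densityT mu (m2 _ mk) (s0 k))//; last first.
  by apply/measurable_EFinP; exact: measurableT_comp.
move=> eq2; rewrite /ip /Rintegral; congr fine.
transitivity (\int[mu]_x ((`|h x|)%:E * (k' x ^+ 2)%:E))%E.
  apply: ge0_ae_eq_integral => //.
  - by apply/measurable_EFinP; exact: measurable_funM.
  - apply: emeasurable_funM; apply/measurable_EFinP; last exact: measurable_funX.
    exact: measurableT_comp.
  - by move=> x _; rewrite lee_fin mulr_ge0.
  - by move=> x _; rewrite mule_ge0// lee_fin.
  - apply: filterS2 k'S eq1 => x k'x; rewrite -exprMn => eqx _.
    have {}eqx : lS x = `|h x| * k' x.
      apply/eqP; rewrite -(@eqrXn2 _ 2)//; last by rewrite mulr_ge0.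
      by rewrite eqx !exprMn real_normK// num_real.
    rewrite -EFinM expr2 mulrA -eqx /lS; congr EFin.
    by rewrite [in LHS]k'x; ring.
rewrite eq2; apply: eq_integral => x _.
rewrite -EFinM; congr EFin; rewrite ger0_norm// /rho.
have [->|kx] := eqVneq (k x) 0; first by rewrite expr0n mulr0 mul0r.
by field.
Qed.

Lemma act_ip g k l : L2cone mu k -> L2cone mu l ->
  ip mu (act g k) (act g l) = ip mu k l.
Proof. by move=> hk hl; apply: (is_act_ip hk hl); exact: actP. Qed.

End KoopmanAction.

(** * The strong operator topology *)

Section StrongOperatorTopology.
Context d (T : measurableType d) (R : realType) (mu : {measure set T -> \bar R}).

Lemma sot_nbhs (g : Autstar mu) S : koopman_sot_subbasis S -> S g -> nbhs g S.
Proof.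
move=> hS Sg; exists S; split => //; exists [set S]; last first.
  by apply/seteqP; split => [x [_ ->]//|x Sx]; exists S.
move=> _ ->; exists (finmap.fset1 S).
  by move=> A; rewrite finmap.in_fset1 => /eqP ->; exact/mem_set.
apply/seteqP; split => [x h|x Sx A /=].
  by apply: (h S); rewrite /= finmap.in_fset1.
by rewrite finmap.in_fset1 => /eqP ->.
Qed.

Lemma sot_cvg (F : set_system (Autstar mu)) (g : Autstar mu) : Filter F ->
  (forall S, koopman_sot_subbasis S -> S g -> F S) -> F --> g.
Proof.
move=> FF h A [B [[C sC <-] [D CD Dg] sBA]].
rewrite nbhs_filterE; apply: (filterS sBA); apply: (@filterS _ _ _ D).
  by move=> x Dx; exists D.
have [E sE ED] := sC _ CD.
rewrite -ED; apply: filter_bigI => S ES; apply: h.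
  by apply/set_mem; exact: sE.
by move: Dg; rewrite -ED; exact.
Qed.

Lemma normc_ge0 (z : R[i]) : 0 <= Normc.normc z.
Proof. by case: z => a b; exact: sqrtr_ge0. Qed.

Lemma normc_sqr (z : R[i]) : Normc.normc z ^+ 2 = complex.Re z ^+ 2 + complex.Im z ^+ 2.
Proof. by case: z => a b; rewrite sqr_sqrtr// addr_ge0// sqr_ge0. Qed.

Lemma normc_real (a : R) : 0 <= a -> Normc.normc (a%:C)%C = a.
Proof. by move=> a0; rewrite /Normc.normc/= expr0n addr0 sqrtr_sqr ger0_norm. Qed.

Lemma normc_dist (z w : R[i]) :
  `|Normc.normc z - Normc.normc w| <= Normc.normc (z - w).
Proof.
have le (a b : R[i]) : Normc.normc a <= Normc.normc (a - b) + Normc.normc b.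
  by have := @le_normcD R (a - b) b; rewrite [(_ + _ : Rcomplex R)](_ : _ = a) ?subrK.
have wz : Normc.normc (w - z) = Normc.normc (z - w).
  by rewrite -opprB; exact: normcN.
rewrite ler_norml; apply/andP; split; last by rewrite lerBlDr le.
by rewrite lerNl opprB lerBlDr -wz le.
Qed.

Lemma L2norm_lt (f : T -> R[i]) (e : R) : 0 < e ->
  (L2norm mu f < e%:E)%E =
  (\int[mu]_x (Normc.normc (f x) ^+ 2)%:E < (e ^+ 2)%:E)%E.
Proof.
move=> e0; have := @poweR_Lnorm _ _ _ mu (fun x => (Normc.normc (f x))%:E) 2.
rewrite -/(L2norm mu f) pnatr_eq0 => /(_ isT) h.
rewrite (eq_integral (fun x => `|(Normc.normc (f x))%:E| `^ 2)%E); last first.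
  by move=> x _ /=; rewrite ger0_norm ?normc_ge0// powR_mulrn// normc_ge0.
rewrite -h; have : (0 <= L2norm mu f)%E by exact: Lnorm_ge0.
case: (L2norm mu f) => [r| |] //=; last first.
  by rewrite pnatr_eq0 /= !ltNge !leey.
rewrite lee_fin => r0; rewrite powR_mulrn// !lte_fin ltr_sqr//.
by rewrite nnegrE ltW.
Qed.

Lemma L2norm_lty (f : T -> R[i]) :
  (\int[mu]_x (Normc.normc (f x) ^+ 2)%:E < +oo)%E -> (L2norm mu f < +oo)%E.
Proof.
move=> foo; set I := (\int[mu]_x _)%E in foo.
have I0 : (0 <= I)%E by apply: integral_ge0 => x _; rewrite lee_fin sqr_ge0.
have Ifin : I \is a fin_num by rewrite ge0_fin_numE.
have e0 : 0 < fine I + 1 by rewrite ltr_wpDl// fine_ge0.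
apply: (@lt_trans _ _ (fine I + 1)%:E); last exact: ltry.
rewrite L2norm_lt// -/I -[I]fineK// lte_fin/=.
by have := fine_ge0 I0; nra.
Qed.

End StrongOperatorTopology.

Section RadonNikodymDerivative.
Context d (T : measurableType d) (R : realType) (mu : {measure set T -> \bar R}).
Implicit Types g : Autstar mu.

Definition is_RN_derivative g (r : T -> R) := [/\ measurable_fun setT r,
    forall x, 0 <= r x &
    forall A : set T, measurable A ->
      (\int[mu]_(x in A) (r x)%:E)%E =
        mu (malg_set ((g^-1%g : Autstar mu) (malg_class mu A)))].

Lemma malg_set_autstarKV g A : measurable A ->
  \forall x \ae mu, A x <-> malg_set (g ((g^-1%g : Autstar mu) (malg_class mu A))) x.
Proof.
by move=> mA; rewrite autstarKV; apply: filterS (malg_classK mu mA) => x; tauto.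
Qed.

(** Densities of finite measures are unique, and the push-forward of [mu] is finite on the images
    [V n] of the sets [F n], which cover the space up to a null set. *)
Lemma is_RN_derivative_uniq g r r' : sigma_finite setT mu ->
  is_RN_derivative g r ->
  is_RN_derivative g r' -> \forall x \ae mu, r x = r' x.
Proof.
move=> [F TF /all_and2[mF Foo]] [mr r0 hr] [mr' r'0 hr'].
pose V n := malg_set (g (malg_class mu (F n))).
have mV n : measurable (V n) by exact: measurable_malg_set.
have : \forall x \ae mu, forall n, r x * \1_(V n) x = r' x * \1_(V n) x.
  apply: ae_foralln => n; apply: density_ae_eq.
  - exact: measurable_funM.
  - by move=> x; rewrite mulr_ge0.
  - exact: measurable_funM.
  - by move=> x; rewrite mulr_ge0.
  - rewrite density_indic setTI /density hr// malg_setK autstarVK.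
    rewrite (_ : mu _ = mu (F n)) ?Foo//; apply: ae_measure_eq => //.
      exact: measurable_malg_set.
    exact: malg_classK.
  - move=> A mA; have mAV : measurable (A `&` V n) by exact: measurableI.
    by rewrite !density_indic /density hr// hr'.
have : \forall x \ae mu, exists n, V n x.
  have : malg_class mu (\bigcup_n F n) = malg_class mu setT by rewrite -TF.
  rewrite malg_class_bigcup// => /(congr1 g); rewrite malg_classT autstar1 autstar_sup.
  move=> eqT; have := malg_set_sup (fun n => g (malg_class mu (F n))).
  rewrite eqT; apply: filterS2 (malg_set_top mu) => x; tauto.
apply: filterS2 => x [n Vx] /(_ n); rewrite indicE mem_set//.
by rewrite !mulr1.
Qed.

Lemma koopman_Re g (f : T -> R[i]) x : complex.Re (koopman g f x) =
  Num.sqrt (RN_derivative g x) * transport g (fun y => complex.Re (f y)) x.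
Proof. by rewrite /koopman /= mul0r subr0. Qed.

Lemma koopman_Im g (f : T -> R[i]) x : complex.Im (koopman g f x) =
  Num.sqrt (RN_derivative g x) * transport g (fun y => complex.Im (f y)) x.
Proof. by rewrite /koopman /= mul0r addr0. Qed.

Lemma measurable_koopman_sub g (f h : T -> R[i]) :
  measurable_fun setT (RN_derivative g) ->
  measurable_fun setT (fun x => complex.Re (f x)) ->
  measurable_fun setT (fun x => complex.Im (f x)) ->
  measurable_fun setT (fun x => complex.Re (h x)) ->
  measurable_fun setT (fun x => complex.Im (h x)) ->
  measurable_fun setT (fun x => Normc.normc (koopman g f x - h x) ^+ 2).
Proof.
move=> mr mfr mfi mhr mhi.
have [mtr _] := transportP g mfr; have [mti _] := transportP g mfi.
have msr : measurable_fun setT (fun x => Num.sqrt (RN_derivative g x)).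
  by apply: measurableT_comp => //; exact: measurable_sqrt.
rewrite (_ : (fun x => _) = (fun x =>
  (Num.sqrt (RN_derivative g x) * transport g (fun y => complex.Re (f y)) x -
     complex.Re (h x)) ^+ 2 +
  (Num.sqrt (RN_derivative g x) * transport g (fun y => complex.Im (f y)) x -
     complex.Im (h x)) ^+ 2)); last first.
  apply/funext => x; rewrite normc_sqr -koopman_Re -koopman_Im.
  by case: (koopman g f x) (h x) => a b [c e].
by apply: measurable_funD; apply: measurable_funX; apply: measurable_funB => //;
  exact: measurable_funM.
Qed.

End RadonNikodymDerivative.

Section KoopmanOperator.
Context d (T : measurableType d) (R : realType).
Context (mu : {sigma_finite_measure set T -> \bar R}).
Implicit Types (g : Autstar mu) (k l : T -> R).

(** As [mu = e ^ -2 (e ^ 2 mu)] with [e ^ 2 mu] finite, the push-forward of [mu] is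
    [h ^ -2 e' ^ 2 mu], where [h] is the transport of [e] and [e' = act g e]. *)
Lemma RN_derivative_exists g : exists r, is_RN_derivative g r.
Proof.
have [e [he e_gt0]] := sigma_finite_positive_L2 mu.
have [me e_ge0 ie] := he.
have [[me' e'_ge0 ie'] ge] := actP g he.
set e' := act g e in me' e'_ge0 ie' ge.
have m2 (f : T -> R) : measurable_fun setT f -> measurable_fun setT (fun x => f x ^+ 2).
  by move=> mf; exact: measurable_funX.
have s0 (f : T -> R) x : 0 <= f x ^+ 2 by exact: sqr_ge0.
have hP := transportP g me; have [mh _] := hP; set h := transport g e in hP mh.
pose r x := (h x ^+ 2)^-1 * e' x ^+ 2.
have mr : measurable_fun setT r.
  apply: measurable_funM; last exact: measurable_funX.
  by apply: measurable_funV0 => //; exact: measurable_funX.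
have r0 x : 0 <= r x by rewrite mulr_ge0// invr_ge0.
exists r; split => // A mA.
rewrite -[LHS]/(density mu r A).
rewrite (density_ae mr r0 mA (measurable_malg_set _) (malg_set_autstarKV g mA)).
set a := (g^-1%g : Autstar mu) (malg_class mu A).
pose M1 : {measure set T -> \bar R} := density_of mu (m2 _ me') (s0 e').
pose M2 : {measure set T -> \bar R} := density_of mu (m2 _ me) (s0 e).
have dM1 : M1 `<< mu by exact: density_dominates.
have dM2 : M2 `<< mu by exact: density_dominates.
have mth : measurable_fun setT (fun t : R => ((t ^+ 2)^-1)%:E).
  apply/measurable_EFinP; apply: measurable_funV0; last by move=> t; exact: sqr_ge0.
  exact: exprn_measurable.
have th0 (t : R) : (0 <= ((t ^+ 2)^-1)%:E)%E by rewrite lee_fin invr_ge0 sqr_ge0.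
have := integral_transport dM1 dM2 ge a me hP mth th0.
rewrite (integral_density mu (m2 _ me') (s0 e'))//; last 2 first.
- exact: measurable_malg_set.
- exact: (measurableT_comp mth).
rewrite (integral_density mu (m2 _ me) (s0 e))//; last 2 first.
- exact: measurable_malg_set.
- exact: (measurableT_comp mth).
move=> H; apply: etrans H _.
rewrite (eq_integral (cst 1%:E)); last first.
  by move=> x _; rewrite -EFinM mulVf// expf_neq0// gt_eqF.
by rewrite integral_cst ?mul1e//; exact: measurable_malg_set.
Qed.

Lemma RN_derivativeP g : is_RN_derivative g (RN_derivative g).
Proof.
rewrite /RN_derivative; case: xgetP => [r -> //|nr].
by have [r hr] := RN_derivative_exists g; case: (nr r).
Qed.

Lemma is_transport_const g (c : R) : is_transport g (cst c) (cst c).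
Proof.
split => // B mB; rewrite !preimage_cst.
by case: ifPn => _; rewrite ?malg_classT ?autstar1// malg_class0 autstar0.
Qed.

Lemma normc_koopman g (f : T -> R[i]) x : Normc.normc (koopman g f x) ^+ 2 =
  RN_derivative g x * (transport g (fun y => complex.Re (f y)) x ^+ 2 +
                       transport g (fun y => complex.Im (f y)) x ^+ 2).
Proof.
have [_ r0 _] := RN_derivativeP g.
rewrite /koopman Normc.normcM exprMn normc_sqr normc_sqr /=.
by rewrite expr0n addr0 sqr_sqrtr.
Qed.

(** The link between the Koopman formula and [act]: the squared modulus is almost everywhere
    [r h ^ 2], and [r mu] is the push-forward of [mu]. *)
Lemma is_act_koopman g k : L2cone mu k ->
  is_act g k (fun x => Normc.normc (koopman g (fun y => (k y)%:C)%C x)).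
Proof.
move=> hk; have [mk k0 ik] := hk.
have [mr r0 hr] := RN_derivativeP g; set r := RN_derivative g in mr r0 hr.
have hP := transportP g mk; have [mh _] := hP; set h := transport g k in hP mh.
(* The imaginary part is 0, but its transport is a chosen function which vanishes only almost
   everywhere. *)
have h0P : is_transport g (cst 0) (transport g (cst 0)) by exact: transportP.
have [mh0 _] := h0P; set h0 := transport g (cst 0) in h0P mh0.
set N := fun x => Normc.normc _.
have N2E x : N x ^+ 2 = r x * (h x ^+ 2 + h0 x ^+ 2) by rewrite normc_koopman.
have mN2 : measurable_fun setT (fun x => r x * (h x ^+ 2 + h0 x ^+ 2)).
  by apply: measurable_funM => //; apply: measurable_funD; exact: measurable_funX.
have NE : N = fun x => Num.sqrt (r x * (h x ^+ 2 + h0 x ^+ 2)).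
  by apply/funext => x; rewrite -N2E sqrtr_sqr ger0_norm// normc_ge0.
have mN : measurable_fun setT N.
  rewrite NE; apply: measurableT_comp => //; exact: measurable_sqrt.
have N0 x : 0 <= N x by exact: normc_ge0.
have h0_0 : \forall x \ae mu, h0 x = 0.
  exact: (is_transport_uniq h0P (is_transport_const g 0)).
pose M1 : {measure set T -> \bar R} := density_of mu mr r0.
have dM1 : M1 `<< mu by exact: density_dominates.
have gM a : M1 (malg_set (g a)) = mu (malg_set a).
  rewrite -[LHS]/(density mu r _) /density hr; last exact: measurable_malg_set.
  by rewrite malg_setK autstarVK.
have mth : measurable_fun setT (fun t : R => (t ^+ 2)%:E).
  by apply/measurable_EFinP; exact: exprn_measurable.
have th0 (t : R) : (0 <= (t ^+ 2)%:E)%E by rewrite lee_fin sqr_ge0.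
have main a : density mu (fun x => N x ^+ 2) (malg_set (g a)) =
    density mu (fun x => k x ^+ 2) (malg_set a).
  have := integral_transport dM1 (@dominates_refl _ _ _ mu) gM a mk hP mth th0.
  rewrite (integral_density mu mr r0)//; last 2 first.
  - exact: measurable_malg_set.
  - by apply/measurable_EFinP; exact: measurable_funX.
  move=> H; apply: etrans H; apply: ge0_ae_eq_integral => //.
  - exact: measurable_malg_set.
  - by apply: measurable_funTS; apply/measurable_EFinP; exact: measurable_funX.
  - by apply: measurable_funTS; apply/measurable_EFinP; apply: measurable_funM => //;
      exact: measurable_funX.
  - by move=> x _; rewrite mule_ge0// lee_fin.
  - apply: filterS h0_0 => x hx _; rewrite N2E hx expr0n addr0 -EFinM.
    by rewrite mulrC.
split => //; split => //.
rewrite -[X in (X < _)%E]/(density mu (fun x => N x ^+ 2) setT).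
have topT : \forall x \ae mu, setT x <-> malg_set (\top%O : MALG mu) x.
  by apply: filterS (malg_set_top mu) => x hx; split.
rewrite (density_ae _ _ measurableT (measurable_malg_set _) topT); last 2 first.
- exact: measurable_funX.
- by move=> x; exact: sqr_ge0.
rewrite -(autstar1 g) main.
rewrite -(density_ae _ _ measurableT (measurable_malg_set _) topT)//.
- exact: measurable_funX.
- by move=> x; exact: sqr_ge0.
Qed.

Lemma L2_real k : L2cone mu k -> L2 mu (fun y => (k y)%:C)%C.
Proof.
move=> [mk k0 ik]; split => //; apply: L2norm_lty.
rewrite (eq_integral (fun x => (k x ^+ 2)%:E))// => x _.
by rewrite normc_real.
Qed.

Lemma measurable_koopman_dist g (f h : T -> R[i]) :
  measurable_fun setT (fun x => complex.Re (f x)) ->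
  measurable_fun setT (fun x => complex.Im (f x)) ->
  measurable_fun setT (fun x => complex.Re (h x)) ->
  measurable_fun setT (fun x => complex.Im (h x)) ->
  measurable_fun setT (fun x => Normc.normc (koopman g f x - h x) ^+ 2).
Proof. by apply: measurable_koopman_sub; have [] := RN_derivativeP g. Qed.

(** Since [k] is real and nonnegative, replacing the Koopman image by its modulus brings it no
    further from [k]. *)
Lemma sqdist_koopman g k (e : R) : L2cone mu k -> 0 < e ->
  (L2norm mu (fun x => (koopman g (fun y => (k y)%:C)%C x - (k x)%:C%C)%R) < e%:E)%E ->
  sqdist mu (act g k) k <= e ^+ 2.
Proof.
move=> hk e0; have [mk k0 ik] := hk; rewrite L2norm_lt//.
have hN := is_act_koopman g hk; set N := fun x => Normc.normc _ in hN.
have [hNL _] := hN.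
have -> : sqdist mu (act g k) k = sqdist mu N k.
  have actN : \forall x \ae mu, act g k x = N x.
    by apply: (is_act_ae hk hk _ (actP g hk) hN); exact: aeW.
  have hak := L2cone_act g hk.
  by rewrite /sqdist (ip_ae hak hNL hak hNL)// (ip_ae hak hNL hk hk)//; exact: aeW.
have [iNk ->] := sqdistE hNL hk => /ltW h.
rewrite -lee_fin /Rintegral fineK; last exact: integrable_fin_num.
apply: le_trans h; apply: ge0_le_integral => //.
- by move=> x _; rewrite lee_fin sqr_ge0.
- exact: measurable_int iNk.
- by apply/measurable_EFinP; apply: measurable_koopman_dist.
- move=> x _; rewrite lee_fin -[X in X <= _]real_normK ?num_real//.
  rewrite ler_sqr ?nnegrE ?normc_ge0//.
  rewrite -[X in `|N x - X|](normc_real (k0 x)); exact: normc_dist.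
Qed.

Lemma koopman1 (f : T -> R[i]) :
  measurable_fun setT (fun x => complex.Re (f x)) ->
  measurable_fun setT (fun x => complex.Im (f x)) ->
  \forall x \ae mu, koopman (1%g : Autstar mu) f x = f x.
Proof.
move=> mre mim.
have h1 (k : T -> R) : measurable_fun setT k ->
    \forall x \ae mu, transport (1%g : Autstar mu) k x = k x.
  by move=> mk; apply: (is_transport_uniq (transportP _ mk)).
have r1 : is_RN_derivative (1%g : Autstar mu) (cst 1).
  split => // A mA.
  rewrite -[LHS]/(\int[mu]_(x in A) cst 1%:E x)%E integral_cst// mul1e invg1.
  apply: ae_measure_eq => //; first exact: measurable_malg_set.
  by apply: filterS (malg_classK mu mA) => x; tauto.
apply: filterS3 (h1 _ mre) (h1 _ mim)
  (is_RN_derivative_uniq (sigma_finiteT mu) (RN_derivativeP _) r1) => x ereal eim er.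
rewrite /koopman ereal eim er sqrtr1 mul1r.
by case: (f x).
Qed.

End KoopmanOperator.

Section KoopmanContinuity.
Context (G : topologicalGroupType) d (T : measurableType d) (R : realType).
Context (mu : {sigma_finite_measure set T -> \bar R}).
Variable phi : nonsingular_action G mu.

Lemma nsaM (x y : G) a : phi (x * y)%g a = phi x (phi y a).
Proof. by rewrite nsa_mul. Qed.

Lemma nsa1E : phi 1%g = 1%g :> Autstar mu.
Proof.
apply: (@mulgI _ (phi 1%g : Autstar mu)).
by rewrite -nsa_mul !mulg1.
Qed.

Lemma act_continuous1 k (e : R) : L2cone mu k -> 0 < e ->
  nbhs (1%g : G) [set g | sqdist mu (act (phi g) k) k < e].
Proof.
move=> hk e0; have [mk k0 ik] := hk.
pose kC := (fun y => (k y)%:C)%C.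
(* The halving compensates for the weak inequality of [sqdist_koopman]. *)
pose s := Num.sqrt (e / 2).
have s0 : 0 < s by rewrite sqrtr_gt0 divr_gt0.
pose S := [set g : Autstar mu |
  (L2norm mu (fun x => (koopman g kC x - kC x)%R) < s%:E)%E].
have SS : koopman_sot_subbasis S.
  by exists kC, kC, s; split => //; exact: L2_real.
have S1 : S 1%g.
  rewrite /S/= L2norm_lt//.
  rewrite (@ge0_ae_eq_integral _ _ _ mu setT _ (cst 0%E))//.
  - by rewrite integral0 lte_fin exprn_gt0.
  - by apply/measurable_EFinP; apply: measurable_koopman_dist.
  - by move=> x _; rewrite lee_fin sqr_ge0.
  - have : \forall x \ae mu, koopman (1%g : Autstar mu) kC x = kC x by exact: koopman1.
    by apply: filterS => x -> _; rewrite subrr Normc.normc0 expr0n.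
have nS : nbhs (phi 1%g) S by rewrite nsa1E; exact: sot_nbhs.
have : nbhs (1%g : G) (phi @^-1` S) by exact: (nsa_continuous nS).
apply: (@filterS _ (nbhs (1%g : G))) => g hg.
apply: (le_lt_trans (sqdist_koopman (g := phi g) hk s0 hg)).
rewrite sqr_sqrtr ?divr_ge0 ?(ltW e0)//.
by rewrite ltr_pdivrMr// ltr_pMr// ltr1n.
Qed.

End KoopmanContinuity.

(** * Weak limits *)

Section WeakCompactness.
Context d (T : measurableType d) (R : realType).
Context (mu : {sigma_finite_measure set T -> \bar R}).

(** The image ultrafilter contains a compact interval, hence has a cluster point, and an ultrafilter
    converges to its cluster points. *)
Lemma ultra_bounded_cvg (U : set_system nat) (u : nat -> R) (a b : R) :
  UltraFilter U -> (forall n, a <= u n <= b) ->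
  exists l : R, u @ U --> l.
Proof.
move=> UU uab; have UP : ProperFilter U by exact: ultra_proper.
have uU : (u @ U) `[a, b].
  have e : u @^-1` `[a, b] = setT.
    by apply/seteqP; split => // n _; rewrite /= in_itv/=; exact: uab.
  suff : U (u @^-1` `[a, b]) by [].
  by rewrite e; exact: filterT.
have [l [_ cl]] := @segment_compact R a b (u @ U) _ uU.
exists l => N Nl; rewrite nbhs_filterE/=.
have [//|nN] := in_ultra_setVsetC (u @^-1` N) UU.
by have [x [/= nx xN]] := cl (~` N) N nN Nl; case: (nx xN).
Qed.

Lemma ip_le k l x : L2cone mu k -> L2cone mu l -> L2cone mu x ->
  (forall t, k t <= l t) -> ip mu k x <= ip mu l x.
Proof.
move=> hk hl hx kl; have [_ x0 _] := hx.
apply: le_Rintegral => //; [exact: L2cone_integrable|exact: L2cone_integrable|].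
by move=> t _; rewrite ler_wpM2r.
Qed.

Variables (k : nat -> T -> R) (C : R) (U : set_system nat).
Hypotheses (hk : forall n, L2cone mu (k n)) (kC : forall n, ip mu (k n) (k n) <= C).
Hypothesis UU : UltraFilter U.

Let UP : ProperFilter U. Proof. exact: ultra_proper. Qed.

Let C0 : 0 <= C.
Proof. exact: le_trans (ip_ge0 (hk 0) (hk 0)) (kC 0). Qed.

(** The functional which the weak limit has to represent; along an ultrafilter all these limits
    exist at once. *)
Let Lam x : R := lim ((fun n => ip mu (k n) x) @ U).

Let cLam x : L2cone mu x -> (fun n => ip mu (k n) x) @ U --> Lam x.
Proof.
move=> hx; have [|l ul] := @ultra_bounded_cvg U (fun n => ip mu (k n) x) 0
    (Num.sqrt (C * ip mu x x)) UU; last first.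
  by rewrite /Lam; apply/cvg_ex; exists l.
move=> n; rewrite ip_ge0//=; have h0 := ip_ge0 hx hx.
rewrite -[X in X <= _]ger0_norm ?ip_ge0// -sqrtr_sqr ler_wsqrtr//.
by rewrite (le_trans (ip_cauchy_schwarz (hk n) hx))// ler_wpM2r.
Qed.

Let Lam_ge0 x : L2cone mu x -> 0 <= Lam x.
Proof.
move=> hx; apply: (ler_cvg_to (cvg_cst 0 (F := U)) (cLam hx)).
by apply: nearW => n; exact: ip_ge0.
Qed.

Let LamD x y : L2cone mu x -> L2cone mu y ->
  Lam (fun t => x t + y t) = Lam x + Lam y.
Proof.
move=> hx hy.
have h : (fun n => ip mu (k n) (fun t => x t + y t)) @ U --> Lam x + Lam y.
  rewrite (_ : (fun n => _) = (fun n => ip mu (k n) x + ip mu (k n) y)).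
    exact: (cvgD (cLam hx) (cLam hy)).
  by apply/funext => n; exact: ipDr.
exact: (cvg_unique _ (cLam (L2coneD hx hy)) h).
Qed.

Let LamZ c x : 0 <= c -> L2cone mu x -> Lam (fun t => c * x t) = c * Lam x.
Proof.
move=> c0 hx.
have h : (fun n => ip mu (k n) (fun t => c * x t)) @ U --> c * Lam x.
  rewrite (_ : (fun n => _) = (fun n => c * ip mu (k n) x)).
    exact: (cvgM (cvg_cst c) (cLam hx)).
  by apply/funext => n; exact: ipZr.
exact: (cvg_unique _ (cLam (L2coneZ c0 hx)) h).
Qed.

Let Lam_dist x y : L2cone mu x -> L2cone mu y ->
  (Lam x - Lam y) ^+ 2 <= C * sqdist mu x y.
Proof.
move=> hx hy.
have hB : (fun n => ip mu (k n) x - ip mu (k n) y) @ U --> Lam x - Lam y.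
  exact: (cvgB (cLam hx) (cLam hy)).
rewrite expr2.
apply: (ler_cvg_to (cvgM hB hB) (cvg_cst (C * sqdist mu x y) (F := U))).
apply: nearW => n /=; rewrite -expr2 [ip mu (k n) x]ipC [ip mu (k n) y]ipC.
rewrite (le_trans (ip_le_sqdist hx hy (hk n)))// mulrC ler_wpM2r//.
exact: sqdist_ge0.
Qed.

Let Lam_sqr x : L2cone mu x -> Lam x ^+ 2 <= C * ip mu x x.
Proof.
move=> hx; rewrite expr2.
apply: (ler_cvg_to (cvgM (cLam hx) (cLam hx)) (cvg_cst (C * ip mu x x) (F := U))).
apply: nearW => n /=; rewrite -expr2.
by rewrite (le_trans (ip_cauchy_schwarz (hk n) hx))// ler_wpM2r// ip_ge0.
Qed.

Let Lam_eq x y : x =1 y -> Lam x = Lam y.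
Proof. by move=> /funext ->. Qed.

Variables (e : T -> R) (he : L2cone mu e) (e_gt0 : forall x, 0 < e x).

Let eI A x : R := e x * \1_A x.

Let L2eI A : measurable A -> L2cone mu (eI A).
Proof. by move=> mA; exact: L2cone_mul_indic. Qed.

(** It will be the measure with density [e k'], for [k'] the weak limit. Non-measurable sets get the
    value 0 so that nonnegativity holds for all sets. *)
Let m (A : set T) : \bar R := if `[< measurable A >] then (Lam (eI A))%:E else 0%E.

Let mE A : measurable A -> m A = (Lam (eI A))%:E.
Proof. by move=> mA; rewrite /m asboolT. Qed.

Let eI0 : eI set0 = cst 0.
Proof. by apply/funext => x; rewrite /eI indic0 mulr0. Qed.

Let Lam0 : Lam (cst 0) = 0.
Proof.
have h0 : L2cone mu (cst 0) by rewrite -eI0; exact: L2eI.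
apply: etrans (etrans (LamZ (lexx 0) h0) (mul0r _)).
by apply: Lam_eq => x; rewrite mul0r.
Qed.

Let m0 : m set0 = 0%E. Proof. by rewrite mE// eI0 Lam0. Qed.

Let m_ge0 A : (0 <= m A)%E.
Proof.
by rewrite /m; case: asboolP => // mA; rewrite lee_fin Lam_ge0//; exact: L2eI.
Qed.

Let LamU A B : measurable A -> measurable B -> A `&` B = set0 ->
  Lam (eI (A `|` B)) = Lam (eI A) + Lam (eI B).
Proof.
move=> mA mB AB; rewrite -LamD; [|exact: L2eI|exact: L2eI].
apply: Lam_eq => x; rewrite /eI -mulrDr; congr (_ * _).
have nAB : ~ (A x /\ B x) by move=> h; suff : (A `&` B) x by rewrite AB.
rewrite !indicE in_setU; case: (boolP (x \in A)) => xA;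
  case: (boolP (x \in B)) => xB; rewrite ?addr0 ?add0r//.
by case: nAB; split; exact: set_mem.
Qed.

Let ip_eI A : measurable A -> (ip mu (eI A) (eI A))%:E = density mu (fun x => e x ^+ 2) A.
Proof.
move=> mA; rewrite -L2cone_integrable_prod; [|exact: L2eI|exact: L2eI].
rewrite -[X in density mu _ X]setTI -density_indic -sqr_indic.
by apply: eq_integral => x _; rewrite expr2.
Qed.

(** [LamU] gives finite additivity. The remainders [W n] decrease to the empty set, and [Lam_sqr]
    bounds [Lam (eI (W n)) ^ 2] by [C] times the value of the finite measure [e ^ 2 mu] on [W n]. *)
Let m_sigma_additive : semi_sigma_additive m.
Proof.
move=> F mF tF mUF.
have [D [dD Doo DE]] := L2cone_density he.
pose V n := \big[setU/set0]_(i < n) F i.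
have mV n : measurable (V n) by exact: bigsetU_measurable.
pose W n := (\bigcup_i F i) `\` V n.
have mW n : measurable (W n) by exact: measurableD.
have VU n : V n `<=` \bigcup_i F i by exact: bigsetU_bigcup.
have tF' : trivIset xpredT F by apply: sub_trivIset tF.
have dVF n : V n `&` F n = set0 by exact: (trivIset_bigsetUI tF').
have sumE n : (\sum_(0 <= i < n) m (F i))%E = (Lam (eI (V n)))%:E.
  elim: n => [|n IH].
    by rewrite big_geq// /V big_ord0 eI0 Lam0.
  by rewrite big_nat_recr//= IH [V n.+1]big_ord_recr/= (LamU (mV n) (mF n) (dVF n)) EFinD mE.
have eqU n : Lam (eI (\bigcup_i F i)) = Lam (eI (V n)) + Lam (eI (W n)).
  by rewrite -(LamU (mV n) (mW n)) ?setDUK// setDIK.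
have W0 : (fun n => Lam (eI (W n))) @ \oo --> 0.
  have DW : (fun n => D (W n)) @ \oo --> D (\bigcap_n W n).
    apply: nonincreasing_cvg_mu => //.
    - by apply: le_lt_trans Doo; apply: le_measure; rewrite ?inE.
    - exact: bigcap_measurable.
    - move=> p q pq; apply/subsetPset; apply: setDS.
      by apply: subset_bigsetU.
  have W_0 : \bigcap_n W n = set0.
    apply/seteqP; split => // x Wx; have [[n _ Fnx] _] := Wx 0%N I.
    have [_] := Wx n.+1 I; apply; rewrite /V big_ord_recr/=; by right.
  rewrite W_0 measure0 in DW.
  have sD : (fun n => Num.sqrt (C * fine (D (W n)))) @ \oo --> 0.
    rewrite -sqrtr0 -[X in Num.sqrt X](mulr0 C).
    apply: cvg_comp; last exact: sqrt_continuous.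
    apply: cvgM; first exact: cvg_cst.
    exact: fine_cvg.
  apply: (squeeze_cvgr _ (cvg_cst 0) sD); apply: nearW => n.
  have L0 := Lam_ge0 (L2eI (mW n)); rewrite L0 -[X in X <= _]ger0_norm//.
  rewrite -sqrtr_sqr ler_wsqrtr// (le_trans (Lam_sqr (L2eI (mW n))))//.
  by rewrite DE -ip_eI.
rewrite mE//; under eq_fun do rewrite sumE.
apply: cvg_EFin; first by apply: nearW => n.
rewrite [X in X @ _ --> _](_ : _ = (fun n => Lam (eI (\bigcup_i F i)) - Lam (eI (W n)))).
  rewrite -[X in _ --> X]subr0; apply: cvgB => //; exact: cvg_cst.
by apply/funext => n /=; rewrite (eqU n) addrK.
Qed.

(** In the induction below, this passes from [x = e H] to a summand of [H], or to a term of a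
    sequence increasing to [H], without leaving the cone. *)
Let part (x : T -> R) (h H : T -> \bar R) : L2cone mu x ->
  measurable_fun setT h -> (forall t, (0 <= h t <= H t)%E) ->
  (forall t, (x t)%:E = ((e t)%:E * H t)%E) ->
  exists y : T -> R, [/\ L2cone mu y, forall t, y t <= x t
    & forall t, (y t)%:E = ((e t)%:E * h t)%E].
Proof.
move=> hx mh hH xE; have [me _ _] := he.
have eh0 t : (0 <= (e t)%:E * h t)%E.
  by rewrite mule_ge0// ?lee_fin ?(ltW (e_gt0 t))//; have /andP[] := hH t.
have ehx t : ((e t)%:E * h t <= (x t)%:E)%E.
  by rewrite xE lee_wpmul2l ?lee_fin ?(ltW (e_gt0 t))//; have /andP[] := hH t.
have yE t : (fine ((e t)%:E * h t))%:E = ((e t)%:E * h t)%E.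
  by rewrite fineK// ge0_fin_numE// (le_lt_trans (ehx t))// ltry.
have yx t : fine ((e t)%:E * h t)%E <= x t by rewrite -lee_fin yE.
exists (fun t => fine ((e t)%:E * h t)%E); split => //.
apply: L2cone_le hx => [|t]; last by rewrite yx fine_ge0.
apply: measurableT_comp => //; apply: emeasurable_funM => //.
exact/measurable_EFinP.
Qed.

(** The weak limit is [f / e], where [f] is the density of the finite measure
    sending [B] to the limit of the inner products of [k n] with [e * \1_B]. *)
Lemma weak_limit_exists : exists k', L2cone mu k' /\
  forall x, L2cone mu x -> (fun n => ip mu (k n) x) @ U --> ip mu k' x.
Proof.
pose mm : {measure set T -> \bar R} :=
  HB.pack m (isMeasure.Build _ _ _ m m0 m_ge0 m_sigma_additive).
have mmoo : (mm setT < +oo)%E by rewrite /mm/= mE// ltry.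
have dmm : mm `<< mu.
  apply/null_content_dominatesP => A mA A0; rewrite [LHS]mE//; congr EFin.
  apply/eqP; rewrite -sqrf_eq0 eq_le sqr_ge0 andbT.
  rewrite (le_trans (Lam_sqr (L2eI mA)))//.
  have [D [dD _ DE]] := L2cone_density he.
  have : (ip mu (eI A) (eI A))%:E = 0%E by rewrite ip_eI// -DE; exact: dominates0 dD mA A0.
  by move=> [->]; rewrite mulr0.
have [f [mf f0 fE]] := radon_nikodym_real mmoo dmm.
have mfE : measurable_fun setT (EFin \o f) by exact/measurable_EFinP.
have [me _ _] := he.
(* Here [h] stands for [x / e]. When [h] is an indicator, the identity is the definition of [f]. *)
have main : forall h : T -> \bar R, measurable_fun setT h -> (forall t, (0 <= h t)%E) ->
    forall x, L2cone mu x -> (forall t, (x t)%:E = ((e t)%:E * h t)%E) ->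
    (Lam x)%:E = (\int[mu]_t (h t * (f t)%:E))%E.
  apply: (nonneg_measurable_ind (P := fun h =>
    forall x, L2cone mu x -> (forall t, (x t)%:E = ((e t)%:E * h t)%E) ->
    (Lam x)%:E = (\int[mu]_t (h t * (f t)%:E))%E)).
  - move=> B mB x hx xE.
    rewrite (@Lam_eq x (eI B)); last by move=> t; apply/EFin_inj; rewrite xE.
    rewrite -mE// -[LHS]/(mm B) fE// -[X in density _ _ X]setTI -density_indic.
    by apply: eq_integral => t _; rewrite -EFinM mulrC.
  - move=> c h c0 mh h0 IH x hx xE.
    have [c_eq0|c_neq0] := eqVneq c 0.
      rewrite (@Lam_eq x (cst 0)) ?Lam0; last first.
        by move=> t; apply/EFin_inj; rewrite xE c_eq0 mul0e mule0.
      by rewrite integral0_eq// => t _; rewrite c_eq0 !mul0e.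
    have cV0 : 0 <= c^-1 by rewrite invr_ge0.
    have := IH _ (L2coneZ cV0 hx); rewrite LamZ// => IHx.
    rewrite -[Lam x](mulVKf c_neq0) EFinM IHx; last first.
      move=> t; rewrite EFinM xE muleCA; congr (_ * _)%E.
      by rewrite muleA -EFinM mulVf// mul1e.
    rewrite -ge0_integralZl_EFin//.
    + by apply: eq_integral => t _; rewrite muleA.
    + by move=> t _; rewrite mule_ge0// lee_fin.
    + exact: emeasurable_funM.
  - move=> h1 h2 mh1 h10 mh2 h20 IH1 IH2 x hx xE.
    have [|x1 [hx1 _ x1E]] := part hx mh1 _ xE.
      by move=> t; rewrite h10 leeDl.
    have [|x2 [hx2 _ x2E]] := part hx mh2 _ xE.
      by move=> t; rewrite h20 leeDr.
    rewrite (@Lam_eq x (fun t => x1 t + x2 t)); last first.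
      by move=> t; apply/EFin_inj; rewrite EFinD x1E x2E xE ge0_muleDr.
    rewrite LamD// EFinD (IH1 _ hx1 x1E) (IH2 _ hx2 x2E).
    rewrite -ge0_integralD//.
    + by apply: eq_integral => t _; rewrite ge0_muleDl.
    + by move=> t _; rewrite mule_ge0// lee_fin.
    + exact: emeasurable_funM.
    + by move=> t _; rewrite mule_ge0// lee_fin.
    + exact: emeasurable_funM.
  - move=> h mh h0 ndh IH x hx xE.
    have hlim t : h ^~ t @ \oo --> limn (h ^~ t).
      exact: ereal_nondecreasing_is_cvgn (ndh t).
    have hle n t : (0 <= h n t <= limn (h ^~ t))%E.
      rewrite h0/=; apply: lime_ge; first exact: ereal_nondecreasing_is_cvgn (ndh t).
      by exists n => // p /= np; exact: ndh.
    have /choice[y yP] := fun n => part hx (mh n) (hle n) xE.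
    have hy n : L2cone mu (y n) by case: (yP n).
    have yx n t : y n t <= x t by case: (yP n).
    have yE n t : (y n t)%:E = ((e t)%:E * h n t)%E by case: (yP n).
    have ynd t : nondecreasing_seq (y ^~ t).
      move=> p q pq; rewrite -lee_fin !yE lee_wpmul2l ?lee_fin ?(ltW (e_gt0 t))//.
      exact: ndh.
    have y_cvg t : (fun n => (y n t)%:E) @ \oo --> (x t)%:E.
      under eq_fun do rewrite yE.
      by rewrite xE; apply: cvgeZl => //; exact: hlim.
    have [mx x0 _] := hx.
    have ipx : (fun n => ip mu x (y n)) @ \oo --> ip mu x x.
      suff : (fun n => (ip mu x (y n))%:E) @ \oo --> (ip mu x x)%:E by move/fine_cvg.
      rewrite -L2cone_integrable_prod//.
      rewrite (_ : (fun n => _) = (fun n => \int[mu]_t (x t * y n t)%:E)%E); last first.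
        by apply/funext => n; rewrite -L2cone_integrable_prod.
      rewrite (eq_integral (fun t => limn (fun n => (x t * y n t)%:E))); last first.
        move=> t _; apply/esym/cvg_lim => //.
        under eq_fun do rewrite EFinM.
        by rewrite EFinM; apply: cvgeZl.
      apply: cvg_monotone_convergence => //.
      + move=> n; apply/measurable_EFinP; apply: measurable_funM => //.
        by case: (hy n).
      + by move=> n t _; rewrite lee_fin mulr_ge0//; case: (hy n).
      + by move=> t _ p q pq; rewrite lee_fin ler_wpM2l//; exact: ynd.
    (* As [0 <= y n <= x], the squared distance from [x] to [y n] is at most [ip x x - ip x (y n)],
       which tends to 0 by monotone convergence; [Lam_dist] then applies. *)
    pose s n := Num.sqrt (C * (ip mu x x - ip mu x (y n))).
    have s_cvg : s @ \oo --> 0.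
      rewrite -sqrtr0 -[X in Num.sqrt X](mulr0 C) -(subrr (ip mu x x)).
      apply: cvg_comp; last exact: sqrt_continuous.
      apply: cvgM; first exact: cvg_cst.
      by apply: cvgB => //; exact: cvg_cst.
    have Ls n : `|Lam x - Lam (y n)| <= s n.
      rewrite -sqrtr_sqr ler_wsqrtr// (le_trans (Lam_dist hx (hy n)))//.
      rewrite ler_wpM2l// /sqdist.
      have := ip_le (hy n) hx (hy n) (yx n); lra.
    have L_cvg : (fun n => Lam (y n)) @ \oo --> Lam x.
      apply: (@squeeze_cvgr _ _ _ _ (fun n => Lam x - s n) (fun n => Lam x + s n)).
      + apply: nearW => n; have := Ls n; rewrite ler_norml => /andP[l1 l2].
        by apply/andP; split; lra.
      + by rewrite -[X in _ --> X]subr0; apply: cvgB => //; exact: cvg_cst.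
      + by rewrite -[X in _ --> X]addr0; apply: cvgD => //; exact: cvg_cst.
    have intE n : (\int[mu]_t (h n t * (f t)%:E))%E = (Lam (y n))%:E.
      exact/esym/(IH n _ (hy n) (yE n)).
    rewrite (eq_integral (fun t => limn (fun n => h n t * (f t)%:E)%E)); last first.
      by move=> t _; rewrite limeMr//; exact: (ereal_nondecreasing_is_cvgn (ndh t)).
    rewrite monotone_convergence//.
    + under eq_fun do rewrite intE.
      by apply/esym/cvg_lim => //; apply: cvg_EFin => //; exact: nearW.
    + by move=> n; exact: emeasurable_funM.
    + by move=> n t _; rewrite mule_ge0// lee_fin.
    + by move=> t _ p q pq; rewrite lee_wpmul2r ?lee_fin//; exact: ndh.
pose k' t := f t / e t.
have e_ge0 t : 0 <= e t by exact: ltW.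
have k'0 t : 0 <= k' t by rewrite divr_ge0.
have mk' : measurable_fun setT k'.
  by apply: measurable_funM => //; exact: measurable_funV0.
have mainx x : L2cone mu x -> (Lam x)%:E = (\int[mu]_t (k' t * x t)%:E)%E.
  move=> hx; have [mx x0 _] := hx.
  rewrite (main (fun t => (x t / e t)%:E)) => [| |t|//|t].
  - apply: eq_integral => t _; rewrite -EFinM; congr EFin.
    by rewrite /k'; field; rewrite gt_eqF.
  - apply/measurable_EFinP; apply: measurable_funM => //.
    exact: measurable_funV0.
  - by rewrite lee_fin divr_ge0.
  - by rewrite -EFinM mulrC divfK// gt_eqF.
have k'L2 : L2cone mu k'.
  split => //.
  (* The truncation [x j <= j e] lies in the cone and [k' * x j = x j ^ 2], so its squared norm is
     [Lam (x j)]. By [Lam_sqr] this is at most [C], and [x j] increases to [k']. *)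
  pose B (j : nat) := [set t | k' t <= j%:R * e t].
  have mB j : measurable (B j).
    rewrite -[X in measurable X]setTI; apply: measurable_fun_ler => //.
    exact: measurable_funM.
  pose x j t := k' t * \1_(B j) t.
  have x2E j t : x j t ^+ 2 = k' t * x j t.
    rewrite /x indicE; case: (_ \in _); first by rewrite !mulr1 expr2.
    by rewrite !mulr0 expr0n.
  have xL2 j : L2cone mu (x j).
    apply: (@L2cone_le _ _ _ _ _ (fun t => j%:R * e t)).
    - exact: measurable_funM.
    - move=> t; rewrite /x indicE; case: (boolP (t \in B j)) => tB.
        by rewrite mulr1 k'0/=; exact: (set_mem tB).
      by rewrite mulr0 lexx/= mulr_ge0.
    - exact: L2coneZ.
  have xC j : (\int[mu]_t (x j t ^+ 2)%:E <= C%:E)%E.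
    have e1 : (\int[mu]_t (x j t ^+ 2)%:E)%E = (ip mu (x j) (x j))%:E.
      rewrite -L2cone_integrable_prod//.
    have e2 : ip mu (x j) (x j) = Lam (x j).
      apply: EFin_inj; rewrite -e1 mainx//.
      by apply: eq_integral => t _; rewrite x2E.
    rewrite e1 lee_fin; have := Lam_sqr (xL2 j); rewrite -e2.
    have := ip_ge0 (xL2 j) (xL2 j); rewrite le_eqVlt => /predU1P[<- //|ip0].
    by rewrite expr2 ler_pM2r.
  have x_cvg t : (fun j => (x j t ^+ 2)%:E) @ \oo --> (k' t ^+ 2)%:E.
    apply: cvg_near_cst; exists (Num.truncn (k' t / e t)).+1 => // j /= jt.
    rewrite /x indicE mem_set ?mulr1//; rewrite /B/= -ler_pdivrMr//.
    by rewrite (le_trans (ltW (truncnS_gt _)))// ler_nat.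
  have x_nd t : nondecreasing_seq (fun j => (x j t ^+ 2)%:E).
    move=> p q pq; rewrite lee_fin ler_sqr ?nnegrE; do ?[by case: (xL2 p)|by case: (xL2 q)].
    rewrite /x !indicE ler_wpM2l//; case: (boolP (t \in B p)) => //= tB.
    rewrite mem_set//; have := set_mem tB; rewrite /B/= => /le_trans; apply.
    by rewrite ler_wpM2r// ler_nat.
  rewrite (eq_integral (fun t => limn (fun j => (x j t ^+ 2)%:E))); last first.
    by move=> t _; apply/esym/cvg_lim => //; exact: x_cvg.
  rewrite monotone_convergence//.
  - apply: (@le_lt_trans _ _ C%:E); last exact: ltry.
    apply: lime_le; last by apply: nearW.
    apply: ereal_nondecreasing_is_cvgn => p q pq; apply: ge0_le_integral => //.
    + by move=> t _; rewrite lee_fin sqr_ge0.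
    + by apply/measurable_EFinP; apply: measurable_funX; case: (xL2 p).
    + by apply/measurable_EFinP; apply: measurable_funX; case: (xL2 q).
    + by move=> t _; exact: x_nd.
  - by move=> j; apply/measurable_EFinP; apply: measurable_funX; case: (xL2 j).
  - by move=> j t _; rewrite lee_fin sqr_ge0.
exists k'; split => // x hx.
have -> : ip mu k' x = Lam x; last exact: cLam.
by apply: EFin_inj; rewrite mainx// L2cone_integrable_prod.
Qed.

End WeakCompactness.

Section InnerProductIdentities.
Context d (T : measurableType d) (R : realType) (mu : {measure set T -> \bar R}).

Lemma indic_ip (k l : T -> R) (B : set T) :
  ip mu (fun x => k x * \1_B x) l = ip mu k (fun x => l x * \1_B x).
Proof. by apply: eq_Rintegral => x _; rewrite mulrAC mulrA. Qed.

Lemma ip0l (l : T -> R) : ip mu (cst 0) l = 0.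
Proof.
rewrite /ip; under eq_Rintegral do rewrite mul0r.
by rewrite Rintegral_cst// mul0r.
Qed.

End InnerProductIdentities.

Opaque act ip.

Section WeakCluster.
Context d (T : measurableType d) (R : realType).
Context (mu : {sigma_finite_measure set T -> \bar R}).

(** The filter [U] refines [\oo], so what holds for all large [n] holds along [U]. *)
Lemma weak_cluster (k : nat -> T -> R) (C : R) :
  (forall n, L2cone mu (k n)) -> (forall n, ip mu (k n) (k n) <= C) ->
  exists (U : set_system nat) (k' : T -> R), [/\ ProperFilter U, \oo `<=` U,
    L2cone mu k' &
    forall x, L2cone mu x -> (fun n => ip mu (k n) x) @ U --> ip mu k' x].
Proof.
move=> hk kC; have [e [he e0]] := sigma_finite_positive_L2 mu.
have [U [UU oU]] := ultraFilterLemma (eventually_filter : ProperFilter \oo).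
have [k' [hk' kk']] := weak_limit_exists hk kC UU he e0.
by exists U, k'; split => //; exact: ultra_proper.
Qed.

End WeakCluster.

(** * Vectors with finitely many Gram coefficients *)

Section GroupAction.
Context (G : topologicalGroupType) d (T : measurableType d) (R : realType).
Context (mu : {sigma_finite_measure set T -> \bar R}).
Variable phi : nonsingular_action G mu.
Implicit Types (g h : G) (k l : T -> R).

Lemma nsaK g a : phi (g^-1)%g (phi g a) = a.
Proof. by rewrite -nsaM mulVg nsa1E. Qed.

Lemma nsaKV g a : phi g (phi (g^-1)%g a) = a.
Proof. by rewrite -nsaM mulgV nsa1E. Qed.

Lemma gactM g h k : L2cone mu k ->
  \forall x \ae mu, act (phi (g * h)%g) k x = act (phi g) (act (phi h) k) x.
Proof. by move=> hk; rewrite nsa_mul; exact: act_mul. Qed.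

Lemma gact1 k : L2cone mu k -> \forall x \ae mu, act (phi 1%g) k x = k x.
Proof. by move=> hk; rewrite nsa1E; exact: act1. Qed.

Lemma ip_ael k k' l : L2cone mu k -> L2cone mu k' -> L2cone mu l ->
  (\forall x \ae mu, k x = k' x) -> ip mu k l = ip mu k' l.
Proof. by move=> hk hk' hl kk'; apply: ip_ae => //; exact: aeW. Qed.

Lemma ip_aer k k' l : L2cone mu k -> L2cone mu k' -> L2cone mu l ->
  (\forall x \ae mu, k x = k' x) -> ip mu l k = ip mu l k'.
Proof. by move=> hk hk' hl kk'; rewrite ![ip mu l _]ipC; exact: ip_ael. Qed.

Lemma gact_adj g k l : L2cone mu k -> L2cone mu l ->
  ip mu (act (phi g) k) l = ip mu k (act (phi (g^-1)%g) l).
Proof.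
move=> hk hl; rewrite -[RHS](act_ip (phi g))//; last exact: L2cone_act.
have hgk := L2cone_act (phi g) hk; have hVl := L2cone_act (phi (g^-1)%g) hl.
have hgVl := L2cone_act (phi g) hVl.
apply: ip_aer => //; have := gactM g (g^-1)%g hl.
rewrite mulgV; apply: filterS2 (gact1 hl) => x e1 e2.
by rewrite -e2 e1.
Qed.

Lemma gact_adjM g h k l : L2cone mu k -> L2cone mu l ->
  ip mu (act (phi g) k) (act (phi h) l) = ip mu k (act (phi (g^-1 * h)%g) l).
Proof.
move=> hk hl; have hhl := L2cone_act (phi h) hl.
rewrite (gact_adj g hk hhl); have hVl := L2cone_act (phi (g^-1)%g) hhl.
have hVhl := L2cone_act (phi (g^-1 * h)%g) hl.
by apply: ip_aer => //; apply: filterS (gactM (g^-1)%g h hl) => x ->.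
Qed.

Definition supported k (w : MALG mu) :=
  \forall x \ae mu, k x = k x * \1_(malg_set w) x.

Lemma supported_act k w g : L2cone mu k -> supported k w ->
  supported (act (phi g) k) (phi g w).
Proof.
move=> hk kw; have mw := measurable_malg_set w.
have h1 := is_act_indic hk mw (actP (phi g) hk); rewrite malg_setK in h1.
exact: (is_act_ae hk (L2cone_mul_indic mw hk) kw (actP (phi g) hk) h1).
Qed.

Lemma supported_indic k (w : MALG mu) : supported (fun x => k x * \1_(malg_set w) x) w.
Proof.
apply: aeW => x; rewrite -mulrA; congr (_ * _).
by rewrite indicE; case: (_ \in _); rewrite ?mulr1 ?mulr0.
Qed.

Hypothesis G_nonarch : non_archimedean G.

(** The vector of minimal norm in the convex set [Cx] is unique, hence fixed by
    [V]; it is nonzero since [f0] pairs with it to at least [1]. *)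
Lemma fixed_vector (w : MALG mu) : invariant_element phi w -> w <> \bot%O ->
  exists (V : openSubgroup G) (f : T -> R), [/\ L2cone mu f, 0 < ip mu f f,
    supported f w &
    forall v, osg_set V v -> \forall x \ae mu, act (phi v) f x = f x].
Proof.
move=> winv w0; have mw := measurable_malg_set w.
have [f0 [hf0 f0_gt0 f0w]] : exists f0, [/\ L2cone mu f0, 0 < ip mu f0 f0 & supported f0 w].
  have [e [he e0]] := sigma_finite_positive_L2 mu.
  have hew := L2cone_mul_indic mw he.
  exists (fun x => e x * \1_(malg_set w) x); split => //.
    rewrite lt0r ip_ge0// andbT; apply/negP => /eqP/(ip_eq0 hew) ew.
    apply: w0; apply/malg_bot_aeP; apply: filterS ew => x /eqP.
    rewrite mulf_eq0 gt_eqF//= indicE => /eqP + wx.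
    by rewrite mem_set// => /eqP; rewrite oner_eq0.
  exact: supported_indic.
set c0 := ip mu f0 f0 in f0_gt0.
(* The squared distance [2 c0 - 2 ip f0 (v f0)] is below [c0], so the inner product exceeds
   [c0 / 2]. *)
have [V VU] := G_nonarch (act_continuous1 phi hf0 f0_gt0).
have Vf0 v : osg_set V v -> c0 / 2 < ip mu f0 (act (phi v) f0).
  move=> /VU/=; rewrite /sqdist act_ip// -/c0 [ip mu _ f0]ipC.
  by move: (ip mu f0 (act (phi v) f0)) => b; lra.
(* A set cut out by lower bounds on inner products with the translates of [f0] by [V]: it is convex,
   stable under [V] and closed under weak limits. *)
pose Cx x := L2cone mu x /\ forall v, osg_set V v -> 1 <= ip mu x (act (phi v) f0).
pose D := [set r : R | exists2 x, Cx x & r = ip mu x x].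
(* Multiplication of [f0] by [2 / c0] turns the bound [c0 / 2] into 1. *)
have D0 : D !=set0.
  exists (ip mu (fun x => 2 / c0 * f0 x) (fun x => 2 / c0 * f0 x)).
  have c2 : 0 <= 2 / c0 by rewrite divr_ge0// ltW.
  exists (fun x => 2 / c0 * f0 x) => //; split; first exact: L2coneZ.
  move=> v Vv; rewrite (ipZl (2 / c0) hf0 (L2cone_act _ hf0)).
  rewrite mulrAC ler_pdivlMr// mul1r; move: (Vf0 v Vv).
  by move: (ip mu f0 (act (phi v) f0)) => b; lra.
have Dlb : has_lbound D.
  by exists 0 => _ [x [hx _] ->]; exact: ip_ge0.
have infD : has_inf D by split.
set delta := inf D.
have /choice[xs xsP] : forall n : nat, exists x, Cx x /\ ip mu x x < delta + n.+1%:R^-1.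
  move=> n; have n0 : 0 < n.+1%:R^-1 :> R by rewrite invr_gt0.
  by have [_ [x Cxx ->] h] := @inf_adherent _ D _ n0 infD; exists x.
have xC n : ip mu (xs n) (xs n) <= delta + 1.
  have [_ /ltW h] := xsP n; apply: (le_trans h); rewrite lerD2l.
  by rewrite invf_le1// ler1n.
have xL n : L2cone mu (xs n) by case: (xsP n) => -[].
have [U [x [PU oU hx xlim]]] := weak_cluster xL xC.
have Cxx : Cx x.
  split => // v Vv; have hv := L2cone_act (phi v) hf0.
  have c1 : (fun=> 1 : R) @ U --> (1 : R) by exact: cvg_cst.
  apply: (ler_cvg_to c1 (xlim _ hv)); apply: nearW => n.
  by have [[_ h] _] := xsP n; exact: h.
have deltaD y : Cx y -> delta <= ip mu y y.
  by move=> Cy; apply: ge_inf => //; exists y.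
have xdelta : ip mu x x = delta.
  apply/eqP; rewrite eq_le deltaD// andbT.
  (* Cauchy-Schwarz for [xs n] and [x], in the limit along [U]. *)
  have : ip mu x x ^+ 2 <= delta * ip mu x x.
    have dU : (fun n : nat => delta + n.+1%:R^-1) @ U --> delta.
      have dN : (fun n : nat => delta + n.+1%:R^-1) @ \oo --> delta.
        rewrite -[X in _ --> X]addr0; apply: cvgD; first exact: cvg_cst.
        exact: cvg_harmonic.
      by move=> N /dN; exact: oU.
    rewrite expr2.
    apply: (ler_cvg_to (cvgM (xlim _ hx) (xlim _ hx))
      (cvgM dU (cvg_cst (ip mu x x) (F := U)))).
    apply: nearW => n /=; rewrite -expr2.
    rewrite (le_trans (ip_cauchy_schwarz (xL n) hx))//.
    by rewrite ler_wpM2r ?ip_ge0//; have [_ /ltW] := xsP n.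
  have := ip_ge0 hx hx; rewrite [0 <= _]le_eqVlt => /orP[/eqP <- _|ip0].
    by apply: lb_le_inf => // _ [y [hy _] ->]; exact: ip_ge0.
  by rewrite expr2 ler_pM2r.
have xfix v : osg_set V v -> \forall t \ae mu, x t = act (phi v) x t.
  move=> Vv; have hvx := L2cone_act (phi v) hx.
  apply: sqdist_eq0 => //.
  apply/eqP; rewrite eq_le sqdist_ge0// andbT /sqdist act_ip// xdelta.
  (* The midpoint lies in [Cx], so its squared norm is at least [delta]; by the parallelogram
     identity its endpoints, both of squared norm [delta], coincide. *)
  pose z t := 2^-1 * (x t + act (phi v) x t).
  have hxv := L2coneD hx hvx.
  have h2 : 0 <= 2^-1 :> R by rewrite invr_ge0.
  have hz : L2cone mu z by exact: L2coneZ.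
  have Cz : Cx z.
    split => // v' Vv'; have hv' := L2cone_act (phi v') hf0.
    rewrite (ipZl 2^-1 hxv hv') (ipDl hx hvx hv') (gact_adjM _ _ hx hf0).
    have [_ h] := Cxx; move: (h _ Vv') (h _ (osgM (osgV Vv) Vv')).
    move: (ip mu x (act (phi v') f0)) (ip mu x (act (phi (v^-1 * v')%g) f0)) => a b.
    lra.
  have := deltaD _ Cz.
  rewrite (ipZl 2^-1 hxv hz) (ipZr 2^-1 hxv hxv) (ipDl hx hvx hxv) (ipDr hx hvx hx)
    (ipDr hx hvx hvx) act_ip// xdelta [ip mu (act _ _) x]ipC.
  by move: (ip mu x (act (phi v) x)) => a; lra.
(* Restriction to the invariant [w] keeps the vector fixed by [V], and nonzero because [f0] is
   supported in [w]. *)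
exists V, (fun t => x t * \1_(malg_set w) t); split.
- exact: L2cone_mul_indic.
- have hxw := L2cone_mul_indic mw hx.
  rewrite lt0r ip_ge0// andbT; apply/negP => /eqP/(ip_eq0 hxw) xw0.
  have [_ /(_ 1%g (osg1 V))] := Cxx.
  rewrite (ip_aer (L2cone_act _ hf0) hf0 hx (gact1 hf0)).
  rewrite (ip_aer hf0 (L2cone_mul_indic mw hf0) hx f0w) -indic_ip.
  have h0 : L2cone mu (cst 0) by apply: L2cone_le (hf0) => // t; rewrite lexx/=; case: hf0.
  by rewrite (ip_ael hxw h0 hf0 xw0) ip0l ler10.
- exact: supported_indic.
- move=> v Vv; have hxw := L2cone_mul_indic mw hx.
  have := is_act_indic hx mw (actP (phi v) hx); rewrite malg_setK winv => h1.
  have := is_act_ae hxw hxw (aeW _ (fun=> erefl)) (actP (phi v) hxw) h1.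
  by apply: filterS2 (xfix v Vv) => t -> ->.
Qed.

End GroupAction.

Section FiniteRealSets.
Context (R : realType).

Lemma finite_isolated (D : set R) (r : R) : finite_set D ->
  exists2 e : R, 0 < e & forall x, D x -> `|r - x| < e -> x = r.
Proof.
move=> fD.
have cD : closed (D `\ r).
  apply: compact_closed; first exact: Rhausdorff.
  by apply: finite_compact; exact: finite_setD.
have : nbhs r (~` (D `\ r)).
  by apply: open_nbhs_nbhs; split; [exact: closed_openC|move=> -[_]; exact].
move=> /nbhs_ballP[e /= e0 eD]; exists e => // x Dx rx.
by apply: contrapT => xr; apply: (eD x).
Qed.

Lemma finite_limit (D : set R) (r : R) : finite_set D ->
  (forall e : R, 0 < e -> exists2 x, D x & `|r - x| < e) -> D r.
Proof.
move=> fD h; have [e e0 De] := finite_isolated r fD.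
by have [x Dx rx] := h _ e0; rewrite -(De _ Dx rx).
Qed.

Lemma finite_min (D : set R) : finite_set D -> D !=set0 ->
  exists2 a, D a & forall b, D b -> a <= b.
Proof.
move=> /finite_seqP[s ->] {D}; elim: s => [[x]//|a s IH _].
have [s0|/set0P s_neq0] := eqVneq [set` s] set0.
  exists a; first by rewrite /= mem_head.
  move=> b; rewrite /= in_cons => /orP[/eqP->//|bs].
  by have : [set` s] b by []; rewrite s0.
have [c cs cmin] := IH s_neq0.
have [ac|ca] := leP a c.
  exists a; first by rewrite /= mem_head.
  by move=> b; rewrite /= in_cons => /orP[/eqP->//|/cmin]; exact: le_trans.
exists c; first by rewrite /= in_cons cs orbT.
by move=> b; rewrite /= in_cons => /orP[/eqP->|/cmin//]; exact: ltW.
Qed.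

End FiniteRealSets.

Section MinimalVector.
Context (G : topologicalGroupType) d (T : measurableType d) (R : realType).
Context (mu : {sigma_finite_measure set T -> \bar R}).
Variable phi : nonsingular_action G mu.
Hypothesis G_nonarch : non_archimedean G.
Hypothesis G_roelcke : roelcke_precompact G.
Implicit Types (g h : G) (k l : T -> R).

Local Notation tr g k := (act (phi g) k).

(** The coefficient depends only on the double coset [V g V], and Roelcke precompactness leaves
    finitely many of these. *)
Lemma gram_finite (V : openSubgroup G) f : L2cone mu f ->
  (forall v, osg_set V v -> \forall x \ae mu, act (phi v) f x = f x) ->
  finite_set [set ip mu f (act (phi g) f) | g in setT].
Proof.
move=> hf Vf.
have nV : nbhs 1%g (osg_set V).
  by apply: open_nbhs_nbhs; split; [exact: osg_open|exact: osg1].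
have [F fF GE] := G_roelcke nV.
apply: (sub_finite_set _ (finite_image (fun a => ip mu f (tr a f)) fF)).
move=> _ [g _ <-]; have : set_mul (set_mul (osg_set V) F) (osg_set V) g by rewrite -GE.
move=> [_ [v1 Vv1 [a Fa <-]] [v2 Vv2 <-]]; exists a; first exact: Fa.
have h1 : \forall x \ae mu, tr (v1 * a * v2)%g f x = tr (v1 * a)%g f x.
  have := act_ae (phi (v1 * a)%g) (L2cone_act (phi v2) hf) hf (Vf _ Vv2).
  by apply: filterS2 (gactM phi (v1 * a)%g v2 hf) => x -> ->.
rewrite (ip_aer (L2cone_act _ hf) (L2cone_act _ hf) hf h1).
rewrite -(ip_ael (L2cone_act _ hf) hf (L2cone_act (phi (v1 * a)%g) hf) (Vf _ Vv1)).
by rewrite (gact_adjM phi v1 (v1 * a)%g hf hf) mulKg.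
Qed.

(** The Gram coefficients of a weak limit of translates of [f] are limits of elements of the finite
    set [D], hence lie in [D]; so the nonzero norms take finitely many values and a smallest one is
    attained. Weak limits of translates of the minimizer are again weak limits of translates of
    [f]. *)
Lemma minimal_vector (w : MALG mu) : invariant_element phi w -> w <> \bot%O ->
  exists k (D : set R), [/\ L2cone mu k, 0 < ip mu k k, supported k w, finite_set D &
    (forall g, D (ip mu k (act (phi g) k))) /\
    forall (g : nat -> G) (U : set_system nat) k', ProperFilter U ->
      L2cone mu k' -> 0 < ip mu k' k' ->
      (forall x, L2cone mu x ->
        (fun n => ip mu (act (phi (g n)) k) x) @ U --> ip mu k' x) ->
      ip mu k k <= ip mu k' k'].
Proof.
move=> winv w0; have [V [f [hf f0 fw Vf]]] := fixed_vector G_nonarch winv w0.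
have mw := measurable_malg_set w.
pose D := [set ip mu f (tr g f) | g in setT].
have fD : finite_set D by exact: gram_finite Vf.
(* A cheap substitute for the weak closure of the orbit of [f]: only one test
   vector at a time is needed. *)
pose K k := L2cone mu k /\ forall x, L2cone mu x -> forall e : R, 0 < e ->
  exists g, `|ip mu k x - ip mu (tr g f) x| < e.
have Kf : K f.
  split => // x hx e e0; exists 1%g.
  by rewrite (ip_ael (L2cone_act _ hf) hf hx (gact1 phi hf)) subrr normr0.
(* The two copies of [k] are replaced one at a time, by [g1 f] and then by [g2 f], at a cost of
   [e / 2] each. *)
have KD k g : K k -> D (ip mu k (tr g k)).
  move=> [hk Kk]; apply: finite_limit => // e e0.
  have e2 : 0 < e / 2 by rewrite divr_gt0.
  have [g1 hg1] := Kk _ (L2cone_act (phi g) hk) _ e2.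
  have [g2 hg2] := Kk _ (L2cone_act (phi (g^-1 * g1)%g) hf) _ e2.
  exists (ip mu (tr g2 f) (tr (g^-1 * g1)%g f)).
    rewrite (gact_adjM phi _ _ hf hf).
    by exists (g2^-1 * (g^-1 * g1))%g.
  have E : ip mu (tr g1 f) (tr g k) = ip mu k (tr (g^-1 * g1)%g f).
    by rewrite ipC (gact_adjM phi _ _ hk hf).
  rewrite E in hg1.
  rewrite (splitr e); apply: le_lt_trans (ltrD hg1 hg2).
  exact: ler_distD.
have KN k : K k -> D (ip mu k k).
  move=> Kk; have [hk _] := Kk; have := KD k 1%g Kk.
  by rewrite (ip_aer (L2cone_act _ hk) hk hk (gact1 phi hk)).
pose E := [set r | exists k, [/\ K k, 0 < ip mu k k & r = ip mu k k]].
have fE : finite_set E.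
  by apply: sub_finite_set fD => _ [k [Kk _ ->]]; exact: KN.
have E0 : E !=set0 by exists (ip mu f f), f.
have [_ [k [Kk k0 ->]] kmin] := finite_min fE E0.
have [hk Kka] := Kk.
exists k, D; split => //.
(* All translates of [f] vanish off [w], so they are orthogonal to the restriction of [k] to the
   complement of [w]; hence so is [k]. *)
- have hkC := L2cone_mul_indic (measurableC mw) hk.
  have h0 : ip mu k (fun x => k x * \1_(~` malg_set w) x) = 0.
    apply/eqP; rewrite eq_le ip_ge0// andbT; apply/ler_addgt0Pr => e e0.
    have [g] := Kka _ hkC _ e0; rewrite add0r.
    rewrite [ip mu (tr g f) _](_ : _ = 0); last first.
      have htf := L2cone_act (phi g) hf.
      rewrite -indic_ip (@ip_ael _ _ _ _ _ (cst 0))//.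
      + exact: ip0l.
      + exact: L2cone_mul_indic (measurableC mw) htf.
      + by apply: L2cone_le (hf) => // x; rewrite lexx/=; case: hf.
      + have := supported_act phi g hf fw; rewrite winv; apply: filterS => x ->.
        rewrite -mulrA !indicE in_setC; case: (x \in malg_set w) => /=.
          by rewrite !mulr0.
        by rewrite mul0r mulr0.
    by rewrite subr0 ger0_norm ?ip_ge0// => /ltW.
  have : \forall x \ae mu, k x * \1_(~` malg_set w) x = 0.
    apply: (ip_eq0 hkC); rewrite indic_ip -[RHS]h0; congr ip; apply/funext => x.
    rewrite -mulrA; congr (_ * _).
    by rewrite indicE; case: (_ \in _); rewrite ?mulr1 ?mulr0.
  apply: filterS => x; rewrite !indicE in_setC.
  by case: (x \in malg_set w) => /=; rewrite ?mulr1// mulr0.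
- split=> [g|g U k' PU hk' k'0 klim]; first exact: KD.
  apply: kmin; exists k'; split => //; split => // x hx e e0.
  have e2 : 0 < e / 2 by rewrite divr_gt0.
  have [n hn] : exists n, `|ip mu k' x - ip mu (act (phi (g n)) k) x| < e / 2.
    have /cvgrPdist_lt/(_ _ e2) := klim _ hx.
    by move=> /filter_ex[n hn]; exists n.
  have hVx := L2cone_act (phi (g n)^-1%g) hx.
  have [h hh] := Kka _ hVx _ e2.
  exists (g n * h)%g; have hhf := L2cone_act (phi h) hf.
  rewrite (ip_ael (L2cone_act _ hf) (L2cone_act _ hhf) hx (gactM phi (g n) h hf)).
  rewrite (gact_adj phi (g n) hhf hx).
  rewrite (gact_adj phi (g n) hk hx) in hn.
  rewrite (splitr e); apply: le_lt_trans (ltrD hn hh).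
  exact: ler_distD.
Qed.

End MinimalVector.

(** * Cells *)

Section OpenSubgroups.
Context (G : topologicalGroupType).

Lemma nbhs_translate (S : set G) (x : G) : nbhs 1%g S ->
  nbhs x [set y | S (x^-1 * y)%g].
Proof.
move=> nS; have c : (fun y : G => (x^-1 * y)%g) @ x --> (1%g : G).
  rewrite -(mulVg x).
  apply: (@cvg_comp _ _ _ (fun y : G => ((x^-1)%g, y)) (fun p : G * G => (p.1 * p.2)%g) _
     (nbhs ((x^-1)%g, x))).
    by apply: cvg_pair; [exact: cvg_cst|exact: cvg_id].
  exact: (@mulg_continuous G ((x^-1)%g, x)).
exact: c.
Qed.

Lemma mk_open_subgroup (S : set G) : S 1%g ->
  (forall x y, S x -> S y -> S (x * y)%g) -> (forall x, S x -> S (x^-1)%g) ->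
  nbhs 1%g S -> exists V : openSubgroup G, osg_set V = S.
Proof.
move=> S1 SM SV nS.
have oS : open S.
  rewrite openE => x Sx; apply: filterS (nbhs_translate x nS) => y /= /(SM _ _ Sx).
  by rewrite mulVKg.
by exists (OpenSubgroup oS S1 SM SV).
Qed.

Lemma lcoset_act_inj (V : openSubgroup G) (g : G) : injective (@lcoset_act G V g).
Proof.
move=> c c'; rewrite -[c]reprK -[c']reprK !lcoset_act_pi => /lcoset_eqP.
by rewrite invgM -mulgA mulKg => h; apply/lcoset_eqP.
Qed.

End OpenSubgroups.

(** * Supports of translates *)

Section Support.
Context (G : topologicalGroupType) d (T : measurableType d) (R : realType).
Context (mu : {sigma_finite_measure set T -> \bar R}).
Variable phi : nonsingular_action G mu.
Implicit Types (g h : G) (k l : T -> R) (a b w : MALG mu).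

Lemma nsa_le g a b : (phi g a <= phi g b)%O = (a <= b)%O.
Proof. exact: autstar_le. Qed.

Lemma nsaI g a b : phi g (a `&` b)%O = (phi g a `&` phi g b)%O.
Proof. exact: autstarI. Qed.

Lemma nsa0 g : phi g \bot%O = \bot%O.
Proof. exact: autstar0. Qed.

Lemma nsa_eq0 g a : phi g a = \bot%O <-> a = \bot%O.
Proof.
split=> [h|->]; last exact: nsa0.
by rewrite -(nsaK phi g a) h nsa0.
Qed.

Definition msupp k : MALG mu := malg_class mu [set x | k x != 0].

Lemma measurable_neq0 k : measurable_fun setT k -> measurable [set x | k x != 0].
Proof.
move=> mk; rewrite (_ : [set x | _] = ~` (k @^-1` [set 0])).
  by apply: measurableC; exact: measurable_preimage.
by apply/seteqP; split => x /eqP.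
Qed.

Lemma malg_set_msupp k : measurable_fun setT k ->
  \forall x \ae mu, malg_set (msupp k) x <-> k x <> 0.
Proof.
move=> mk; apply: filterS (malg_classK mu (measurable_neq0 mk)) => x -> /=.
by split => /eqP.
Qed.

Lemma msupp_ae k l : measurable_fun setT k -> measurable_fun setT l ->
  (\forall x \ae mu, k x = l x) -> msupp k = msupp l.
Proof.
move=> mk ml kl; apply/malg_class_aeP; [exact: measurable_neq0|exact: measurable_neq0|].
by apply: filterS kl => x /= ->.
Qed.

Lemma supported_leP k w : measurable_fun setT k ->
  supported k w <-> (msupp k <= w)%O.
Proof.
move=> mk; split => [kw|/malg_leP].
  apply/malg_leP; apply: filterS2 kw (malg_set_msupp mk) => x kx -> k0.
  apply: contrapT => nw; apply: k0; rewrite kx indicE memNset ?mulr0//.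
apply: filterS2 (malg_set_msupp mk) => x e h; rewrite indicE.
have [->|/eqP k0] := eqVneq (k x) 0; first by rewrite mul0r.
by rewrite mem_set ?mulr1//; apply: h; apply/e.
Qed.

(** [supported_act] gives one inequality, and the same inequality for [g^-1] gives the other. *)
Lemma msupp_act g k : L2cone mu k -> msupp (act (phi g) k) = phi g (msupp k).
Proof.
have le h l : L2cone mu l -> (msupp (act (phi h) l) <= phi h (msupp l))%O.
  move=> hl; have [ml _ _] := hl; have [mal _ _] := L2cone_act (phi h) hl.
  by apply/(supported_leP _ mal)/supported_act => //; apply/supported_leP.
move=> hk; apply/eqP; rewrite eq_le le//=.
have hgk := L2cone_act (phi g) hk; have hVgk := L2cone_act (phi (g^-1)%g) hgk.
have [mk _ _] := hk; have [mgk _ _] := hgk; have [mVgk _ _] := hVgk.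
have := le (g^-1)%g _ hgk; rewrite (@msupp_ae _ k)//.
  by rewrite -(nsa_le g) nsaKV.
have := gactM phi (g^-1)%g g hk; rewrite mulVg.
by apply: filterS2 (gact1 phi hk) => x <- ->.
Qed.

(** A nonnegative product with zero integral vanishes almost everywhere. *)
Lemma ip_msupp k l : L2cone mu k -> L2cone mu l -> ip mu k l = 0 ->
  (msupp k `&` msupp l)%O = \bot%O.
Proof.
move=> hk hl kl0; have [mk k0 _] := hk; have [ml l0 _] := hl.
have mkl : measurable_fun setT (fun x => k x * l x) by exact: measurable_funM.
have kl : \forall x \ae mu, k x * l x = 0.
  apply: (density_ae_eq (g := cst 0)) => //.
  - by move=> x; rewrite mulr_ge0.
  - by rewrite /density L2cone_integrable_prod// ltry.
  - move=> A mA; rewrite [RHS]integral0; apply/eqP; rewrite eq_le; apply/andP; split.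
      apply: (@le_trans _ _ (density mu (fun x => k x * l x) setT)).
        apply: ge0_subset_integral => //; first exact/measurable_EFinP.
        by move=> x _; rewrite lee_fin mulr_ge0.
      by rewrite /density L2cone_integrable_prod// kl0.
    by apply: integral_ge0 => x _; rewrite lee_fin mulr_ge0.
apply/malg_bot_aeP.
have := malg_set_meet (msupp k) (msupp l).
apply: filterS2 (ae_and kl (ae_and (malg_set_msupp mk) (malg_set_msupp ml))) => x.
move=> [klx [ek el]] e /e [/ek kx /el lx]; move/eqP : klx.
by rewrite mulf_eq0 => /orP[/eqP|/eqP].
Qed.

End Support.

Section Cells.
Context (G : topologicalGroupType) d (T : measurableType d) (R : realType).
Context (mu : {sigma_finite_measure set T -> \bar R}).
Variable phi : nonsingular_action G mu.
Hypothesis G_nonarch : non_archimedean G.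
Hypothesis G_roelcke : roelcke_precompact G.
Implicit Types (g h : G) (k l : T -> R) (a b w : MALG mu).

Local Notation tr g k := (act (phi g) k).

Section Stabilizer.
Variables (k : T -> R) (D : set R).
Hypotheses (hk : L2cone mu k) (k_gt0 : 0 < ip mu k k) (fD : finite_set D).
Hypothesis kD : forall g, D (ip mu k (tr g k)).
Hypothesis kmin : forall (g : nat -> G) (U : set_system nat) k', ProperFilter U ->
  L2cone mu k' -> 0 < ip mu k' k' ->
  (forall x, L2cone mu x ->
     (fun n => ip mu (tr (g n) k) x) @ U --> ip mu k' x) ->
  ip mu k k <= ip mu k' k'.

Let stab := [set g | \forall x \ae mu, tr g k x = k x].

Let tr_fixM g h : stab h -> \forall x \ae mu, tr (g * h)%g k x = tr g k x.
Proof.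
move=> sh; have := act_ae (phi g) (L2cone_act (phi h) hk) hk sh.
by apply: filterS2 (gactM phi g h hk) => x -> ->.
Qed.

(** For [g] near the identity, [ip k (g k)] is an element of [D] close to the isolated value
    [ip k k], hence equal to it; the squared distance [2 (ip k k - ip k (g k))] is then 0. *)
Lemma stabilizer_open : exists V : openSubgroup G, osg_set V = stab.
Proof.
apply: mk_open_subgroup.
- exact: gact1.
- move=> x y sx sy; have := sx; rewrite /stab/=.
  by apply: filterS2 (tr_fixM x sy) => t -> ->.
- move=> x sx; have := tr_fixM (x^-1)%g sx; rewrite mulVg.
  by apply: filterS2 (gact1 phi hk) => t <- ->.
- have [e e0 De] := finite_isolated (ip mu k k) fD.
  apply: filterS (act_continuous1 phi hk e0) => g /=.
  have hgk := L2cone_act (phi g) hk.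
  have s0 := sqdist_ge0 hgk hk.
  rewrite /sqdist act_ip// [ip mu (tr g k) k]ipC => h.
  have E : ip mu k (tr g k) = ip mu k k.
    apply: De => //; move: s0 h; rewrite /sqdist act_ip// [ip mu (tr g k) k]ipC.
    move: (ip mu k k) (ip mu k (tr g k)) => a b s0 h.
    by rewrite ger0_norm; lra.
  apply: sqdist_eq0 => //; rewrite /sqdist act_ip// [ip mu (tr g k) k]ipC E.
  by move: (ip mu k k) => a; lra.
Qed.

Variables (V : openSubgroup G) (VE : osg_set V = stab).

Lemma tr_lcoset g h : \pi_(lcosets V)%qT g = \pi_(lcosets V)%qT h ->
  \forall x \ae mu, tr g k x = tr h k x.
Proof.
move=> /esym/lcoset_eqP; rewrite VE => /(tr_fixM h).
by rewrite mulVKg; apply: filterS => x ->.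
Qed.

(** A weak limit of infinitely many translates at a fixed distance from being
    orthogonal to [k] is nonzero, so its norm is at least that of [k]; two of
    these translates then have inner product close to, hence equal to, [ip k k]. *)
Lemma finite_neighbours :
  finite_set [set c : lcosets V | ip mu (tr (repr c) k) k != 0].
Proof.
apply: contrapT => /infiniteP/pcard_leP/unsquash f.
pose g n := repr (f n).
have f_inj n m : f n = f m -> n = m.
  by move=> fnm; apply: (@inj _ _ _ f) => //; exact: mem_set.
have [ks ksE] : exists ks : nat -> T -> R, forall n, ks n = tr (g n) k.
  by exists (fun n => tr (g n) k).
have hks n : L2cone mu (ks n) by rewrite ksE; exact: L2cone_act.
have ksN n : ip mu (ks n) (ks n) = ip mu k k by rewrite ksE (act_ip (phi (g n)) hk hk).
have ksC n : ip mu (ks n) (ks n) <= ip mu k k by rewrite ksN.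
have ksD n : D (ip mu (ks n) k) by rewrite ksE ipC.
have [U [k' [PU oU hk' klim]]] := weak_cluster hks ksC.
(* A nonzero coefficient is at least the distance [e] which isolates 0 in [D], and this bound passes
   to the weak limit. *)
have [e e0 De] := finite_isolated 0 fD.
have ke n : e <= ip mu (ks n) k.
  rewrite leNgt; apply/negP => lt_e.
  have fN : ip mu (tr (g n) k) k != 0 by exact: (@funS _ _ _ _ f n I).
  move/eqP: fN; apply; rewrite -ksE; apply: (De _ (ksD n)).
  by rewrite sub0r normrN ger0_norm// ip_ge0.
have k'k : e <= ip mu k' k.
  have c1 : (fun=> e : R) @ U --> (e : R) by exact: cvg_cst.
  by apply: (ler_cvg_to c1 (klim _ hk)); apply: nearW.
have k'0 : 0 < ip mu k' k'.
  rewrite lt0r ip_ge0// andbT; apply/negP => /eqP k'0.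
  have := ip_cauchy_schwarz hk' hk; rewrite k'0 mul0r.
  have : 0 < ip mu k' k by exact: lt_le_trans k'k.
  by move: (ip mu k' k) => a; nra.
have kk' : ip mu k k <= ip mu k' k'.
  apply: (kmin (g := g) PU hk' k'0) => x hx.
  by rewrite (_ : (fun n => _) = (fun n => ip mu (ks n) x)); [exact: klim|
    apply/funext => n; rewrite ksE].
have [eta eta0 Deta] := finite_isolated (ip mu k k) fD.
have eta2 : 0 < eta / 2 by rewrite divr_gt0.
have near_lim x : L2cone mu x -> U [set n | ip mu k' x - eta / 2 < ip mu (ks n) x].
  move=> hx; have /cvgrPdist_lt/(_ _ eta2) := klim _ hx.
  apply: filterS => n /=; rewrite ltr_norml => /andP[_].
  by move: (ip mu k' x) (ip mu (ks n) x) => a b; lra.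
(* The order matters: [n] makes [ip k' (ks n)] nearly [ip k' k'], and only then [m > n] makes
   [ip (ks m) (ks n)] nearly [ip k' (ks n)]. The coefficient exceeds [ip k k - eta], while a
   nonnegative squared distance bounds it by [ip k k]. *)
have [n hn] := filter_ex (near_lim _ hk').
have Um : U [set m | (n < m)%N] by apply: oU; exists n.+1.
have [m [hm nm]] := filter_ex (filterI (near_lim _ (hks n)) Um).
move: hn hm => /= hn hm.
have Dnm : D (ip mu (ks n) (ks m)).
  by rewrite !ksE (gact_adjM phi _ _ hk hk); exact: kD.
have E2 : ip mu (ks n) (ks m) = ip mu k k.
  apply: (Deta _ Dnm); have := sqdist_ge0 (hks n) (hks m).
  rewrite /sqdist !ksN.
  move: hn hm kk'; rewrite [ip mu k' (ks n)]ipC [ip mu (ks m) (ks n)]ipC.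
  move: (ip mu k k) (ip mu k' k') (ip mu (ks n) k') (ip mu (ks n) (ks m)) => p q r s.
  by move=> h1 h2 h3 h4; rewrite ger0_norm; lra.
have ae_nm : \forall x \ae mu, ks n x = ks m x.
  apply: (sqdist_eq0 (hks n) (hks m)); rewrite /sqdist E2 !ksN.
  by move: (ip mu k k) => a; lra.
have : f n = f m.
  rewrite -[f n]reprK -[f m]reprK; apply/lcoset_eqP; rewrite VE /stab/=.
  have mn : \forall x \ae mu, ks m x = ks n x by apply: filterS ae_nm => x ->.
  have h1 := act_ae (phi (g n)^-1%g) (hks m) (hks n) mn.
  have hA := gactM phi (g n)^-1%g (g m) hk.
  have hB := gactM phi (g n)^-1%g (g n) hk.
  rewrite mulVg -ksE in hB; rewrite -ksE in hA.
  apply: filterS2 (ae_and hA hB) (ae_and (gact1 phi hk) h1) => x [eA eB] [e1 e2].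
  by rewrite eA e2 -eB e1.
by move=> /f_inj nm'; move: nm; rewrite nm' /= ltnn.
Qed.

End Stabilizer.
End Cells.

Section Cell.
Context (G : topologicalGroupType) d (T : measurableType d) (R : realType).
Context (mu : {sigma_finite_measure set T -> \bar R}).
Variable phi : nonsingular_action G mu.
Implicit Types (g h : G) (k l : T -> R) (a b w : MALG mu).

Local Notation tr g k := (act (phi g) k).

(** The translates of [A] by distinct cosets of [V] are disjoint, and [m] is a
    [V]-invariant finite measure in the class of the restriction of [mu] to [A]. *)
Definition is_cell (A : MALG mu) (V : openSubgroup G) (m : {measure set T -> \bar R}) :=
  [/\ A <> \bot%O, forall g, osg_set V g <-> phi g A = A &
    forall g, (phi g A `&` A)%O <> \bot%O -> phi g A = A] /\
  [/\ m `<< mu, (m setT < +oo)%E, m (~` malg_set A) = 0%E,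
    forall a, m (malg_set a) = 0%E -> (a `&` A)%O = \bot%O &
    forall g a, osg_set V g -> m (malg_set (phi g a)) = m (malg_set a)].

Section Cliques.
Variables (k : T -> R) (V : openSubgroup G).
Hypotheses (hk : L2cone mu k) (k_gt0 : 0 < ip mu k k).
Hypothesis VE : osg_set V = [set g | \forall x \ae mu, tr g k x = k x].
Hypothesis fN : finite_set [set c : lcosets V | ip mu (tr (repr c) k) k != 0].

Let S (c : lcosets V) : MALG mu := phi (repr c) (msupp mu k).

Let measurable_tr g : measurable_fun setT (tr g k).
Proof. by have [] := L2cone_act (phi g) hk. Qed.

Let S_pi g : S (\pi_(lcosets V)%qT g) = phi g (msupp mu k).
Proof.
rewrite /S -(msupp_act phi (repr _) hk) -(msupp_act phi g hk).
apply: (msupp_ae (measurable_tr _) (measurable_tr _)).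
by apply: (tr_lcoset hk VE); rewrite reprK.
Qed.

Let S_act g c : S (lcoset_act g c) = phi g (S c).
Proof. by rewrite /lcoset_act S_pi nsaM. Qed.

Let M (s : seq (lcosets V)) : MALG mu := (\meet_(c <- s) S c)%O.

Let phiM g s : phi g (M s) = M [seq lcoset_act g c | c <- s].
Proof.
rewrite /M (big_morph (phi g) (nsaI phi g) (autstar1 (phi g))) big_map.
by apply: eq_bigr => c _; rewrite S_act.
Qed.

Let leM a s : (forall c, c \in s -> (a <= S c)%O) -> (a <= M s)%O.
Proof. by move=> h; apply/meetsP_seq => c cs _; exact: h. Qed.

Let Mle c s : c \in s -> (M s <= S c)%O.
Proof. by move=> cs; exact: (meetsP_seq _ _ _ _ (lexx (M s))). Qed.

(** A clique is a family of translates of the support of [k] with non-null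
    intersection. If [g A] meets [A] for [A] the intersection of a clique [s] of
    maximal size, then [s] and its translate by [g] form a clique, hence coincide. *)
Let clique s := uniq s /\ M s <> \bot%O.

Let clique_act g s : clique s -> clique [seq lcoset_act g c | c <- s].
Proof.
move=> [us Ms]; split; first by rewrite map_inj_uniq//; exact: lcoset_act_inj.
by rewrite -phiM => /nsa_eq0.
Qed.

(** Once a clique is translated so as to contain the trivial coset, each of its supports meets the
    support of [k]; its cosets then lie in the finite set [fN]. *)
Let clique_bound : exists N, forall s, clique s -> (size s <= N)%N.
Proof.
have /finite_seqP[L LE] := fN; exists (size L) => s [us Ms].
case: s us Ms => [//|c0 s] us Ms.
pose t := [seq lcoset_act (repr c0)^-1%g c | c <- c0 :: s].
have [ut Mt] : clique t by exact: clique_act.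
rewrite -(size_map (lcoset_act (repr c0)^-1%g)); apply: uniq_leq_size => // c ct.
have c1t : \pi_(lcosets V)%qT 1%g \in t.
  rewrite /t /= (_ : lcoset_act _ c0 = \pi_(lcosets V)%qT 1%g) ?mem_head//.
  by rewrite -{2}[c0]reprK lcoset_act_pi mulVg.
suff : [set` L] c by [].
rewrite -LE /=; apply/eqP => c_orth; apply: Mt; apply/eqP; rewrite -lex0.
have <- : (S c `&` S (\pi_(lcosets V)%qT 1%g))%O = \bot%O.
  rewrite S_pi nsa1E -[X in (_ `&` X)%O]/(msupp mu k) /S -msupp_act//.
  by apply: ip_msupp => //; exact: L2cone_act.
by rewrite lexI !Mle.
Qed.

Let max_clique : exists s, [/\ clique s, (0 < size s)%N &
  forall t, clique t -> (size t <= size s)%N].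
Proof.
have [N sN] := clique_bound.
pose P n := `[< exists2 s, clique s & size s = n >].
have cl1 : clique [:: \pi_(lcosets V)%qT 1%g].
  split => //; rewrite /M big_seq1 S_pi nsa1E => s0.
  have [mk _ _] := hk.
  have : \forall x \ae mu, k x = 0.
    have /malg_bot_aeP : msupp mu k = \bot%O by exact: s0.
    apply: filterS2 (malg_set_msupp mu mk) => x e; rewrite e.
    by move=> nk; apply: contrapT.
  move=> k0; have h0 : L2cone mu (cst 0).
    by apply: L2cone_le (hk) => // x; rewrite lexx/=; case: hk.
  by move: k_gt0; rewrite (ip_ael hk h0 hk k0) ip0l ltxx.
have P1 : P 1%N by apply/asboolP; exists [:: \pi_(lcosets V)%qT 1%g].
have exP : exists n, P n by exists 1%N.
have PN n : P n -> (n <= N)%N by move=> /asboolP[s cs <-]; exact: sN.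
case: (ex_maxnP exP PN) => n /asboolP[s cs sn] nmax.
exists s; split => //; first by rewrite sn; exact: nmax P1.
by move=> t ct; rewrite sn; apply: nmax; apply/asboolP; exists t.
Qed.

Let Tm (c : lcosets V) b : \bar R := density mu (fun x => tr (repr c) k x ^+ 2) (malg_set b).

(** [g^-1] pushes the measure attached to [c] to the one attached to [g^-1 c]. *)
Let Tm_act g c b : Tm c (phi g b) = Tm (lcoset_act (g^-1)%g c) b.
Proof.
have hck := L2cone_act (phi (repr c)) hk.
have [_ h] := actP (phi (g^-1)%g) hck.
rewrite /Tm -h nsaK.
have := gactM phi (g^-1)%g (repr c) hk.
have : \forall x \ae mu, tr (g^-1 * repr c)%g k x = tr (repr (lcoset_act (g^-1)%g c)) k x.
  by apply: (tr_lcoset hk VE); rewrite reprK.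
move=> e1 e2; apply: ge0_ae_eq_integral.
- exact: measurable_malg_set.
- apply: measurable_funTS; apply/measurable_EFinP; apply: measurable_funX.
  by have [] := L2cone_act (phi (g^-1)%g) hck.
- by apply: measurable_funTS; apply/measurable_EFinP; exact: measurable_funX.
- by move=> x _; rewrite lee_fin sqr_ge0.
- by move=> x _; rewrite lee_fin sqr_ge0.
- by apply: filterS2 e1 e2 => x <- ->.
Qed.

Lemma cell_of_clique : exists A V' m, is_cell A V' m /\ exists g, (A <= phi g (msupp mu k))%O.
Proof.
have [s [[us Ms] s0 smax]] := max_clique.
pose A := M s.
have dich g : (phi g A `&` A)%O <> \bot%O ->
    perm_eq [seq lcoset_act g c | c <- s] s /\ phi g A = A.
  move=> gA; have [ugs Mgs] := clique_act g (conj us Ms).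
  pose gs := [seq lcoset_act g c | c <- s]; pose t := undup (s ++ gs).
  have ct : clique t.
    split; first exact: undup_uniq.
    move=> Mt; apply: gA; apply/eqP; rewrite -lex0 -Mt; apply: leM => c.
    rewrite mem_undup mem_cat => /orP[cs|cgs].
      by rewrite leIxr// Mle.
    by rewrite leIxl// phiM Mle.
  have st : {subset s <= t} by move=> c cs; rewrite mem_undup mem_cat cs.
  have [_ s_t] := uniq_min_size us st (smax _ ct).
  have gss : {subset gs <= s}.
    by move=> c cgs; rewrite s_t mem_undup mem_cat cgs orbT.
  have [|_ gs_s] := uniq_min_size ugs gss; first by rewrite size_map.
  have pgs : perm_eq gs s by exact: uniq_perm.
  by split => //; rewrite phiM /A /M; exact: perm_big.
have mA := measurable_malg_set A.
(* If [g A] were disjoint from [A], the vector [e 1_A] and its translate would be orthogonal, at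
   squared distance twice the squared norm. So [g A] meets [A] for [g] near the identity, and [dich]
   applies. *)
have [V' V'E] : exists V' : openSubgroup G, osg_set V' = [set g | phi g A = A].
  apply: mk_open_subgroup.
  - by rewrite /= nsa1E.
  - by move=> x y /= xA yA; rewrite nsaM yA xA.
  - by move=> x /= xA; rewrite -{1}xA nsaK.
  have [e [he e0]] := sigma_finite_positive_L2 mu.
  have heA := L2cone_mul_indic mA he.
  have eA_gt0 : 0 < ip mu (fun x => e x * \1_(malg_set A) x) (fun x => e x * \1_(malg_set A) x).
    rewrite lt0r ip_ge0// andbT; apply/negP => /eqP/(ip_eq0 heA) eA.
    apply: Ms; apply/malg_bot_aeP; apply: filterS eA => x /eqP.
    rewrite mulf_eq0 gt_eqF//= indicE => /eqP + Ax.
    by rewrite mem_set// => /eqP; rewrite oner_eq0.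
  apply: filterS (act_continuous1 phi heA eA_gt0) => g /= hg.
  have hgA := L2cone_act (phi g) heA.
  suff /dich[] : (phi g A `&` A)%O <> \bot%O by [].
  move=> gAA; move: hg.
  rewrite /sqdist (act_ip (phi g) heA heA).
  rewrite [X in _ - 2 * X](_ : _ = 0).
    by move: eA_gt0; move: (ip _ _ _) => a; lra.
  rewrite (ip_ael hgA (L2cone_mul_indic (measurable_malg_set (phi g A)) hgA) heA
    (supported_act phi g heA (supported_indic e A))).
  rewrite indic_ip ipC (@ip_ael _ _ _ _ _ (cst 0)) ?ip0l//.
  - exact: L2cone_mul_indic (measurable_malg_set _) heA.
  - by apply: L2cone_le (heA) => // x; rewrite lexx/=; case: heA.
  - have := malg_set_meet (phi g A) A.
    move/malg_bot_aeP : gAA; apply: filterS2 => x nx /iffRL mx.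
    rewrite !indicE -mulrA; case: (boolP (x \in malg_set A)) => xA; last by rewrite mul0r mulr0.
    case: (boolP (x \in malg_set (phi g A))) => xgA; last by rewrite !mulr0.
    by case: nx; apply: mx; split; exact: set_mem.
pose K x := (\sum_(c <- s) tr (repr c) k x ^+ 2) * \1_(malg_set A) x.
have mS : measurable_fun setT (fun x => \sum_(c <- s) tr (repr c) k x ^+ 2).
  by apply: measurable_sum => c; exact: measurable_funX.
have mK : measurable_fun setT K by exact: measurable_funM.
have S0 x : 0 <= \sum_(c <- s) tr (repr c) k x ^+ 2 by apply: sumr_ge0 => c _; exact: sqr_ge0.
have K0 x : 0 <= K x by rewrite mulr_ge0.
pose m : {measure set T -> \bar R} := density_of mu mK K0.
have dm : m `<< mu by exact: density_dominates.
have m_sum a : m (malg_set a) = (\sum_(c <- s) Tm c (a `&` A)%O)%E.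
  rewrite -[LHS]/(density mu K (malg_set a)) /K density_indic.
  have mI : measurable (malg_set a `&` malg_set A).
    by apply: measurableI; exact: measurable_malg_set.
  rewrite /density (eq_integral (fun x => \sum_(c <- s) (tr (repr c) k x ^+ 2)%:E)%E); last first.
    by move=> x _; rewrite sumEFin.
  rewrite ge0_integral_sum//.
  - apply: eq_bigr => c _; apply: density_ae => //.
    + exact: measurable_funX.
    + by move=> x; exact: sqr_ge0.
    + exact: measurable_malg_set.
    + by apply: filterS (malg_set_meet a A) => x; rewrite /setI/= /Order.meet/=; tauto.
  - move=> c; apply: measurable_funTS; apply/measurable_EFinP; exact: measurable_funX.
  - by move=> c x _; rewrite lee_fin sqr_ge0.
exists A, V', m; split; last first.
  case: s s0 @A {us Ms smax dich mA V'E K mS mK S0 K0 m dm m_sum} => [//|c s] _ A.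
  by exists (repr c); rewrite /A Mle// mem_head.
split; first by split => // [g|g /dich[]//]; rewrite V'E.
split => //.
- have -> : m setT = m (malg_set (\top%O : MALG mu)).
    apply: ae_measure_eq => //; first exact: measurable_malg_set.
    by apply: (dominates_ae dm); apply: filterS (malg_set_top mu) => x hx; split.
  rewrite m_sum; apply: lte_sum_pinfty => c _.
  apply: (@le_lt_trans _ _ (density mu (fun x => tr (repr c) k x ^+ 2) setT)).
    apply: ge0_subset_integral => //; first exact: measurable_malg_set.
      by apply/measurable_EFinP; exact: measurable_funX.
    by move=> x _; rewrite lee_fin sqr_ge0.
  by have [] := L2cone_act (phi (repr c)) hk.
- rewrite -[LHS]/(density mu K _) /K density_indic setICl.
  exact: integral_set0.
- move=> a ma0; apply/malg_bot_aeP.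
  have ma := measurable_malg_set a.
  have Ka : \forall x \ae mu, K x * \1_(malg_set a) x = 0.
    apply: (density_ae_eq (g := cst 0)) => //.
    + exact: measurable_funM.
    + by move=> x; rewrite mulr_ge0.
    + by rewrite density_indic setTI -[X in (X < _)%E]/(m (malg_set a)) ma0.
    + move=> B mB; rewrite density_indic [RHS]integral0.
      apply: (subset_measure0 (mu := m) _ ma _ ma0); first exact: measurableI.
      exact: subIsetr.
  (* One member of the clique is enough: [A] lies below its support, so its square is already
     positive on [A]. *)
  have sK : \forall x \ae mu, malg_set A x -> K x <> 0.
    case: s s0 @A @K {us Ms smax dich V'E mS mK S0 K0 m dm m_sum ma0 Ka mA} => [//|c s] _ A K.
    have : (A <= msupp mu (tr (repr c) k))%O by rewrite msupp_act// Mle// mem_head.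
    move=> /malg_leP; apply: filterS2 (malg_set_msupp mu (measurable_tr (repr c))) => x ec + Ax.
    move=> /(_ Ax)/ec kx; rewrite /K indicE mem_set// mulr1 big_cons => /eqP.
    rewrite gt_eqF// ltr_pwDl//; last by apply: sumr_ge0 => c' _; exact: sqr_ge0.
    by rewrite exprn_even_gt0//=; apply/eqP.
  apply: filterS3 Ka sK (malg_set_meet a A) => x kx sx ->[ax Ax].
  by apply: (sx Ax); move: kx; rewrite indicE mem_set// mulr1.
(* An element stabilizing [A] permutes the clique by [dich], hence permutes the summands of [m]. *)
- move=> g a; rewrite V'E /= => gA; rewrite !m_sum.
  have VgA : phi (g^-1)%g A = A by rewrite -{1}gA nsaK.
  have [pg _] : perm_eq [seq lcoset_act (g^-1)%g c | c <- s] s /\ phi (g^-1)%g A = A.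
    by apply: dich; rewrite VgA meetxx.
  rewrite -[RHS](perm_big _ pg) big_map; apply: eq_bigr => c _.
  have -> : (phi g a `&` A)%O = phi g (a `&` A)%O by rewrite nsaI gA.
  exact: Tm_act.
Qed.

End Cliques.

Hypothesis G_nonarch : non_archimedean G.
Hypothesis G_roelcke : roelcke_precompact G.

Lemma cell_exists w : invariant_element phi w -> w <> \bot%O ->
  exists A V m, is_cell A V m /\ (A <= w)%O.
Proof.
move=> winv w0.
have [k [D [hk k0 kw fD [kD kmin]]]] := minimal_vector G_nonarch G_roelcke winv w0.
have [V VE] := stabilizer_open hk fD kD.
have fN := finite_neighbours hk fD kD kmin VE.
have [A [V' [m [cAm [g Ag]]]]] := cell_of_clique hk k0 VE fN.
exists A, V', m; split => //; apply: (le_trans Ag).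
rewrite -(winv g) nsa_le; apply/supported_leP => //.
by have [] := hk.
Qed.

End Cell.

(** * Continuity of measure-preserving actions *)

Section MalgMeasure.
Context d (T : measurableType d) (R : realType).
Variables (mu m : {measure set T -> \bar R}) (dm : m `<< mu).
Implicit Types a b c : MALG mu.

Lemma malg_setI_ae a b : \forall x \ae mu,
  malg_set (a `&` b)%O x <-> malg_set a x /\ malg_set b x.
Proof. exact: malg_set_meet. Qed.

Lemma malg_setC_ae a : \forall x \ae mu, malg_set (~` a)%O x <-> ~ malg_set a x.
Proof. exact: malg_set_compl. Qed.

Lemma malg_set_ae_measure a (A : set T) : measurable A ->
  (\forall x \ae mu, malg_set a x <-> A x) -> m (malg_set a) = m A.
Proof.
move=> mA aA; apply: ae_measure_eq => //; first exact: measurable_malg_set.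
exact: dominates_ae dm aA.
Qed.

Lemma malg_measureID a c :
  m (malg_set a) = (m (malg_set (a `&` c)%O) + m (malg_set (a `&` ~` c)%O))%E.
Proof.
have ma := measurable_malg_set a; have mc := measurable_malg_set c.
rewrite (@malg_set_ae_measure (a `&` c)%O (malg_set a `&` malg_set c)); last 2 first.
- exact: measurableI.
- exact: malg_setI_ae.
rewrite (@malg_set_ae_measure (a `&` ~` c)%O (malg_set a `\` malg_set c)); last 2 first.
- exact: measurableD.
- by apply: filterS2 (malg_setI_ae a (~` c)%O) (malg_setC_ae c) => x; rewrite /setD/=; tauto.
by rewrite addeC -measureDI.
Qed.

Lemma malg_measure_le a b : (a <= b)%O -> (m (malg_set a) <= m (malg_set b))%E.
Proof. by move=> /meet_idPr ab; rewrite (malg_measureID b a) ab leeDl. Qed.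

End MalgMeasure.

Section ActionMeasureContinuity.
Context (G : topologicalGroupType) d (T : measurableType d) (R : realType).
Context (mu : {sigma_finite_measure set T -> \bar R}).
Variable phi : nonsingular_action G mu.

(** With [k] the root of the density of [m], the value [m a] is the integral of [(g k) ^ 2] over
    [g a]. As [g k] is close to [k], this is not much larger than [m (g a)]. *)
Lemma action_measure_continuous (m : {measure set T -> \bar R}) (a : MALG mu) (e : R) :
  m `<< mu -> (m setT < +oo)%E -> 0 < e ->
  nbhs (1%g : G) [set g | (m (malg_set a) <= m (malg_set (phi g a)) + e%:E)%E].
Proof.
move=> dm moo e0.
have [f [mf f0 mE]] := radon_nikodym_real moo dm.
pose k x := Num.sqrt (f x).
have k2 : (fun x => k x ^+ 2) = f by apply/funext => x; rewrite sqr_sqrtr.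
have mk : measurable_fun setT k by apply: measurableT_comp => //; exact: measurable_sqrt.
have hk : L2cone mu k.
  split => //; first by move=> x; exact: sqrtr_ge0.
  by under eq_integral do rewrite sqr_sqrtr//; rewrite -[X in (X < _)%E]/(density mu f setT) -mE.
pose M := fine (m setT).
have M0 : 0 <= M by exact: fine_ge0.
have ME : m setT = M%:E by rewrite fineK// ge0_fin_numE.
(* Chosen so that [dl * M <= e / 2]; the added 1 covers the case [M = 0]. *)
pose dl := e / (2 * (M + 1)).
have dl0 : 0 < dl by rewrite divr_gt0// mulr_gt0// ltr_wpDl.
have dlM : dl * M <= e / 2.
  by rewrite /dl invfM mulrA -mulrA ler_piMr ?divr_ge0 ?(ltW e0)// mulrC ler_pdivrMr ?mul1r; lra.
pose C := 1 + dl^-1.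
have C0 : 0 < C by rewrite addr_gt0// invr_gt0.
have e2 : 0 < e / 2 / C by rewrite !divr_gt0.
apply: filterS (act_continuous1 phi hk e2) => g /= hg.
have [hgk gkE] := actP (phi g) hk.
set u := act (phi g) k in hg hgk gkE.
have [mu' u0 _] := hgk.
have mB := measurable_malg_set (phi g a); set B := malg_set (phi g a) in mB gkE *.
have maE : m (malg_set a) = density mu (fun x => u x ^+ 2) B.
  by rewrite gkE k2 mE//; exact: measurable_malg_set.
have [iS SE] := sqdistE hgk hk.
have mS : measurable_fun setT (fun x => (u x - k x) ^+ 2).
  by apply: measurable_funX; exact: measurable_funB.
have Sfin : (\int[mu]_x ((u x - k x) ^+ 2)%:E = (sqdist mu u k)%:E)%E.
  by rewrite SE /Rintegral fineK//; exact: integrable_fin_num.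
(* [C = 1 + 1 / dl] makes the difference of the two sides [1 / dl] times a square. *)
have pp x : u x ^+ 2 <= (1 + dl) * k x ^+ 2 + C * (u x - k x) ^+ 2.
  rewrite -subr_ge0; have -> : (1 + dl) * k x ^+ 2 + C * (u x - k x) ^+ 2 - u x ^+ 2 =
      dl^-1 * (dl * k x - (u x - k x)) ^+ 2 by rewrite /C; field; exact: lt0r_neq0.
  by rewrite mulr_ge0 ?sqr_ge0// invr_ge0 ltW.
have mk2 : measurable_fun B (fun x => (k x ^+ 2)%:E).
  by apply: measurable_funTS; apply/measurable_EFinP; exact: measurable_funX.
have mSB : measurable_fun B (fun x => ((u x - k x) ^+ 2)%:E).
  by apply: measurable_funTS; apply/measurable_EFinP.
have step : (m (malg_set a) <= (1 + dl)%:E * m B + C%:E * (sqdist mu u k)%:E)%E.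
  rewrite maE (mE _ mB) -k2 /density -Sfin.
  apply: (@le_trans _ _ ((1 + dl)%:E * \int[mu]_(x in B) (k x ^+ 2)%:E
     + C%:E * \int[mu]_(x in B) ((u x - k x) ^+ 2)%:E)%E); last first.
    rewrite leeD2l// lee_wpmul2l ?lee_fin ?(ltW C0)//.
    apply: ge0_subset_integral => //; first exact/measurable_EFinP.
    by move=> x _; rewrite lee_fin sqr_ge0.
  have sq0 x : B x -> (0 <= (k x ^+ 2)%:E)%E by rewrite lee_fin sqr_ge0.
  have sq1 x : B x -> (0 <= ((u x - k x) ^+ 2)%:E)%E by rewrite lee_fin sqr_ge0.
  have dl1 : 0 <= 1 + dl by rewrite addr_ge0// ltW.
  rewrite -(ge0_integralZl_EFin mu mB sq0 mk2 dl1).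
  rewrite -(ge0_integralZl_EFin mu mB sq1 mSB (ltW C0)).
  rewrite -ge0_integralD//; last 4 first.
  - by move=> x _; rewrite lee_fin mulr_ge0 ?sqr_ge0// addr_ge0// ltW.
  - exact: measurable_funeM.
  - by move=> x _; rewrite lee_fin mulr_ge0 ?sqr_ge0// ltW.
  - exact: measurable_funeM.
  apply: ge0_le_integral => //.
  - by move=> x _; rewrite lee_fin sqr_ge0.
  - by apply: measurable_funTS; apply/measurable_EFinP; exact: measurable_funX.
  - by apply: emeasurable_funD; exact: measurable_funeM.
  - by move=> x _; rewrite lee_fin.
have mBM : (m B <= M%:E)%E by rewrite -ME le_measure ?inE.
have mBfin : m B \is a fin_num by rewrite ge0_fin_numE// (le_lt_trans mBM) ?ltry.
apply: (le_trans step); move: mBM; rewrite -(fineK mBfin) -!EFinM -!EFinD !lee_fin => mBM.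
have h1 : C * sqdist mu u k <= e / 2 by rewrite mulrC -ler_pdivlMr// ltW.
have h2 : dl * fine (m B) <= e / 2 by apply: le_trans dlM; rewrite ler_wpM2l// ltW.
by move: h1 h2; move: (fine _) (C * _) => p q; lra.
Qed.

End ActionMeasureContinuity.

Lemma integral_le_lin d (T : measurableType d) (R : realType) (mu : {measure set T -> \bar R})
    (F F1 F2 : T -> R) (a b : R) :
  measurable_fun setT F -> measurable_fun setT F1 -> measurable_fun setT F2 ->
  (forall x, 0 <= F x) -> (forall x, 0 <= F1 x) -> (forall x, 0 <= F2 x) ->
  0 <= a -> 0 <= b -> (forall x, F x <= a * F1 x + b * F2 x) ->
  (\int[mu]_x (F x)%:E <= a%:E * \int[mu]_x (F1 x)%:E + b%:E * \int[mu]_x (F2 x)%:E)%E.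
Proof.
move=> mF mF1 mF2 F0 F10 F20 a0 b0 le.
have h1 x : setT x -> (0 <= (F1 x)%:E)%E by rewrite lee_fin.
have h2 x : setT x -> (0 <= (F2 x)%:E)%E by rewrite lee_fin.
have e1 : measurable_fun setT (fun x => (F1 x)%:E) by exact/measurable_EFinP.
have e2 : measurable_fun setT (fun x => (F2 x)%:E) by exact/measurable_EFinP.
rewrite -(ge0_integralZl_EFin mu measurableT h1 e1 a0).
rewrite -(ge0_integralZl_EFin mu measurableT h2 e2 b0).
rewrite -ge0_integralD//; last 4 first.
- by move=> x _; rewrite lee_fin mulr_ge0.
- exact: measurable_funeM.
- by move=> x _; rewrite lee_fin mulr_ge0.
- exact: measurable_funeM.
apply: ge0_le_integral => //.
- by move=> x _; rewrite lee_fin.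
- exact/measurable_EFinP.
- by apply: emeasurable_funD; exact: measurable_funeM.
- by move=> x _; rewrite -!EFinM -EFinD lee_fin.
Qed.

(** * From continuity on sets to the strong operator topology *)

Section PreservingContinuity.
Context (H : topologicalGroupType) d (X : measurableType d) (R : realType).
Context (nu : {measure set X -> \bar R}).
Variable psi : H -> Autstar nu.
Hypotheses (psiM : {morph psi : x y / (x * y)%g}).
Hypothesis psi_pres : forall h b, nu (malg_set (psi h b)) = nu (malg_set b).
Hypothesis sfnu : sigma_finite setT nu.
Hypothesis psi_small : forall b (e : R), (nu (malg_set b) < +oo)%E -> 0 < e ->
  nbhs (1%g : H) [set h | (nu (malg_set (b `&` ~` psi h b)%O) < e%:E)%E].
Implicit Types (h : H) (b : MALG nu) (f : X -> R).

Let dnu : nu `<< nu := @dominates_refl _ _ _ nu.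

(** Two sets of equal finite measure exceed each other by the same amount, so [psi_small] bounds
    both halves of the symmetric difference. *)
Let psi_diff b h0 (e : R) : (nu (malg_set b) < +oo)%E -> 0 < e ->
  nbhs h0 [set h | (nu (malg_set (psi h b `&` ~` psi h0 b)%O) +
    nu (malg_set (psi h0 b `&` ~` psi h b)%O) < e%:E)%E].
Proof.
move=> boo e0; have e20 : 0 < e / 2 by rewrite divr_gt0.
apply: filterS (nbhs_translate h0 (psi_small boo e20)) => h /=.
have -> : psi h b = psi h0 (psi (h0^-1 * h)%g b).
  by rewrite -{1}(mulVKg h0 h) psiM.
move: (psi _ b) (psi_pres (h0^-1 * h)%g b) => c nuc hc.
rewrite -!autstarC -!autstarI !psi_pres.
suff -> : nu (malg_set (c `&` ~` b)%O) = nu (malg_set (b `&` ~` c)%O).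
  by rewrite [e](splitr e) EFinD lteD.
have := malg_measureID dnu b c; have := malg_measureID dnu c b.
rewrite nuc meetC => ->.
have I_fin : nu (malg_set (b `&` c)%O) \is a fin_num.
  by rewrite ge0_fin_numE// (le_lt_trans _ boo)// malg_measure_le// leIl.
move=> /(congr1 (fun z => z - nu (malg_set (b `&` c)%O))%E).
by rewrite ![(nu (malg_set (b `&` c)%O) + _)%E]addeC !addeK.
Qed.

(** [f] is approximated through Borel functions [th] of [f]: left composition
    commutes with [transport], whose additivity is then not needed. *)
Let small f h0 (th : R -> R) := forall e : R, 0 < e ->
  nbhs h0 [set h | (\int[nu]_x ((th (transport (psi h) f x) -
    th (transport (psi h0) f x)) ^+ 2)%:E < e%:E)%E].

(** The squared difference of two indicators is the indicator of the symmetric difference. *)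
Let small_indic f h0 (B : set R) : measurable_fun setT f -> measurable B ->
  (nu (f @^-1` B) < +oo)%E -> small f h0 \1_B.
Proof.
move=> mf mB Boo e e0.
have mfB := measurable_preimage mf mB.
pose b := malg_class nu (f @^-1` B).
have boo : (nu (malg_set b) < +oo)%E.
  by rewrite (malg_set_ae_measure dnu mfB)//; exact: malg_classK.
apply: filterS (psi_diff h0 boo e0) => h /=.
have [mt hP] := transportP (psi h) mf; have [mt0 h0P] := transportP (psi h0) mf.
move: (transport (psi h) f) (transport (psi h0) f) mt hP mt0 h0P => u v mu hu mv hv.
have muB := measurable_preimage mu mB; have mvB := measurable_preimage mv mB.
rewrite -(hu _ mB) -(hv _ mB).
have D (P Q : set X) : measurable P -> measurable Q ->
    nu (malg_set (malg_class nu P `&` ~` malg_class nu Q)%O) = nu (P `\` Q).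
  move=> mP mQ; apply: (malg_set_ae_measure dnu); first exact: measurableD.
  apply: filterS2 (ae_and (malg_classK nu mP) (malg_classK nu mQ))
    (ae_and (malg_setI_ae (malg_class nu P) (~` malg_class nu Q)%O)
       (malg_setC_ae (malg_class nu Q))) => x.
  by rewrite /setD/=; tauto.
rewrite !D//; apply: le_lt_trans.
have mD1 : measurable (u @^-1` B `\` v @^-1` B) by exact: measurableD.
have mD2 : measurable (v @^-1` B `\` u @^-1` B) by exact: measurableD.
have I (P : set X) : measurable P -> (\int[nu]_x (\1_P x)%:E = nu P)%E.
  by move=> mP; rewrite integral_indic// setIT.
rewrite -(I _ mD1) -(I _ mD2) -[X in (_ <= X + _)%E]mul1e -[X in (_ <= _ + X)%E]mul1e.
apply: integral_le_lin => //.
- by apply: measurable_funX; apply: measurable_funB; exact: measurableT_comp.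
- by move=> x; exact: sqr_ge0.
- move=> x; rewrite !mul1r !indicE !in_setD.
  have pE (w : X -> R) : (x \in w @^-1` B) = (w x \in B).
    by apply/idP/idP => /set_mem wx; apply/mem_set.
  rewrite !pE; case: (u x \in B) (v x \in B) => -[]/=; rewrite ?subrr ?expr0n/= ?addr0//.
    by rewrite subr0 expr1n.
  by rewrite sub0r sqrrN expr1n add0r lexx.
Qed.

Let measurable_th_diff (th : R -> R) (u v : X -> R) : measurable_fun setT th ->
  measurable_fun setT u -> measurable_fun setT v ->
  measurable_fun setT (fun x => (th (u x) - th (v x)) ^+ 2).
Proof.
move=> mth mu mv; apply: measurable_funX; apply: measurable_funB.
  exact: (measurableT_comp mth).
exact: (measurableT_comp mth).
Qed.

Let measurable_tr f h : measurable_fun setT f -> measurable_fun setT (transport (psi h) f).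
Proof. by move=> mf; have [] := transportP (psi h) mf. Qed.

Let le_lty f (th th1 : R -> R) : measurable_fun setT f ->
  measurable_fun setT th -> measurable_fun setT th1 -> (forall t, 0 <= th1 t <= th t) ->
  (\int[nu]_x (th (f x) ^+ 2)%:E < +oo)%E -> (\int[nu]_x (th1 (f x) ^+ 2)%:E < +oo)%E.
Proof.
move=> mf mth mth1 le; apply: le_lt_trans; apply: ge0_le_integral => //.
- by move=> x _; rewrite lee_fin sqr_ge0.
- by apply/measurable_EFinP; apply: measurable_funX; exact: (measurableT_comp mth1).
- by apply/measurable_EFinP; apply: measurable_funX; exact: (measurableT_comp mth).
- move=> x _; rewrite lee_fin; have /andP[t0 tle] := le (f x).
  by rewrite ler_sqr ?nnegrE// (le_trans t0).
Qed.

Let small_lin f h0 (th th1 th2 : R -> R) (c1 c2 : R) : measurable_fun setT f ->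
  measurable_fun setT th -> measurable_fun setT th1 -> measurable_fun setT th2 ->
  0 <= c1 -> 0 <= c2 ->
  (forall s t, (th s - th t) ^+ 2 <= c1 * (th1 s - th1 t) ^+ 2 + c2 * (th2 s - th2 t) ^+ 2) ->
  small f h0 th1 -> small f h0 th2 -> small f h0 th.
Proof.
move=> mf mth mth1 mth2 c10 c20 le s1 s2 e e0.
pose c := 1 + c1 + c2; have c0 : 0 < c by rewrite /c -addrA ltr_pwDl// addr_ge0.
have ec0 : 0 < e / c by rewrite divr_gt0.
apply: filterS2 (s1 _ ec0) (s2 _ ec0) => h /=.
have mu := measurable_tr h mf; have mv := measurable_tr h0 mf.
move: (transport (psi h) f) (transport (psi h0) f) mu mv => u v mu mv.
move=> /= l1 l2.
have : (\int[nu]_x ((th (u x) - th (v x)) ^+ 2)%:E <=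
   c1%:E * \int[nu]_x ((th1 (u x) - th1 (v x)) ^+ 2)%:E
   + c2%:E * \int[nu]_x ((th2 (u x) - th2 (v x)) ^+ 2)%:E)%E.
  by apply: integral_le_lin => // [| | |x|x|x]; rewrite ?sqr_ge0//; exact: measurable_th_diff.
move=> le3; apply: (le_lt_trans le3).
apply: (@le_lt_trans _ _ (c1%:E * (e / c)%:E + c2%:E * (e / c)%:E)%E).
  by apply: leeD; rewrite lee_wpmul2l ?lee_fin// ltW.
rewrite -!EFinM -EFinD lte_fin -mulrDl mulrC -mulrA gtr_pMr// mulrC ltr_pdivrMr// mul1r.
by rewrite /c; lra.
Qed.

(** The induction runs on [Th], and [th] is its real-valued copy. Square integrability of [th] along
    [f] passes to summands and to terms of an increasing sequence, which lie below it. *)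
Let small_nonneg f h0 : measurable_fun setT f ->
  forall Th : R -> \bar R, measurable_fun setT Th -> (forall t, (0 <= Th t)%E) ->
  forall th : R -> R, measurable_fun setT th -> (forall t, Th t = (th t)%:E) ->
  (\int[nu]_x (th (f x) ^+ 2)%:E < +oo)%E -> small f h0 th.
Proof.
move=> mf; apply: (nonneg_measurable_ind (P := fun Th =>
  forall th : R -> R, measurable_fun setT th -> (forall t, Th t = (th t)%:E) ->
  (\int[nu]_x (th (f x) ^+ 2)%:E < +oo)%E -> small f h0 th)).
- move=> B mB th mth thE foo.
  have thE' : th = \1_B by apply/funext => t; apply/EFin_inj; rewrite -thE.
  rewrite thE'; apply: small_indic => //; apply: le_lt_trans foo.
  have mfB := measurable_preimage mf mB.
  rewrite -[X in (nu X <= _)%E]setIT -integral_indic//.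
  rewrite le_eqVlt; apply/orP; left; apply/eqP; apply: eq_integral => x _.
  rewrite thE' !indicE.
  have -> : (x \in f @^-1` B) = (f x \in B).
    by apply/idP/idP => /set_mem fx; apply/mem_set.
  by case: (_ \in _); rewrite ?expr1n ?expr0n.
- move=> c Th c0 mTh Th0 IH th mth thE foo.
  have [c_eq0|c_neq0] := eqVneq c 0.
    move=> e e0; apply: filterE => h /=.
    rewrite integral0_eq ?lte_fin// => x _.
    have th0 t : th t = 0 by apply/EFin_inj; rewrite -thE c_eq0 mul0e.
    by rewrite !th0 subrr expr0n.
  have mth1 : measurable_fun setT (fun t => c^-1 * th t) by exact: measurable_funM.
  have s1 : small f h0 (fun t => c^-1 * th t).
    apply: IH => // [t|].
      by rewrite EFinM -thE muleA -EFinM mulVf// mul1e.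
    apply: le_lt_trans (_ : (c^-1 ^+ 2)%:E * \int[nu]_x (th (f x) ^+ 2)%:E
       + 0%:E * \int[nu]_x (th (f x) ^+ 2)%:E < +oo)%E; last first.
      by rewrite mul0e adde0 lte_mul_pinfty// lee_fin sqr_ge0.
    apply: integral_le_lin => //.
    + by apply: measurable_funX; exact: (measurableT_comp mth1).
    + by apply: measurable_funX; exact: (measurableT_comp mth).
    + by apply: measurable_funX; exact: (measurableT_comp mth).
    + by move=> x; exact: sqr_ge0.
    + by move=> x; exact: sqr_ge0.
    + by move=> x; exact: sqr_ge0.
    + exact: sqr_ge0.
    + by move=> x; rewrite exprMn mul0r addr0.
  apply: (small_lin mf mth mth1 mth1 (sqr_ge0 c) (lexx 0) _ s1 s1) => s t.
  by rewrite mul0r addr0 -exprMn -mulrBr mulVKf.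
- move=> Th1 Th2 mTh1 Th10 mTh2 Th20 IH1 IH2 th mth thE foo.
  have fin1 t : Th1 t \is a fin_num.
    by rewrite ge0_fin_numE// (@le_lt_trans _ _ (th t)%:E) ?ltry// -thE leeDl.
  have fin2 t : Th2 t \is a fin_num.
    by rewrite ge0_fin_numE// (@le_lt_trans _ _ (th t)%:E) ?ltry// -thE leeDr.
  pose th1 t := fine (Th1 t); pose th2 t := fine (Th2 t).
  have th1E t : Th1 t = (th1 t)%:E by rewrite fineK.
  have th2E t : Th2 t = (th2 t)%:E by rewrite fineK.
  have thD t : th t = th1 t + th2 t by apply/EFin_inj; rewrite -thE EFinD -th1E -th2E.
  have mth1 : measurable_fun setT th1.
    by apply/measurable_EFinP; rewrite (_ : EFin \o th1 = Th1)//; exact/funext.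
  have mth2 : measurable_fun setT th2.
    by apply/measurable_EFinP; rewrite (_ : EFin \o th2 = Th2)//; exact/funext.
  have th10 t : 0 <= th1 t by exact: fine_ge0.
  have th20 t : 0 <= th2 t by exact: fine_ge0.
  apply: (small_lin mf mth mth1 mth2 (ler0n _ 2) (ler0n _ 2)).
  + move=> s t; rewrite !thD.
    have := sqr_ge0 ((th1 s - th1 t) - (th2 s - th2 t)); nra.
  + apply: IH1 => //; apply: (le_lty mf mth mth1 _ foo) => t.
    by rewrite th10 thD lerDl th20.
  + apply: IH2 => //; apply: (le_lty mf mth mth2 _ foo) => t.
    by rewrite th20 thD lerDr th10.
- move=> Th mTh Th0 ndTh IH th mth thE foo e e0.
  have hle n t : (Th n t <= (th t)%:E)%E.
    rewrite -thE; apply: lime_ge; first exact: ereal_nondecreasing_is_cvgn (ndTh t).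
    by exists n => // p /= np; exact: ndTh.
  have fin n t : Th n t \is a fin_num by rewrite ge0_fin_numE// (le_lt_trans (hle n t)) ?ltry.
  pose thn n t := fine (Th n t).
  have thnE n t : Th n t = (thn n t)%:E by rewrite fineK.
  have mthn n : measurable_fun setT (thn n).
    by apply/measurable_EFinP; rewrite (_ : EFin \o thn n = Th n)//; exact/funext.
  have thn0 n t : 0 <= thn n t by exact: fine_ge0.
  have thn_le n t : thn n t <= th t by rewrite -lee_fin -thnE.
  have mthf : measurable_fun setT (fun x => th (f x) ^+ 2).
    by apply: measurable_funX; exact: (measurableT_comp mth).
  have mthnf n : measurable_fun setT (fun x => thn n (f x) ^+ 2).
    by apply: measurable_funX; exact: (measurableT_comp (mthn n)).
  have nd x : nondecreasing_seq (fun n => (thn n (f x) ^+ 2)%:E).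
    move=> p q pq; rewrite lee_fin ler_sqr ?nnegrE// -lee_fin -!thnE; exact: ndTh.
  (* With [A] the squared truncation error and [J] the squared variation of [thn n], the final bound
     is [2 A + 2 (2 A + 2 J) = 6 A + 4 J]; hence [e / 12] here and [e / 8] for [J]. *)
  have e12 : 0 < e / 12 by rewrite divr_gt0.
  pose I := (\int[nu]_x (th (f x) ^+ 2)%:E)%E; rewrite -/I in foo.
  have I0 : (0 <= I)%E by apply: integral_ge0 => x _; rewrite lee_fin sqr_ge0.
  have Ifin : I \is a fin_num by rewrite ge0_fin_numE.
  have [n hn] : exists n, (I - (e / 12)%:E < \int[nu]_x (thn n (f x) ^+ 2)%:E)%E.
    apply: contrapT => /forallNP hn.
    have : (I <= I - (e / 12)%:E)%E.
      rewrite {1}/I (eq_integral (fun x => limn (fun n => (thn n (f x) ^+ 2)%:E))); last first.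
        move=> x _; apply/esym/cvg_lim => //.
        have h : (fun n => thn n (f x)) @ \oo --> th (f x).
          apply: fine_cvg; rewrite -thE; exact: ereal_nondecreasing_is_cvgn (ndTh (f x)).
        apply: cvg_EFin; first exact: nearW.
        under eq_fun do rewrite expr2.
        by rewrite expr2; apply: cvgM.
      rewrite monotone_convergence//.
      + apply: lime_le; last by apply: nearW => n; rewrite leNgt; apply/negP/hn.
        apply: ereal_nondecreasing_is_cvgn => p q pq; apply: ge0_le_integral => //.
        * by move=> x _; rewrite lee_fin sqr_ge0.
        * exact/measurable_EFinP.
        * exact/measurable_EFinP.
        * by move=> x _; exact: nd.
      + by move=> p; exact/measurable_EFinP.
      + by move=> p x _; rewrite lee_fin sqr_ge0.
    by rewrite -(fineK Ifin) -EFinB lee_fin; lra.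
  pose A := (\int[nu]_x ((th (f x) - thn n (f x)) ^+ 2)%:E)%E.
  have mdiff (w : X -> R) : measurable_fun setT w ->
      measurable_fun setT (fun x => (th (w x) - thn n (w x)) ^+ 2).
    move=> mw; apply: measurable_funX; apply: measurable_funB.
      exact: (measurableT_comp mth).
    exact: (measurableT_comp (mthn n)).
  (* From [0 <= thn n <= th] follows [(th - thn n) ^ 2 + thn n ^ 2 <= th ^ 2]. *)
  have AI : (A < (e / 12)%:E)%E.
    have : (A + \int[nu]_x (thn n (f x) ^+ 2)%:E <= I)%E.
      rewrite -ge0_integralD//; last 4 first.
      - by move=> x _; rewrite lee_fin sqr_ge0.
      - by apply/measurable_EFinP; exact: mdiff.
      - by move=> x _; rewrite lee_fin sqr_ge0.
      - exact/measurable_EFinP.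
      apply: ge0_le_integral => //.
      - by move=> x _; rewrite -EFinD lee_fin addr_ge0// sqr_ge0.
      - by apply: emeasurable_funD; apply/measurable_EFinP => //; exact: mdiff.
      - exact/measurable_EFinP.
      - move=> x _; rewrite -EFinD lee_fin.
        have := thn0 n (f x); have := thn_le n (f x); nra.
    have A0 : (0 <= A)%E by apply: integral_ge0 => x _; rewrite lee_fin sqr_ge0.
    move: hn; rewrite -(fineK Ifin).
    have : (0 <= \int[nu]_x (thn n (f x) ^+ 2)%:E)%E.
      by apply: integral_ge0 => x _; rewrite lee_fin sqr_ge0.
    case: (\int[nu]_x (thn n (f x) ^+ 2)%:E)%E => [j| |]//; case: A A0 => [q| |]//.
    by rewrite -EFinB -EFinD !lee_fin !lte_fin; lra.
  have s_n : small f h0 (thn n).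
    by apply: (IH n) => //; apply: (le_lty mf mth (mthn n) _ foo) => t; rewrite thn0 thn_le.
  have e8 : 0 < e / 8 by rewrite divr_gt0.
  apply: filterS (s_n _ e8) => h /= hS.
  (* As [psi h'] preserves [nu], the truncation error is the same for all [h']: the approximation is
     uniform along the orbit. *)
  have Ah h' : (\int[nu]_x ((th (transport (psi h') f x) -
      thn n (transport (psi h') f x)) ^+ 2)%:E = A)%E.
    apply: (integral_transportT (theta := fun t => ((th t - thn n t) ^+ 2)%:E) dnu dnu
      (psi_pres h') mf (transportP _ mf)).
      by apply/measurable_EFinP; apply: measurable_funX; exact: measurable_funB.
    by move=> t; rewrite lee_fin sqr_ge0.
  have := Ah h; have := Ah h0; move: hS.
  have mu := measurable_tr h mf; have mv := measurable_tr h0 mf.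
  move: (transport (psi h) f) (transport (psi h0) f) mu mv => u v mu mv hS Av Au.
  have muv : measurable_fun setT (fun x => (thn n (u x) - th (v x)) ^+ 2).
    apply: measurable_funX; apply: measurable_funB.
      exact: (measurableT_comp (mthn n)).
    exact: (measurableT_comp mth).
  have le1 : (\int[nu]_x ((th (u x) - th (v x)) ^+ 2)%:E <= 2%:E * A +
      2%:E * \int[nu]_x ((thn n (u x) - th (v x)) ^+ 2)%:E)%E.
    rewrite -Au; apply: integral_le_lin => //; try (by move=> x; exact: sqr_ge0).
    - exact: measurable_th_diff.
    - exact: mdiff.
    - move=> x; have := sqr_ge0 ((th (u x) - thn n (u x)) - (thn n (u x) - th (v x))); nra.
  have le2 : (\int[nu]_x ((thn n (u x) - th (v x)) ^+ 2)%:E <= 2%:E * A +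
      2%:E * \int[nu]_x ((thn n (u x) - thn n (v x)) ^+ 2)%:E)%E.
    rewrite -Av; apply: integral_le_lin => //; try (by move=> x; exact: sqr_ge0).
    - exact: mdiff.
    - exact: measurable_th_diff.
    - move=> x; have := sqr_ge0 ((th (v x) - thn n (v x)) + (thn n (u x) - thn n (v x))); nra.
  have le3 : (2%:E * A + 2%:E * \int[nu]_x ((thn n (u x) - th (v x)) ^+ 2)%:E <=
      2%:E * A + 2%:E * (2%:E * A + 2%:E * \int[nu]_x ((thn n (u x) - thn n (v x)) ^+ 2)%:E))%E.
    by rewrite leeD2l// lee_wpmul2l// lee_fin.
  apply: (le_lt_trans le1); apply: (le_lt_trans le3); clear Au Av Ah le1 le2 le3.
  have A0 : (0 <= A)%E by apply: integral_ge0 => x _; rewrite lee_fin sqr_ge0.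
  have J0 : (0 <= \int[nu]_x ((thn n (u x) - thn n (v x)) ^+ 2)%:E)%E.
    by apply: integral_ge0 => x _; rewrite lee_fin sqr_ge0.
  move: A0 J0 hS AI.
  move: A (\int[nu]_x ((thn n (u x) - thn n (v x)) ^+ 2)%:E)%E => [a| |]// [j| |]//.
  by rewrite -!EFinM -!EFinD !lee_fin !lte_fin; lra.
Qed.

(** The positive and negative parts are nonnegative Borel functions of [f], dominated by its
    absolute value. *)
Let small_id f h0 : measurable_fun setT f ->
  (\int[nu]_x (f x ^+ 2)%:E < +oo)%E -> small f h0 id.
Proof.
move=> mf foo.
have mid : measurable_fun setT (@id R) by [].
pose th1 (t : R) := Num.max t 0; pose th2 (t : R) := Num.max (- t) 0.
have mth1 : measurable_fun setT th1 by exact: measurable_funrpos.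
have mth2 : measurable_fun setT th2.
  exact: measurable_funrneg.
have th10 t : 0 <= th1 t by rewrite le_max lexx orbT.
have th20 t : 0 <= th2 t by rewrite le_max lexx orbT.
have norm_lty (th : R -> R) : measurable_fun setT th -> (forall t, 0 <= th t <= `|t|) ->
    (\int[nu]_x (th (f x) ^+ 2)%:E < +oo)%E.
  move=> mth le; have mn : measurable_fun setT (@Num.Def.normr _ R) by exact: normr_measurable.
  apply: (le_lty mf mn mth le).
  by under eq_integral do rewrite real_normK ?num_real//.
have s_nonneg (th : R -> R) : measurable_fun setT th -> (forall t, 0 <= th t <= `|t|) ->
    small f h0 th.
  move=> mth le; apply: (small_nonneg h0 mf (Th := EFin \o th)) => //.
  - exact/measurable_EFinP.
  - by move=> t; rewrite lee_fin; case/andP: (le t).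
  - exact: norm_lty.
apply: (small_lin mf mid mth1 mth2 (ler0n _ 2) (ler0n _ 2)).
- move=> s t.
  have E r : r = th1 r - th2 r by rewrite /th1 /th2; case: (lerP r 0); case: (lerP (- r) 0); lra.
  rewrite {1}(E s) {1}(E t).
  have := sqr_ge0 ((th1 s - th1 t) + (th2 s - th2 t)); nra.
- by apply: s_nonneg => // t; rewrite th10/= /th1 ge_max ler_norm normr_ge0.
- by apply: s_nonneg => // t; rewrite th20/= /th2 ge_max -normrN ler_norm normr_ge0.
Qed.

Let RN_psi h : is_RN_derivative (psi h) (RN_derivative (psi h)) /\
  \forall x \ae nu, RN_derivative (psi h) x = 1.
Proof.
have h1 : is_RN_derivative (psi h) (cst 1).
  split => // A mA.
  rewrite -[LHS]/(\int[nu]_(x in A) cst 1%:E x)%E integral_cst// mul1e.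
  rewrite -(psi_pres h) autstarKV; apply: ae_measure_eq => //; first exact: measurable_malg_set.
  by apply: filterS (malg_classK nu mA) => x; tauto.
have hr : is_RN_derivative (psi h) (RN_derivative (psi h)).
  by rewrite /RN_derivative; case: xgetP => [r -> //|/(_ (cst 1))]; case.
by split => //; exact: is_RN_derivative_uniq hr h1.
Qed.

Let int_koopman h (f k : X -> R[i]) :
  measurable_fun setT (fun x => complex.Re (f x)) ->
  measurable_fun setT (fun x => complex.Im (f x)) ->
  measurable_fun setT (fun x => complex.Re (k x)) ->
  measurable_fun setT (fun x => complex.Im (k x)) ->
  (\int[nu]_x (Normc.normc (koopman (psi h) f x - k x) ^+ 2)%:E =
   \int[nu]_x ((transport (psi h) (fun y => complex.Re (f y)) x - complex.Re (k x)) ^+ 2 +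
     (transport (psi h) (fun y => complex.Im (f y)) x - complex.Im (k x)) ^+ 2)%:E)%E.
Proof.
move=> mfr mfi mkr mki; have [[mr _ _] r1] := RN_psi h.
apply: ge0_ae_eq_integral => //.
- by apply/measurable_EFinP; exact: measurable_koopman_sub.
- apply/measurable_EFinP; apply: measurable_funD; apply: measurable_funX;
    apply: measurable_funB => //; exact: measurable_tr.
- by move=> x _; rewrite lee_fin sqr_ge0.
- by move=> x _; rewrite lee_fin addr_ge0// sqr_ge0.
- apply: filterS r1 => x rx _; rewrite normc_sqr; congr EFin.
  have := koopman_Re (psi h) f x; have := koopman_Im (psi h) f x.
  rewrite rx sqrtr1 !mul1r => <- <-.
  by case: (koopman _ f x) (k x) => a b [c e].
Qed.

(** The Radon-Nikodym derivatives are 1 almost everywhere, so the Koopman operators act by transport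
    of real and imaginary parts, and [small_id] applies to each. *)
Lemma preserving_continuous : continuous (psi : H -> Autstar nu).
Proof.
move=> h0; apply: sot_cvg => S [f [k [e [[mfr mfi foo] [mkr mki _] e0 ->]]]].
rewrite /= L2norm_lt// int_koopman// => hI.
have {}foo : (\int[nu]_x (Normc.normc (f x) ^+ 2)%:E < +oo)%E.
  have L0 : (0 <= L2norm nu f)%E by exact: Lnorm_ge0.
  have Lfin : L2norm nu f \is a fin_num by rewrite ge0_fin_numE.
  have l1 : 0 < fine (L2norm nu f) + 1 by rewrite ltr_wpDl// fine_ge0.
  have : (L2norm nu f < (fine (L2norm nu f) + 1)%:E)%E.
    by rewrite -{1}(fineK Lfin) lte_fin ltrDl.
  by rewrite L2norm_lt// => /lt_trans; apply; rewrite ltry.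
have mnf : measurable_fun setT (fun x => Normc.normc (f x) ^+ 2).
  rewrite (_ : (fun x => _) = fun x => complex.Re (f x) ^+ 2 + complex.Im (f x) ^+ 2).
    by apply: measurable_funD; exact: measurable_funX.
  by apply/funext => x; rewrite normc_sqr.
have rlty : (\int[nu]_x (complex.Re (f x) ^+ 2)%:E < +oo)%E.
  apply: le_lt_trans foo; apply: ge0_le_integral => //.
  - by move=> x _; rewrite lee_fin sqr_ge0.
  - by apply/measurable_EFinP; exact: measurable_funX.
  - exact/measurable_EFinP.
  - by move=> x _; rewrite lee_fin normc_sqr lerDl sqr_ge0.
have ilty : (\int[nu]_x (complex.Im (f x) ^+ 2)%:E < +oo)%E.
  apply: le_lt_trans foo; apply: ge0_le_integral => //.
  - by move=> x _; rewrite lee_fin sqr_ge0.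
  - by apply/measurable_EFinP; exact: measurable_funX.
  - exact/measurable_EFinP.
  - by move=> x _; rewrite lee_fin normc_sqr lerDr sqr_ge0.
move: hI; set I := (\int[nu]_x _)%E => hI.
have I0 : (0 <= I)%E by apply: integral_ge0 => x _; rewrite lee_fin addr_ge0// sqr_ge0.
have Ifin : I \is a fin_num by rewrite ge0_fin_numE// (lt_trans hI) ?ltry.
pose J := fine I; have J0 : 0 <= J by exact: fine_ge0.
have IJ : I = J%:E by rewrite fineK.
have Je : 0 < e ^+ 2 - J by rewrite subr_gt0 -lte_fin -IJ.
(* [J < e ^ 2] is the squared distance at [h0]. Near [h0] it is at most [(1 + dl) J + 2 C eta],
   where [dl J] is at most half and [2 C eta] is a quarter of [e ^ 2 - J]. *)
pose dl := (e ^+ 2 - J) / (2 * (J + 1)).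
have J1 : 0 < J + 1 by rewrite ltr_wpDl.
have dl0 : 0 < dl by rewrite divr_gt0// mulr_gt0.
have dlJ : dl * J <= (e ^+ 2 - J) / 2.
  rewrite /dl invfM mulrA -mulrA ler_piMr ?divr_ge0 ?(ltW Je)//.
  by rewrite mulrC ler_pdivrMr ?mul1r; lra.
pose C := 1 + dl^-1.
have C0 : 0 < C by rewrite addr_gt0// invr_gt0.
pose eta := (e ^+ 2 - J) / 8 / C.
have eta0 : 0 < eta by rewrite !divr_gt0.
apply: filterS2 (small_id h0 mfr rlty eta0) (small_id h0 mfi ilty eta0) => h /=.
rewrite L2norm_lt// int_koopman//.
have mr := measurable_tr h mfr; have mi := measurable_tr h mfi.
have mr0 := measurable_tr h0 mfr; have mi0 := measurable_tr h0 mfi.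
rewrite /I in IJ.
move: (transport (psi h) (fun y => complex.Re (f y))) (transport (psi h) (fun y => complex.Im (f y)))
  (transport (psi h0) (fun y => complex.Re (f y))) (transport (psi h0) (fun y => complex.Im (f y)))
  mr mi mr0 mi0 IJ => ur ui vr vi mur mui mvr mvi IJ hr hi.
have m2 (u v : X -> R) : measurable_fun setT u -> measurable_fun setT v ->
    measurable_fun setT (fun x => (u x - v x) ^+ 2).
  by move=> mu mv; apply: measurable_funX; exact: measurable_funB.
have hs : (\int[nu]_x ((ur x - vr x) ^+ 2 + (ui x - vi x) ^+ 2)%:E <= (2 * eta)%:E)%E.
  rewrite -[2]/(1 + 1) mulrDl mul1r EFinD.
  apply: le_trans (leeD (ltW hr) (ltW hi)).
  rewrite -[X in (_ <= X + _)%E]mul1e -[X in (_ <= _ + X)%E]mul1e.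
  apply: integral_le_lin => //; try (by move=> x; exact: sqr_ge0); try exact: m2.
  - by apply: measurable_funD; exact: m2.
  - by move=> x; rewrite addr_ge0// sqr_ge0.
  - by move=> x; rewrite !mul1r lexx.
apply: (@le_lt_trans _ _ ((1 + dl)%:E * J%:E + C%:E * (2 * eta)%:E)%E); last first.
  rewrite -!EFinM -EFinD lte_fin.
  have -> : C * (2 * eta) = (e ^+ 2 - J) / 4 by rewrite /eta; field; exact: lt0r_neq0.
  by rewrite mulrDl mul1r; move: dlJ Je; move: (e ^+ 2) (dl * J) => p q; lra.
apply: (@le_trans _ _ ((1 + dl)%:E * J%:E + C%:E *
   \int[nu]_x ((ur x - vr x) ^+ 2 + (ui x - vi x) ^+ 2)%:E)%E); last first.
  by rewrite leeD2l// lee_wpmul2l// lee_fin ltW.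
rewrite -IJ; apply: integral_le_lin => //.
- by apply: measurable_funD; exact: m2.
- by apply: measurable_funD; exact: m2.
- by apply: measurable_funD; exact: m2.
- by move=> x; rewrite addr_ge0// sqr_ge0.
- by move=> x; rewrite addr_ge0// sqr_ge0.
- by move=> x; rewrite addr_ge0// sqr_ge0.
- by rewrite addr_ge0// ltW.
- exact: ltW.
have pp (a b c : R) : (a - c) ^+ 2 <= (1 + dl) * (b - c) ^+ 2 + C * (a - b) ^+ 2.
  rewrite -subr_ge0; have -> : (1 + dl) * (b - c) ^+ 2 + C * (a - b) ^+ 2 - (a - c) ^+ 2 =
      dl^-1 * (dl * (b - c) - (a - b)) ^+ 2 by rewrite /C; field; exact: lt0r_neq0.
  by rewrite mulr_ge0 ?sqr_ge0// invr_ge0 ltW.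
move=> x; have := pp (ur x) (vr x) (complex.Re (k x)).
have := pp (ui x) (vi x) (complex.Im (k x)).
by rewrite !mulrDr; move: (_ * _) (_ * _) (_ * _) (_ * _) => *; lra.
Qed.

End PreservingContinuity.

Section TransferredAction.
Context (G : topologicalGroupType) d (T : measurableType d) (R : realType).
Context (mu : {sigma_finite_measure set T -> \bar R}).
Variable phi : nonsingular_action G mu.
Context (H : topologicalGroupType) (iota : H -> G).
Hypotheses (iota1 : iota 1%g = 1%g) (iota_cont : continuous iota).
Context d' (X : measurableType d') (nu : {measure set X -> \bar R}).
Variables (psi : H -> Autstar nu) (J : MALG nu -> MALG mu).
Variable N : {measure set T -> \bar R}.
Hypotheses (psiM : {morph psi : x y / (x * y)%g}).
Hypothesis psi_pres : forall h b, nu (malg_set (psi h b)) = nu (malg_set b).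
Hypothesis sfnu : sigma_finite setT nu.
Hypothesis JI : {morph J : a b / (a `&` b)%O}.
Hypothesis Jpsi : forall h b, J (psi h b) = phi (iota h) (J b).
Hypothesis dN : N `<< mu.
Hypothesis NJ : forall b, nu (malg_set b) = N (malg_set (J b)).

(** For [nu b] finite, [a |-> N (a `&` J b)] is a finite measure dominated by
    [mu], so [nu (psi h b `&` b)] tends to [nu b] as [h] tends to the identity. *)
Lemma transferred_action : exists alpha : nonsingular_action H nu, alpha =1 psi.
Proof.
suff c : continuous (psi : H -> Autstar nu) by exists (NonsingularAction psiM c).
apply: preserving_continuous => // b e boo e0.
have mJb := measurable_malg_set (J b).
pose m := mrestr N mJb.
have mE c : m (malg_set c) = N (malg_set (c `&` J b)%O).
  rewrite [LHS]/(N _); apply/esym/(malg_set_ae_measure dN).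
    by apply: measurableI => //; exact: measurable_malg_set.
  exact: malg_setI_ae.
have dm : m `<< mu.
  apply/null_content_dominatesP => A mA A0; rewrite [LHS]/(N _).
  apply: (subset_measure0 (mu := N) _ mA (@subIsetl _ _ _)); first exact: measurableI.
  exact: dominates0 dN mA A0.
have moo : (m setT < +oo)%E by rewrite /m /mrestr/= setTI -NJ.
have e2 : 0 < e / 2 by rewrite divr_gt0.
have := action_measure_continuous phi (J b) dm moo e2.
rewrite -iota1 => /iota_cont; apply: (@filterS _ (nbhs (1%g : H))) => h hm.
have {hm} : (m (malg_set (J b)) <= m (malg_set (phi (iota h) (J b))) + (e / 2)%:E)%E by [].
rewrite -Jpsi !mE meetxx -JI -!NJ (malg_measureID (@dominates_refl _ _ _ nu) b (psi h b)).
rewrite [(psi h b `&` b)%O]meetC.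
have Ifin : nu (malg_set (b `&` psi h b)%O) \is a fin_num.
  rewrite ge0_fin_numE// (le_lt_trans _ boo)//.
  by rewrite (malg_measure_le (@dominates_refl _ _ _ nu))// leIl.
rewrite leeD2lE// => /le_lt_trans; apply.
by rewrite lte_fin gtr_pMr// invf_lt1// ltr1n.
Qed.

End TransferredAction.

Lemma normalize_measure d (T : measurableType d) (R : realType)
    (m : {measure set T -> \bar R}) : (m setT < +oo)%E -> m setT <> 0%E ->
  exists P : probability T R, exists2 c : R, 0 < c & forall A, P A = (c%:E * m A)%E.
Proof.
move=> moo m0.
have mfin : m setT \is a fin_num by rewrite ge0_fin_numE.
have r0 : 0 < fine (m setT).
  by rewrite lt0r fine_ge0// andbT; apply/eqP => f0; apply: m0; rewrite -(fineK mfin) f0.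
have c0 : 0 < (fine (m setT))^-1 by rewrite invr_gt0.
pose p := mscale (NngNum (ltW c0)) m.
have p1 : p setT = 1%E.
  by rewrite /p /mscale/= -{2}(fineK mfin) -EFinM mulVf// gt_eqF.
pose P : probability T R := HB.pack (mscale (NngNum (ltW c0)) m)
  (Measure_isProbability.Build _ _ _ (mscale (NngNum (ltW c0)) m) p1).
by exists P, (fine (m setT))^-1.
Qed.

Section CosetEnumeration.
Context (G : topologicalGroupType) (V : openSubgroup G).

(** Cosets of [V] are open, so a countable dense set meets each of them. *)
Lemma countable_lcosets : separable_space G -> countable [set: lcosets V].
Proof.
move=> [D cD dD].
have : (fun g => \pi_(lcosets V)%qT g) @` D = setT.
  apply/seteqP; split => // c _.
  have nV : nbhs (1%g : G) (osg_set V).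
    by apply: open_nbhs_nbhs; split; [exact: osg_open|exact: osg1].
  have := nbhs_translate (repr c) nV; rewrite nbhsE => -[U [oU Uc] UV].
  have [|x [Ux Dx]] := dD U _ oU; first by exists (repr c).
  exists x => //; rewrite -[c]reprK; apply/esym/lcoset_eqP; exact: UV.
by move=> <-; exact: (card_le_trans (card_image_le _ _) cD).
Qed.

Lemma lcosets_enum : countable [set: lcosets V] ->
  exists e : nat -> lcosets V, forall c, exists n, e n = c.
Proof.
move=> /countable_injP[f fI].
exists (fun n => xget point [set c | f c = n]) => c; exists (f c).
by case: xgetP => [c' -> /fI|/(_ c)/(_ erefl)//]; apply; rewrite inE.
Qed.

Lemma section_exists : exists s : coset_section V, forall c, s c = repr c.
Proof. by exists (CosetSection (@reprK _ _)). Qed.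

End CosetEnumeration.

(** * Induced actions *)

Section InducedMeasure.
Context (G : topologicalGroupType) (V : openSubgroup G).
Hypothesis cV : countable [set: lcosets V].
Context d (X : measurableType d) (R : realType).
Variable nu : {sigma_finite_measure set X -> \bar R}.

Local Notation IM := (ind_measure V nu).

Lemma ind_measure_slice (c : lcosets V) (B : set X) : measurable B ->
  IM ([set c] `*` B) = nu B.
Proof.
move=> mB; rewrite /ind_measure [LHS]product_measure1E//.
rewrite [X in (X * _)%E](_ : _ = 1%E) ?mul1e//.
rewrite /coset_counting /= /counting asboolT; last exact: finite_set1.
by rewrite fset_set1 finmap.cardfs1.
Qed.

(** Each slice carries a copy of [nu], and there are countably many slices. *)
Lemma ind_measure_aeP (Q : lcosets V * X -> Prop) :
  (\forall y \ae IM, Q y) <-> (forall c, \forall x \ae nu, Q (c, x)).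
Proof.
split=> [[N [mN N0 QN]] c|h].
  have mNc : measurable (xsection N c) by exact: measurable_xsection.
  exists (xsection N c); split => //.
    rewrite -(ind_measure_slice c mNc).
    apply: (subset_measure0 _ mN _ N0); first exact: measurableX.
    by move=> -[c' x] /= [-> /xsectionP].
  by move=> x /= nQ; apply/xsectionP; exact: QN.
have [e eP] := lcosets_enum cV.
have /choice[N /all_and3[mN N0 QN]] : forall n, exists N, [/\ measurable N, nu N = 0%E &
    ~` [set x | Q (e n, x)] `<=` N].
  by move=> n; have [N [mN N0 QN]] := h (e n); exists N.
have mS n : measurable ([set e n] `*` N n) by exact: measurableX.
have [M [mM M0 sM]] : IM.-negligible (\bigcup_n ([set e n] `*` N n)).
  by apply: negligible_bigcup => n; apply/negligibleP => //; apply: etrans (N0 n); exact: ind_measure_slice.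
exists M; split => // -[c x] nQ; apply: sM; have [n en] := eP c.
by exists n => //; split => //; apply: QN; rewrite /= en.
Qed.

Lemma measurable_coset_family (S : lcosets V -> set X) : (forall c, measurable (S c)) ->
  measurable [set y : lcosets V * X | S y.1 y.2].
Proof.
move=> mS; have [e eP] := lcosets_enum cV.
rewrite (_ : [set y | _] = \bigcup_n ([set e n] `*` S (e n))).
  by apply: bigcup_measurable => n _; exact: measurableX.
apply/seteqP; split => [[c x]/= Scx|[c x]/= [n _ [/= -> //]]].
by have [n en] := eP c; exists n => //; split => /=; rewrite en.
Qed.

Lemma ind_measure_sigma_finite : (nu setT < +oo)%E -> sigma_finite setT IM.
Proof.
move=> nuoo; have [e eP] := lcosets_enum cV.
exists (fun n => [set e n] `*` setT) => [|n].
  apply/seteqP; split => // -[c x] _; have [n <-] := eP c.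
  by exists n.
by split; [exact: measurableX|rewrite ind_measure_slice].
Qed.

End InducedMeasure.

Import Order.CTheory.

Lemma boolean_isomorphism_meet_compl d1 d2 (A : ctbDistrLatticeType d1)
    (B : ctbDistrLatticeType d2) (F : A -> B) : bijective F ->
  {morph F : x y / (x `&` y)%O} -> {morph F : x / (~` x)%O} -> boolean_isomorphism F.
Proof.
move=> bF FI FC; split => // x y.
by rewrite -[(x `|` y)%O]complK complU FC FI !FC
  complI !complK.
Qed.

(** * The measure algebra of a cell *)

Section CellAlgebra.
Context (G : topologicalGroupType) d (T : measurableType d) (R : realType).
Context (mu : {sigma_finite_measure set T -> \bar R}).
Variables (phi : nonsingular_action G mu) (A : MALG mu) (V : openSubgroup G).
Variable nu : probability T R.
Hypothesis cell : is_cell phi A V nu.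
Implicit Types (a : MALG mu) (b : MALG nu) (g : G).

Let VE g : osg_set V g <-> phi g A = A.
Proof. by have [[_ + _] _] := cell; exact. Qed.

Let cell_disj g : (phi g A `&` A)%O <> \bot%O -> phi g A = A.
Proof. by have [[_ _ +] _] := cell; exact. Qed.

Let dnu : nu `<< mu.
Proof. by have [_ []] := cell. Qed.

Let nuA : \forall x \ae nu, malg_set A x.
Proof.
have [_ [_ _ nA _ _]] := cell.
exists (~` malg_set A); split => //; apply: measurableC; exact: measurable_malg_set.
Qed.

Let nu0 a : nu (malg_set a) = 0%E -> (a `&` A)%O = \bot%O.
Proof. by have [_ [_ _ _ + _]] := cell; exact. Qed.

Let nuV g a : osg_set V g -> nu (malg_set (phi g a)) = nu (malg_set a).
Proof. by have [_ [_ _ _ _ +]] := cell; exact. Qed.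

(** [nu] vanishes off [A], and on [A] it has the same null sets as [mu]. *)
Lemma cell_aeP (P : T -> Prop) :
  (\forall x \ae nu, P x) <-> \forall x \ae mu, malg_set A x -> P x.
Proof.
split=> [[N [mN N0 PN]]|h]; last first.
  by apply: filterS2 nuA (dominates_ae dnu h) => x Ax; exact.
have eN : nu (malg_set (malg_class mu N)) = 0%E.
  by rewrite (malg_set_ae_measure dnu mN)//; exact: malg_classK.
have /malg_bot_aeP := nu0 eN.
apply: filterS3 (malg_classK mu mN) (malg_setI_ae (malg_class mu N) A) => x h1 h2 h3 Ax.
apply: contrapT => nP; apply: h3; apply/h2; split => //; apply/h1; exact: PN.
Qed.

(** Together with [cell_lift], this identifies the measure algebra of [nu] with the elements of
    [MALG mu] below [A]. *)
Definition cell_proj (a : MALG mu) : MALG nu := malg_class nu (malg_set a).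
Definition cell_lift (b : MALG nu) : MALG mu :=
  malg_class mu (malg_set b `&` malg_set A).

Local Notation q := cell_proj.
Local Notation j := cell_lift.

Lemma cell_projE a : \forall x \ae mu, malg_set A x -> (malg_set (q a) x <-> malg_set a x).
Proof. by apply/cell_aeP; apply: malg_classK; exact: measurable_malg_set. Qed.

Lemma cell_liftE (b : MALG nu) :
  \forall x \ae mu, malg_set (j b) x <-> malg_set b x /\ malg_set A x.
Proof.
have mI : measurable (malg_set b `&` malg_set A).
  by apply: measurableI; exact: measurable_malg_set.
exact: (malg_classK mu mI).
Qed.

Lemma cell_nu_eqP (b c : MALG nu) :
  b = c <-> \forall x \ae mu, malg_set A x -> (malg_set b x <-> malg_set c x).
Proof. by rewrite malg_eqP; exact: cell_aeP. Qed.

Lemma cell_liftK : cancel cell_lift cell_proj.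
Proof.
move=> b; apply/cell_nu_eqP.
by apply: filterS2 (cell_projE (j b)) (cell_liftE b) => x; tauto.
Qed.

Lemma cell_projK a : j (q a) = (a `&` A)%O.
Proof.
apply/malg_eqP.
by apply: filterS3 (cell_projE a) (cell_liftE (q a)) (malg_setI_ae a A) => x; tauto.
Qed.

Lemma cell_lift_le b : (j b <= A)%O.
Proof. by apply/malg_leP; apply: filterS (cell_liftE b) => x; tauto. Qed.

Lemma cell_liftKI a : (a <= A)%O -> j (q a) = a.
Proof. by rewrite cell_projK => /meet_idPl. Qed.

Lemma cell_liftI : {morph cell_lift : b c / (b `&` c)%O}.
Proof.
move=> b c; apply/malg_eqP.
have h : \forall x \ae mu, malg_set A x ->
    (malg_set (b `&` c)%O x <-> malg_set b x /\ malg_set c x).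
  by apply/cell_aeP; exact: malg_setI_ae.
by apply: filterS3 (ae_and (cell_liftE b) (cell_liftE c)) (ae_and h (cell_liftE (b `&` c)%O))
  (malg_setI_ae (j b) (j c)) => x; tauto.
Qed.

Lemma cell_liftC b : j (~` b)%O = (A `&` ~` j b)%O.
Proof.
apply/malg_eqP.
have h : \forall x \ae mu, malg_set A x -> (malg_set (~` b)%O x <-> ~ malg_set b x).
  by apply/cell_aeP; exact: malg_setC_ae.
by apply: filterS3 (ae_and h (cell_liftE b)) (ae_and (cell_liftE (~` b)%O) (malg_setC_ae (j b)))
  (malg_setI_ae A (~` j b)%O) => x; tauto.
Qed.

Lemma cell_projI : {morph cell_proj : a b / (a `&` b)%O}.
Proof.
move=> a b; apply/malg_eqP.
have h : \forall x \ae nu, malg_set (a `&` b)%O x <-> malg_set a x /\ malg_set b x.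
  by apply: (dominates_ae dnu); exact: malg_setI_ae.
have K c : \forall x \ae nu, malg_set (q c) x <-> malg_set c x.
  by apply: malg_classK; exact: measurable_malg_set.
by apply: filterS3 (ae_and (K a) (K b)) (ae_and h (K (a `&` b)%O))
  (malg_setI_ae (q a) (q b)) => x; tauto.
Qed.

Lemma nu_cell_lift (b : MALG nu) : nu (malg_set (j b)) = nu (malg_set b).
Proof.
apply: ae_measure_eq; [exact: measurable_malg_set|exact: measurable_malg_set|].
by apply: filterS2 nuA (dominates_ae dnu (cell_liftE b)) => x; tauto.
Qed.

(** The restriction of [g] to [A]; it is an automorphism when [g] lies in [V], the stabilizer of
    [A]. *)
Let alpha_fun g (b : MALG nu) : MALG nu := q (phi g (j b)).

Let alpha_lift g b : osg_set V g -> j (alpha_fun g b) = phi g (j b).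
Proof.
move=> Vg; rewrite cell_liftKI//; have /VE gA := Vg.
by rewrite -[X in (_ <= X)%O]gA nsa_le cell_lift_le.
Qed.

Let alphaK g : osg_set V g -> cancel (alpha_fun g) (alpha_fun (g^-1)%g).
Proof. by move=> Vg b; rewrite {1}/alpha_fun alpha_lift// nsaK cell_liftK. Qed.

Let alpha_iso g : osg_set V g -> boolean_isomorphism (alpha_fun g).
Proof.
move=> Vg; have gA : phi g A = A by apply/VE.
apply: boolean_isomorphism_meet_compl.
- exists (alpha_fun (g^-1)%g); first exact: alphaK.
  by move=> b; have := alphaK (osgV Vg) b; rewrite invgK.
- by move=> b c; rewrite /alpha_fun cell_liftI nsaI cell_projI.
- move=> b; apply: (can_inj cell_liftK).
  by rewrite cell_liftC !alpha_lift// cell_liftC nsaI gA autstarC.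
Qed.

Lemma cell_action : exists alpha : nonsingular_action (subgroup_type V) nu,
  preserves_measure alpha nu /\
  forall (v : subgroup_type V) b, j (alpha v b) = phi (val v) (j b).
Proof.
pose psi (v : subgroup_type V) : Autstar nu := mk_autstar (alpha_iso (set_mem (valP v))).
have psi_lift v b : j (psi v b) = phi (val v) (j b).
  by apply: alpha_lift; exact: set_mem (valP v).
have psi_pres v b : nu (malg_set (psi v b)) = nu (malg_set b).
  rewrite -nu_cell_lift psi_lift -[RHS]nu_cell_lift nuV//; exact: set_mem (valP v).
have psiM : {morph psi : x y / (x * y)%g}.
  move=> x y; apply: autstarP => b; apply: (can_inj cell_liftK).
  by rewrite psi_lift [RHS]psi_lift psi_lift -nsaM.
have val_cont : continuous (val : subgroup_type V -> G).
  exact: (@initial_continuous (set_type (osg_set V)) G set_val).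
have [alpha aE] := transferred_action (H := subgroup_type V)
  (iota := (fun v : subgroup_type V => val v : G)) (J := j) erefl val_cont psiM psi_pres
  (sigma_finiteT nu) cell_liftI psi_lift dnu (fun b => esym (nu_cell_lift b)).
exists alpha; split => [v b|v b]; by rewrite aE.
Qed.

Lemma cell_disjoint g h : ~ osg_set V (g^-1 * h)%g -> (phi g A `&` phi h A)%O = \bot%O.
Proof.
move=> nV; rewrite -[LHS](nsaKV phi g) nsaI nsaK -nsaM.
rewrite (_ : (A `&` _)%O = \bot%O) ?nsa0//; apply: contrapT; rewrite meetC => /cell_disj.
by move/VE.
Qed.

Lemma cell_coset g h : osg_set V (g^-1 * h)%g -> phi g A = phi h A.
Proof. by move/VE => gh; rewrite -{1}gh -nsaM mulVKg. Qed.

End CellAlgebra.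

(** [B] is cut along the cover made disjoint. *)
Lemma measure_eq_on_cover d (T : measurableType d) (R : realType)
    (m1 m2 : {measure set T -> \bar R}) (C : nat -> set T) :
  (forall n, measurable (C n)) ->
  (forall n B, measurable B -> B `<=` C n -> m1 B = m2 B) ->
  m1 (~` \bigcup_n C n) = 0%E -> m2 (~` \bigcup_n C n) = 0%E ->
  forall B, measurable B -> m1 B = m2 B.
Proof.
move=> mC mCE m10 m20 B mB.
have mU : measurable (\bigcup_n C n) by exact: bigcup_measurable.
have mD n : measurable (seqDU C n).
  by apply: measurableD => //; exact: bigsetU_measurable.
have BE (m : {measure set T -> \bar R}) : m (~` \bigcup_n C n) = 0%E ->
    m B = (\sum_(n <oo) m (B `&` seqDU C n))%E.
  move=> m0; rewrite (measureDI m mB mU) [X in (X + _)%E](_ : _ = 0%E) ?add0e; last first.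
    apply: (subset_measure0 (mu := m) _ _ _ m0); [exact: measurableD|exact: measurableC|].
    by move=> x [].
  rewrite seqDU_bigcup_eq setI_bigcupr; apply: (measure_semi_bigcup m).
  - by move=> n; exact: measurableI.
  - by apply: trivIset_setIl; exact: trivIset_seqDU.
  - by apply: bigcup_measurable => n _; exact: measurableI.
rewrite (BE m1 m10) (BE m2 m20); apply: eq_eseriesr => n _.
apply: (mCE n); first exact: measurableI.
by move=> x [_ []].
Qed.

(** * The saturation of a cell and the induced action *)

Section CellInduced.
Context (G : topologicalGroupType) d (T : measurableType d) (R : realType).
Context (mu : {sigma_finite_measure set T -> \bar R}).
Variables (phi : nonsingular_action G mu) (A : MALG mu) (V : openSubgroup G).
Variable nu : probability T R.
Hypothesis cell : is_cell phi A V nu.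
Hypothesis cV : countable [set: lcosets V].
Variables (e : nat -> lcosets V) (eP : forall c, exists n, e n = c).
Implicit Types (a : MALG mu) (b : MALG nu) (g : G) (c : lcosets V).

Local Notation IM := (ind_measure V nu).
Local Notation q := (cell_proj nu).
Local Notation j := (cell_lift A).

Let dnu : nu `<< mu.
Proof. by have [_ []] := cell. Qed.

(** The enumeration [e] of the cosets may have repetitions, which do not affect the join. *)
Definition cell_saturation : MALG mu := malg_sup (fun n => phi (repr (e n)) A).

Lemma cell_saturation_section (s : coset_section V) :
  cell_saturation = malg_sup (fun n => phi (s (e n)) A).
Proof.
congr malg_sup; apply/funext => n; apply: (cell_coset cell).
by apply/lcoset_eqP; rewrite reprK sec_pi.
Qed.

Lemma cell_le_saturation c : (phi (repr c) A <= cell_saturation)%O.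
Proof. by have [n <-] := eP c; exact: (malg_sup_ub (fun n => phi (repr (e n)) A)). Qed.

Lemma cell_saturation_invariant : invariant_element phi cell_saturation.
Proof.
have le g : (phi g cell_saturation <= cell_saturation)%O.
  rewrite [X in phi g X]/cell_saturation autstar_sup; apply: malg_sup_lub => n.
  apply: le_trans (cell_le_saturation (lcoset_act g (e n))).
  rewrite -nsaM le_eqVlt; apply/orP; left; apply/eqP; apply: (cell_coset cell).
  by apply/lcoset_eqP; rewrite reprK.
move=> g; apply/eqP; rewrite eq_le le//=.
by rewrite -[X in (X <= _)%O](nsaKV phi g) nsa_le le.
Qed.

Definition ind_section (E : MALG IM) c : MALG nu := malg_class nu (xsection (malg_set E) c).
Local Notation sec := ind_section.

Let secE E c : \forall x \ae nu, malg_set (sec E c) x <-> malg_set E (c, x).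
Proof.
have mS : measurable (xsection (malg_set E) c).
  by apply: measurable_xsection; exact: measurable_malg_set.
by apply: filterS (malg_classK nu mS) => x ->; split => /xsectionP.
Qed.

Let sec_inj (E E' : MALG IM) : (forall c, sec E c = sec E' c) -> E = E'.
Proof.
move=> h; apply/malg_eqP/(ind_measure_aeP cV) => c.
have /malg_eqP := h c.
by apply: filterS3 (secE E c) (secE E' c) => x; tauto.
Qed.

Let sec_ae (P : lcosets V * T -> Prop) c : (\forall y \ae IM, P y) -> \forall x \ae nu, P (c, x).
Proof. by move/(ind_measure_aeP cV); exact. Qed.

Let secI E E' c : sec (E `&` E')%O c = (sec E c `&` sec E' c)%O.
Proof.
apply/malg_eqP.
by apply: filterS3 (ae_and (secE E c) (secE E' c))
  (ae_and (secE (E `&` E')%O c) (sec_ae c (malg_setI_ae E E')))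
  (malg_setI_ae (sec E c) (sec E' c)) => x; tauto.
Qed.

Let secC E c : sec (~` E)%O c = (~` sec E c)%O.
Proof.
apply/malg_eqP.
by apply: filterS3 (ae_and (secE E c) (secE (~` E)%O c)) (sec_ae c (malg_setC_ae E))
  (malg_setC_ae (sec E c)) => x; tauto.
Qed.

Let sec_sup (E : nat -> MALG IM) c : sec (malg_sup E) c = malg_sup (fun n => sec (E n) c).
Proof.
apply/malg_eqP.
have /ae_foralln h := fun n => secE (E n) c.
apply: filterS3 (ae_and (secE (malg_sup E) c) h) (sec_ae c (malg_set_sup E))
  (malg_set_sup (fun n => sec (E n) c)) => x [h1 h2] h3 h4.
rewrite h1 h3 h4; split => -[n hn]; exists n; exact/h2.
Qed.

Let sec_slice c b c' : sec (slice c b) c' = if c' == c then b else \bot%O.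
Proof.
apply/malg_eqP.
have mb : measurable ([set c] `*` malg_set b).
  by apply: measurableX => //; exact: measurable_malg_set.
have := sec_ae c' (malg_classK IM mb).
case: eqP => [->|cc'].
  by apply: filterS2 (secE (slice c b) c) => x -> -> /=; split => [[]|].
apply: filterS3 (secE (slice c b) c') (malg_set_bot nu) => x -> h -> /=.
by split => [[]//|]; move/h.
Qed.

Let projC a : q (~` a)%O = (~` q a)%O.
Proof.
apply/malg_eqP.
have K a' : \forall x \ae nu, malg_set (q a') x <-> malg_set a' x.
  by apply: malg_classK; exact: measurable_malg_set.
by apply: filterS3 (ae_and (K a) (K (~` a)%O)) (dominates_ae dnu (malg_setC_ae a))
  (malg_setC_ae (q a)) => x; tauto.
Qed.

Let proj_sup (a : nat -> MALG mu) : q (malg_sup a) = malg_sup (fun n => q (a n)).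
Proof.
apply/malg_eqP.
have K a' : \forall x \ae nu, malg_set (q a') x <-> malg_set a' x.
  by apply: malg_classK; exact: measurable_malg_set.
have /ae_foralln h := fun n => K (a n).
apply: filterS3 (ae_and (K (malg_sup a)) h) (dominates_ae dnu (malg_set_sup a))
  (malg_set_sup (fun n => q (a n))) => x [h1 h2] h3 h4.
by rewrite h1 h3 h4; split => -[n hn]; exists n; exact/h2.
Qed.

Section WithSection.
Variable s : coset_section V.

(** Over the coset [c] lies the translate of [a] by the inverse of [s c], of which [nu] sees the
    part inside [A]. Thus the slice over [c] is a copy of the translate of [A] by [s c]. *)
Definition cell_to_ind a : MALG IM :=
  malg_class IM [set y | malg_set (phi ((s y.1)^-1)%g a) y.2].

Definition ind_to_cell (E : MALG IM) : MALG mu :=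
  malg_sup (fun n => phi (s (e n)) (j (sec E (e n)))).

Local Notation F := cell_to_ind.
Local Notation K := ind_to_cell.

Let secF a c : sec (F a) c = q (phi ((s c)^-1)%g a).
Proof.
have mS : measurable [set y : lcosets V * T | malg_set (phi ((s y.1)^-1)%g a) y.2].
  apply: (measurable_coset_family cV (S := fun c' => malg_set (phi ((s c')^-1)%g a))) => c'.
  exact: measurable_malg_set.
apply/malg_eqP.
apply: filterS3 (secE (F a) c) (sec_ae c (malg_classK IM mS))
  (malg_classK nu (measurable_malg_set (phi ((s c)^-1)%g a))) => x h1 h2 h3.
by rewrite h1 h3; exact: h2.
Qed.

Let FI : {morph F : a a' / (a `&` a')%O}.
Proof. by move=> a a'; apply: sec_inj => c; rewrite secI !secF nsaI (cell_projI cell). Qed.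

Let FC : {morph F : a / (~` a)%O}.
Proof. by move=> a; apply: sec_inj => c; rewrite secC !secF autstarC projC. Qed.

Let F0 : F \bot%O = \bot%O.
Proof.
have <- : (\top `&` ~` \top)%O = \bot%O :> MALG mu by exact: meetxC.
by rewrite FI FC meetxC.
Qed.

Let F_sup (a : nat -> MALG mu) : F (malg_sup a) = malg_sup (F \o a).
Proof.
apply: sec_inj => c; rewrite sec_sup secF autstar_sup proj_sup.
by congr malg_sup; apply/funext => n /=; rewrite secF.
Qed.

Let sec_V c c' : osg_set V ((s c)^-1 * s c')%g -> c = c'.
Proof. by move/lcoset_eqP; rewrite !sec_pi. Qed.

Let lift_le c b : (phi (s c) (j b) <= phi (s c) A)%O.
Proof. by rewrite nsa_le cell_lift_le. Qed.

(** Translates of [A] by distinct cosets are disjoint, so only the term of index [c] remains. *)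
Let K_meet E c : (K E `&` phi (s c) A)%O = phi (s c) (j (sec E c)).
Proof.
apply/eqP; rewrite eq_le; apply/andP; split.
  rewrite meetC malg_meet_sup; apply: malg_sup_lub => n.
  have [<-|/eqP ec] := eqVneq (e n) c; first exact: leIr.
  have : (phi (s c) A `&` phi (s (e n)) A)%O = \bot%O.
    by apply: (cell_disjoint cell) => /sec_V/esym.
  move=> h; rewrite (_ : (_ `&` _)%O = \bot%O) ?le0x//.
  by apply/eqP; rewrite -lex0 -h leI2// lift_le.
rewrite lexI lift_le andbT; have [n <-] := eP c.
exact: (malg_sup_ub (fun n => phi (s (e n)) (j (sec E (e n))))).
Qed.

Let FK : cancel K F.
Proof.
move=> E; apply: sec_inj => c; apply: (can_inj (cell_liftK cell)).
rewrite secF (cell_projK cell) -[X in (_ `&` X)%O](nsaK phi (s c)) -nsaI K_meet.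
by rewrite nsaK.
Qed.

(** With [FK], this makes [F] and [K] inverse bijections between the elements below the saturation
    and the product algebra. *)
Let KF a : K (F a) = (a `&` cell_saturation)%O.
Proof.
rewrite (cell_saturation_section s) malg_meet_sup; congr malg_sup; apply/funext => n.
by rewrite secF (cell_projK cell) nsaI nsaKV.
Qed.

Opaque cell_to_ind ind_to_cell.

Let K_le E : (K E <= cell_saturation)%O.
Proof. by rewrite -(FK E) KF leIr. Qed.

Let KF_le a : (a <= cell_saturation)%O -> K (F a) = a.
Proof. by rewrite KF => /meet_idPl. Qed.

Let F_sat : F cell_saturation = \top%O.
Proof. by rewrite -[cell_saturation]meet1x -KF FK -compl0 FC F0 compl0. Qed.

Let K0 : K \bot%O = \bot%O.
Proof. by rewrite -F0 KF meet0x. Qed.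

Let KI : {morph K : E E' / (E `&` E')%O}.
Proof.
move=> E E'; rewrite -{1}(FK E) -{1}(FK E') -FI KF; apply/meet_idPl.
by rewrite leIxl// K_le.
Qed.

Let KC E : K (~` E)%O = (~` K E `&` cell_saturation)%O.
Proof. by rewrite -{1}(FK E) -FC KF. Qed.

Let lift0 : j (\bot%O : MALG nu) = \bot%O.
Proof.
by rewrite -{1}(meetxC (\bot%O : MALG nu)) (cell_liftI cell) (cell_liftC cell) meetCA meetxC meetx0.
Qed.

Let F_slice c b : F (phi (s c) (j b)) = slice c b.
Proof.
apply: sec_inj => c'; rewrite secF sec_slice; case: eqP => [->|cc'].
  by rewrite nsaK (cell_liftK cell).
apply: (can_inj (cell_liftK cell)); rewrite (cell_projK cell) lift0.
rewrite -[X in (_ `&` X)%O](nsaK phi (s c')) -nsaI.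
rewrite (_ : (_ `&` _)%O = \bot%O) ?nsa0//; apply/eqP; rewrite -lex0.
rewrite -(cell_disjoint cell (g := s c) (h := s c')); first by rewrite leI2// lift_le.
by move/sec_V/esym.
Qed.

Let K_slice c b : K (slice c b) = phi (s c) (j b).
Proof.
rewrite -F_slice KF_le//; apply: le_trans (lift_le _ _) _; have [n <-] := eP c.
by rewrite (cell_saturation_section s); exact: (malg_sup_ub (fun n => phi (s (e n)) A)).
Qed.

Let beta_fun g (E : MALG IM) : MALG IM := F (phi g (K E)).

Let K_beta g E : K (beta_fun g E) = phi g (K E).
Proof. by rewrite KF_le// -(cell_saturation_invariant g) nsa_le. Qed.

Let betaK g : cancel (beta_fun g) (beta_fun (g^-1)%g).
Proof. by move=> E; rewrite {1}/beta_fun K_beta nsaK FK. Qed.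

Let beta_iso g : boolean_isomorphism (beta_fun g).
Proof.
apply: boolean_isomorphism_meet_compl.
- exists (beta_fun (g^-1)%g); first exact: betaK.
  by move=> E; have := betaK (g^-1)%g E; rewrite invgK.
- by move=> E E'; rewrite /beta_fun KI nsaI FI.
- move=> E; rewrite /beta_fun KC nsaI cell_saturation_invariant FI F_sat meetx1.
  by rewrite autstarC FC.
Qed.

Let psi g : Autstar IM := mk_autstar (beta_iso g).

Let K_psi g E : K (psi g E) = phi g (K E).
Proof. exact: K_beta. Qed.

Let psiM : {morph psi : g h / (g * h)%g}.
Proof.
move=> g h; apply: autstarP => E.
by rewrite -[LHS]/(F _) -[RHS]/(F (phi g (K (psi h E)))) K_psi nsaM.
Qed.

Let F_hom : sigma_hom F.
Proof. by split; [exact: F0|exact: FI|exact: F_sup]. Qed.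

(** The product of the counting measure and [nu], carried back along [F]. It vanishes off the
    saturation, whose complement [F] sends to bottom. *)
Definition saturation_measure : {measure set T -> \bar R} :=
  pullback_measure_of F_hom (@dominates_refl _ _ _ IM).
Local Notation N := saturation_measure.

Let NE a : N (malg_set a) = IM (malg_set (F a)).
Proof. exact: pullback_measureE. Qed.

Let dN : N `<< mu.
Proof. exact: pullback_measure_dominates. Qed.

Opaque saturation_measure.

Let N_slice c b : N (malg_set (phi (s c) (j b))) = nu (malg_set b).
Proof.
rewrite NE F_slice /slice.
have mb : measurable ([set c] `*` malg_set b).
  by apply: measurableX => //; exact: measurable_malg_set.
rewrite (malg_set_ae_measure (@dominates_refl _ _ _ IM) mb); last exact: malg_classK.
by apply: ind_measure_slice; exact: measurable_malg_set.
Qed.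

Variable alpha : nonsingular_action (subgroup_type V) nu.
Hypothesis alpha_pres : preserves_measure alpha nu.
Hypothesis alpha_lift : forall v b, j (alpha v b) = phi (val v) (j b).

(** The relation [g * s c = s (g c) * cocycle g c]. *)
Let phi_lift g c b : phi g (phi (s c) (j b)) =
  phi (s (lcoset_act g c)) (j (alpha (cocycle s g c) b)).
Proof. by rewrite alpha_lift -!nsaM /= !mulgA mulgV mul1g. Qed.

Let le_lift c a : (a <= phi (s c) A)%O -> a = phi (s c) (j (q (phi ((s c)^-1)%g a))).
Proof.
move=> ac; rewrite (cell_liftKI cell) ?nsaKV//.
by rewrite -(nsa_le phi (s c)) nsaKV.
Qed.

Let N_compl_sat : N (malg_set (~` cell_saturation)%O) = 0%E.
Proof.
rewrite NE FC F_sat compl1; apply/malg_class_eq0; last by rewrite malg_setK.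
exact: measurable_malg_set.
Qed.

Let compl_sat_cover : \forall x \ae mu,
  malg_set (~` cell_saturation)%O x <-> (~` \bigcup_n malg_set (phi (s (e n)) A)) x.
Proof.
rewrite (cell_saturation_section s).
apply: filterS2 (malg_setC_ae (malg_sup (fun n => phi (s (e n)) A)))
  (malg_set_sup (fun n => phi (s (e n)) A)) => x -> h.
by split => nx hx; apply: nx; [case: hx => n _ hn; apply/h; exists n|
  case/h: hx => n hn; exists n].
Qed.

Let N_null_cover : N (~` \bigcup_n malg_set (phi (s (e n)) A)) = 0%E.
Proof.
rewrite -(malg_set_ae_measure dN _ compl_sat_cover) ?N_compl_sat//.
by apply: measurableC; apply: bigcup_measurable => n _; exact: measurable_malg_set.
Qed.

(** It is enough to look inside one translate of [A]: by [phi_lift], [g] acts there as a change of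
    slice combined with an element of [alpha], and both preserve the measure. *)
Let N_phi g a : N (malg_set (phi g a)) = N (malg_set a).
Proof.
pose N2 : {measure set T -> \bar R} := pullback_measure_of (autstar_sigma_hom (phi g)) dN.
have N2E a' : N2 (malg_set a') = N (malg_set (phi g a')) by exact: pullback_measureE.
have dN2 : N2 `<< mu by exact: pullback_measure_dominates.
rewrite -N2E; apply: (@measure_eq_on_cover _ _ _ _ _ (fun n => malg_set (phi (s (e n)) A))).
- by move=> n; exact: measurable_malg_set.
- move=> n B mB BC.
  have BE : \forall x \ae mu, malg_set (malg_class mu B) x <-> B x by exact: malg_classK.
  rewrite -(malg_set_ae_measure dN2 mB BE) -(malg_set_ae_measure dN mB BE) N2E.
  rewrite (@le_lift (e n) (malg_class mu B)); last first.
    by apply/malg_leP; apply: filterS BE => x -> /BC.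
  by rewrite phi_lift !N_slice alpha_pres.
- rewrite -(@malg_set_ae_measure _ _ _ _ _ dN2 (~` cell_saturation)%O).
  + rewrite N2E autstarC cell_saturation_invariant; exact: N_compl_sat.
  + by apply: measurableC; apply: bigcup_measurable => n _; exact: measurable_malg_set.
  + exact: compl_sat_cover.
- exact: N_null_cover.
- exact: measurable_malg_set.
Qed.

Lemma saturation_action : exists2 beta : nonsingular_action G IM, is_induced s alpha beta &
  forall winv : invariant_element phi cell_saturation,
    isomorphic_actions (restrict_action winv) (fun g E => beta g E).
Proof.
have NK E : IM (malg_set E) = N (malg_set (K E)) by rewrite NE FK.
have psi_pres g E : IM (malg_set (psi g E)) = IM (malg_set E).
  apply: (etrans (NK (psi g E))).
  apply: (etrans _ (esym (NK E))).
  rewrite K_psi.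
  exact: N_phi.
have nuoo : (nu setT < +oo)%E by rewrite probability_setT ltry.
have id_cont : continuous (@id G) by move=> g; exact: cvg_id.
have [beta bE] := transferred_action (iota := @id G) erefl id_cont psiM psi_pres
  (ind_measure_sigma_finite cV nuoo) KI K_psi dN NK.
exists beta => [g c b|winv].
  by rewrite bE -[LHS]/(F (phi g (K (slice c b)))) K_slice phi_lift F_slice.
exists (fun a : below cell_saturation => F (val a)); last first.
  by move=> g a; rewrite bE -[RHS]/(F (phi g (K (F (val a))))) KF_le//; exact: (valP a).
apply: boolean_isomorphism_meet_compl.
- exists (fun E => mk_below (K_le E)) => [a|E]; last exact: FK.
  by apply/val_inj => /=; rewrite KF_le//; exact: (valP a).
- by move=> a a'; rewrite -FI.
- move=> a; transitivity (F (cell_saturation `&` ~` val a)%O).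
    by congr F; exact: (diffE cell_saturation (val a)).
  by rewrite FI F_sat meet1x FC.
Qed.

Lemma saturation_measureP : [/\ N `<< mu, forall g a, N (malg_set (phi g a)) = N (malg_set a),
  forall a, N (malg_set a) = 0%E -> (a `&` cell_saturation)%O = \bot%O,
  N (malg_set (~` cell_saturation)%O) = 0%E &
  exists2 C : nat -> MALG mu, cell_saturation = malg_sup C & forall n, (N (malg_set (C n)) < +oo)%E].
Proof.
split; [exact: dN|exact: N_phi|move=> a Na0|exact: N_compl_sat|].
  rewrite -KF -K0; congr K; rewrite -[F a]malg_setK.
  by apply/malg_class_eq0; [exact: measurable_malg_set|rewrite -NE].
exists (fun n => phi (s (e n)) A); first exact: cell_saturation_section.
move=> n; rewrite -(cell_liftKI cell (lexx A)) N_slice.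
by apply: le_lt_trans (probability_le1 _ _) (ltry _); exact: measurable_malg_set.
Qed.

End WithSection.

End CellInduced.

(** * Exhaustion *)

Section Blocks.
Context (G : topologicalGroupType) d (T : measurableType d) (R : realType).
Context (mu : {sigma_finite_measure set T -> \bar R}).
Variable phi : nonsingular_action G mu.
Implicit Types (w a : MALG mu) (g : G).

(** The isomorphism is stated for every proof [winv] of invariance, so that it applies to whichever
    one is supplied later. *)
Definition is_induced_block w :=
  exists (V : openSubgroup G) (d' : measure_display) (X : measurableType d')
    (nu : probability X R) (alpha : nonsingular_action (subgroup_type V) nu),
  [/\ countable [set: lcosets V], preserves_measure alpha nu
    & forall s : coset_section V,
        exists2 beta : nonsingular_action G (ind_measure V nu), is_induced s alpha beta &
        forall winv : invariant_element phi w,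
          isomorphic_actions (restrict_action winv) (fun g b => beta g b)].

Definition is_invariant_measure_on w (N : {measure set T -> \bar R}) :=
  [/\ N `<< mu, forall g a, N (malg_set (phi g a)) = N (malg_set a),
    forall a, N (malg_set a) = 0%E -> (a `&` w)%O = \bot%O,
    N (malg_set (~` w)%O) = 0%E &
    exists2 C : nat -> MALG mu, w = malg_sup C & forall n, (N (malg_set (C n)) < +oo)%E].

Definition is_block w := [/\ invariant_element phi w, w <> \bot%O, is_induced_block w &
  exists N, is_invariant_measure_on w N].

Lemma block_exists w : separable_space G -> non_archimedean G -> roelcke_precompact G ->
  invariant_element phi w -> w <> \bot%O -> exists2 w', is_block w' & (w' <= w)%O.
Proof.
move=> sG nG rG winv w0.
have [A [V [m [[cA cm] Aw]]]] := cell_exists nG rG winv w0.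
have [A0 VE dA] := cA; have [dm moo mA m0 mV] := cm.
have mT0 : m setT <> 0%E.
  move=> mT; apply: A0; rewrite -(meetxx A); apply: m0.
  apply: (subset_measure0 (mu := m) _ measurableT (@subsetT _ _) mT).
  exact: measurable_malg_set.
have [P [c c0 PE]] := normalize_measure moo mT0.
have Pm0 B : P B = 0%E -> m B = 0%E.
  by move=> /(etrans (esym (PE B)))/eqP; rewrite mule_eq0 eqe gt_eqF//= => /eqP.
have cell : is_cell phi A V P.
  split => //; split.
  - apply/null_content_dominatesP => B mB B0; apply: (etrans (PE B)).
    by rewrite (dominates0 dm mB B0) mule0.
  - by rewrite [X in (X < _)%E](probability_setT P) ltry.
  - by apply: (etrans (PE _)); rewrite mA mule0.
  - by move=> a /Pm0/m0.
  - move=> g a Vg; apply: (etrans (PE _)); apply: (etrans _ (esym (PE _))).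
    by rewrite mV.
have cV := countable_lcosets V sG.
have [e eP] := lcosets_enum cV.
have [alpha [apres alift]] := cell_action cell.
have [s _] := section_exists V.
exists (cell_saturation phi A e).
  split; first exact: (cell_saturation_invariant cell eP).
  - move=> S0; apply: A0; apply/(nsa_eq0 phi (repr (e 0%N))).
    by apply/eqP; rewrite -lex0 -S0 (cell_le_saturation phi A eP).
  - exists V, d, T, P, alpha; split => // s'.
    exact: (saturation_action cell cV eP s' apres alift).
  - exists (saturation_measure cell cV s).
    exact: (saturation_measureP cell cV eP s apres alift).
apply: malg_sup_lub => n; by rewrite -(winv (repr (e n))) nsa_le.
Qed.

(** For the finite measure [e ^ 2 mu], which is positive on non-null sets, only finitely many
    disjoint elements have mass at least [1 / k.+1]. *)
Lemma countable_disjoint_family (D : set (MALG mu)) : (forall w, D w -> w <> \bot%O) ->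
  (forall w w', D w -> D w' -> w <> w' -> (w `&` w')%O = \bot%O) -> countable D.
Proof.
move=> D0 dD; have [e [he e0]] := sigma_finite_positive_L2 mu.
have [m [dm moo mE]] := L2cone_density he.
have me2 : measurable_fun setT (fun x => e x ^+ 2).
  by apply: measurable_funX; case: he.
have m_gt0 w : D w -> (0 < m (malg_set w))%E.
  move=> Dw; rewrite lt0e measure_ge0 andbT; apply/eqP => mw0; apply: (D0 w Dw).
  have mw := measurable_malg_set w.
  have Ka : \forall x \ae mu, e x ^+ 2 * \1_(malg_set w) x = 0.
    apply: (density_ae_eq (g := cst 0)) => //.
    - exact: measurable_funM.
    - by move=> x; rewrite mulr_ge0// sqr_ge0.
    - by rewrite density_indic setTI -mE mw0.
    - move=> B mB; rewrite density_indic [RHS]integral0 -mE.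
      apply: (subset_measure0 (mu := m) _ mw _ mw0); first exact: measurableI.
      exact: subIsetr.
  apply/malg_bot_aeP; apply: filterS Ka => x /eqP.
  rewrite mulf_eq0 expf_eq0/= gt_eqF//= indicE => + wx.
  by rewrite mem_set// oner_eq0.
pose Dk k := [set w | D w /\ (k.+1%:R^-1%:E <= m (malg_set w))%E].
have mfin w : m (malg_set w) \is a fin_num.
  rewrite ge0_fin_numE// (le_lt_trans _ moo)//.
  by apply: le_measure; rewrite ?inE//; exact: measurable_malg_set.
have -> : D = \bigcup_k Dk k.
  apply/seteqP; split => [w Dw|w [k _ []]//].
  have := m_gt0 w Dw; rewrite -(fineK (mfin w)) lte_fin => /ltr_add_invr[k].
  rewrite add0r => /ltW hk; exists k => //; split => //.
  by rewrite -(fineK (mfin w)) lee_fin.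
apply: bigcup_countable => // k _; apply: finite_set_countable.
apply: contrapT => /infiniteP/card_leP[f].
pose g n : MALG mu := val (f (exist (fun n => n \in [set: nat]) n (mem_set I))).
have gD n : Dk k (g n) by exact: (set_valP (f _)).
have gI i j : g i = g j -> i = j.
  by move=> /val_inj/(@inj _ _ _ f) => /(_ (mem_set I) (mem_set I))[].
have gd i j : i != j -> (g i `&` g j)%O = \bot%O.
  move=> /eqP ij; apply: dD; [by have [] := gD i|by have [] := gD j|].
  by move/gI.
have c0 : 0 < k.+1%:R^-1 :> R by rewrite invr_gt0.
have bound n : n%:R * k.+1%:R^-1 <= fine (m setT).
  rewrite -lee_fin fineK ?ge0_fin_numE//.
  have mg i : measurable (malg_set (g i)) by exact: measurable_malg_set.
  apply: (@le_trans _ _ (m (\bigcup_i malg_set (g i)))); last first.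
    by apply: le_measure; rewrite ?inE//; exact: bigcup_measurable.
  have gae i j : i != j -> \forall x \ae m, ~ (malg_set (g i) x /\ malg_set (g j) x).
    move=> /gd/malg_bot_aeP h; apply: (dominates_ae dm).
    by apply: filterS2 h (malg_setI_ae (g i) (g j)) => x; tauto.
  have := @ae_disjoint_cvg_measure _ _ _ m (fun i => malg_set (g i)) mg gae.
  move=> /cvg_lim <- //.
  apply: le_trans (nneseries_lim_ge n (fun i _ _ => measure_ge0 m (malg_set (g i)))).
  have -> : (n%:R * k.+1%:R^-1)%:E = (\sum_(0 <= i < n) (k.+1%:R^-1 : R)%:E)%E.
    by rewrite sumEFin sumr_const_nat subn0 mulr_natl.
  by apply: lee_sum => i _; have [] := gD i.
have [n hn] : exists n : nat, fine (m setT) / k.+1%:R^-1 < n%:R.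
  by exists (Num.truncn (fine (m setT) / k.+1%:R^-1)).+1; exact: truncnS_gt.
by have := bound n; rewrite leNgt -ltr_pdivrMr// hn.
Qed.

End Blocks.

Section Exhaustion.
Context (G : topologicalGroupType) d (T : measurableType d) (R : realType).
Context (mu : {sigma_finite_measure set T -> \bar R}).
Variable phi : nonsingular_action G mu.
Hypotheses (sG : separable_space G) (nG : non_archimedean G) (rG : roelcke_precompact G).

Lemma block_sequence : exists W : nat -> MALG mu,
  [/\ forall n, W n = \bot%O \/ is_block phi (W n),
    forall n m, n != m -> (W n `&` W m)%O = \bot%O & malg_sup W = \top%O].
Proof.
pose P (D : set (MALG mu)) := (forall w, D w -> is_block phi w) /\
  (forall w w', D w -> D w' -> w <> w' -> (w `&` w')%O = \bot%O).
have [|D [[Db Dd] Dmax]] := @Zorn_bigcup _ P.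
  move=> F FP Ftot; split => [w [D FD Dw]|w w' [D FD Dw] [D' FD' D'w'] ww'].
    by have [h _] := FP D FD; exact: h.
  have [DD'|D'D] := Ftot D D' FD FD'.
  - by have [_ h] := FP D' FD'; apply: h => //; exact: DD'.
  - by have [_ h] := FP D FD; apply: h => //; exact: D'D.
have /countable_injP[f fI] : countable D.
  by apply: countable_disjoint_family => // w /Db[].
(* Integers that number no member of [D] get the bottom element. *)
pose W n := xget \bot%O [set w | D w /\ f w = n].
have WD n : (D (W n) /\ f (W n) = n) \/ W n = \bot%O.
  by rewrite /W; case: xgetP => [w _ h|_]; [left|right].
have DW w : D w -> exists n, w = W n.
  move=> Dw; exists (f w); rewrite /W; case: xgetP => [w' _ [Dw' /fI]|/(_ w)[]//].
  by rewrite !inE => /(_ Dw' Dw).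
exists W; split.
- by move=> n; have [[/Db]|] := WD n; [right|left].
- move=> n m nm; have [[Dn fn]|->] := WD n; last by rewrite meet0x.
  have [[Dm fm]|->] := WD m; last by rewrite meetx0.
  by apply: Dd => // WW; move: nm; rewrite -fn -fm WW eqxx.
pose c := (~` malg_sup W)%O.
have cinv : invariant_element phi c.
  move=> g; rewrite /c autstarC autstar_sup; congr (~` (malg_sup _))%O; apply/funext => n.
  by have [[/Db[]]|->] := WD n; last rewrite nsa0.
suff c0 : c = \bot%O by rewrite -[LHS]complK -/c c0 compl0.
apply: contrapT => c0; have [w' bw' w'c] := block_exists sG nG rG cinv c0.
have w'0 : w' <> \bot%O by case: bw'.
have w'D w : D w -> (w `&` w')%O = \bot%O.
  move=> /DW[n ->]; apply/eqP; rewrite -lex0 -(meetxC (malg_sup W)) leI2//.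
  exact: malg_sup_ub.
apply: (Dmax (D `|` [set w'])).
  split; first by move=> w Dw; left.
  by move=> /(_ w' (or_intror erefl))/w'D; rewrite meetxx.
split => [w [/Db//|->//]|w w''].
case=> [Dw|->] [Dw''|->] // ww; first exact: Dd.
  exact: w'D.
by rewrite meetC; exact: w'D.
Qed.

End Exhaustion.

(** * An equivalent invariant measure *)

Section InvariantMeasure.
Context (G : topologicalGroupType) d (T : measurableType d) (R : realType).
Context (mu : {sigma_finite_measure set T -> \bar R}).
Variable phi : nonsingular_action G mu.
Variables (W : nat -> MALG mu) (N : nat -> {measure set T -> \bar R}).
Hypotheses (Wd : forall n m, n != m -> (W n `&` W m)%O = \bot%O) (WT : malg_sup W = \top%O).
Hypothesis WN : forall n, is_invariant_measure_on phi (W n) (N n).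

(** Serves the indices at which the sequence of blocks is padded with bottom. *)
Lemma invariant_measure_bot : is_invariant_measure_on phi \bot%O (@mzero d T R).
Proof.
split => //.
- by move=> a _; rewrite meetx0.
- exists (fun _ => \bot%O) => [|n]; last exact: ltry.
  by apply/esym/eqP; rewrite -lex0; apply: malg_sup_lub.
Qed.

(** The sum of the [N n] inherits invariance and null sets. Its sigma-finiteness comes from each
    [N n] being concentrated on [W n]. *)
Lemma invariant_measure_sum : exists nu : {sigma_finite_measure set T -> \bar R},
  [/\ nu `<< mu, mu `<< nu & preserves_measure phi nu].
Proof.
have dN n : N n `<< mu by have [] := WN n.
pose nu := mseries N 0.
have nu_mu : nu `<< mu.
  apply/null_content_dominatesP => A mA A0.
  by rewrite /nu /mseries eseries0// => n _ _; exact: (dominates0 (dN n)).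
have /choice[C /all_and2[WC Coo]] : forall n, exists C : nat -> MALG mu,
    W n = malg_sup C /\ forall k, (N n (malg_set (C k)) < +oo)%E.
  by move=> n; have [_ _ _ _ [C WC Coo]] := WN n; exists C.
(* Cutting by [W n] leaves a set on which all the other [N i] vanish. *)
pose D n k := (C n k `&` W n)%O.
have NDoo n k : (nu (malg_set (D n k)) < +oo)%E.
  rewrite /nu /mseries (nneseriesD1 (n := n))//.
  rewrite eseries0 ?adde0.
    by apply: le_lt_trans (Coo n k); apply: (malg_measure_le (dN n)); exact: leIl.
  move=> i _ /= ni; have [_ _ _ Ni0 _] := WN i.
  apply/eqP; rewrite -measure_le0 -Ni0; apply: (malg_measure_le (dN i)).
  apply/malg_leP; have /malg_bot_aeP := Wd ni.
  apply: filterS3 (ae_and (malg_setI_ae (C n k) (W n)) (malg_setC_ae (W i)))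
    (malg_setI_ae (W i) (W n)) => x; tauto.
pose Z := ~` \bigcup_n \bigcup_k malg_set (D n k).
have mZ : measurable Z.
  by apply: measurableC; apply: bigcup_measurable => n _; apply: bigcup_measurable => k _;
    exact: measurable_malg_set.
have Z0 : nu Z = 0%E.
  apply: (dominates0 nu_mu mZ); apply/measure0_aeP => //.
  have /ae_foralln h1 : forall n, \forall x \ae mu,
      malg_set (W n) x -> exists k, malg_set (C n k) x.
    move=> n; have /malg_eqP : W n = malg_sup (C n) by exact: WC.
    by apply: filterS2 (malg_set_sup (C n)) => x; tauto.
  have /ae_foralln h2 : forall n, \forall x \ae mu, forall k,
      malg_set (D n k) x <-> malg_set (C n k) x /\ malg_set (W n) x.
    by move=> n; apply/ae_foralln => k; exact: malg_setI_ae.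
  have h3 : \forall x \ae mu, exists n, malg_set (W n) x.
    have /malg_eqP := WT.
    by apply: filterS3 (malg_set_top mu) (malg_set_sup W) => x; tauto.
  apply: filterS3 h1 h2 h3 => x h1 h2 [n Wx]; apply.
  by have [k Cx] := h1 n Wx; exists n => //; exists k => //; apply/h2.
have sf : sigma_finite setT nu.
  (* Index 0 is the remainder [Z], null but possibly nonempty because representatives cover only up
     to a null set; an integer that encodes no pair gives the empty set. *)
  exists (fun i => if i is i'.+1 then
    (if unpickle i' is Some nk then malg_set (D nk.1 nk.2) else set0) else Z).
    apply/seteqP; split => // x _.
    have [[n _ [k _ Dx]]|nD] := pselect ((\bigcup_n \bigcup_k malg_set (D n k)) x).
      by exists (pickle (n, k)).+1 => //; rewrite pickleK.
    by exists 0%N.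
  case=> [|i]; first by split => //; rewrite Z0 ltry.
  case: (unpickle i : option (nat * nat)) => [[n k]|].
    by split; [exact: measurable_malg_set|exact: NDoo].
  by split => //; rewrite /nu measure0 ltry.
pose nu' : {sigma_finite_measure set T -> \bar R} :=
  HB.pack (mseries N 0) (Measure_isSigmaFinite.Build _ _ _ (mseries N 0) sf).
exists nu'; split => //.
- apply/null_content_dominatesP => B mB B0; apply/malg_class_eq0 => //.
  rewrite -[LHS]meetx1 -WT malg_meet_sup; apply/eqP; rewrite -lex0.
  apply: malg_sup_lub => n; have [_ _ N0 _ _] := WN n; rewrite N0//.
  rewrite (malg_set_ae_measure (dN n) mB); last exact: malg_classK.
  apply/eqP; rewrite -measure_le0 -B0 /nu' /= /mseries (nneseriesD1 (n := n))//.
  by rewrite leeDl// nneseries_ge0.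
- move=> g a; rewrite /nu' /= /mseries; apply: eq_eseriesr => n _.
  by have [_ Ninv _ _ _] := WN n.
Qed.

End InvariantMeasure.

Theorem theorem1p1 (R : realType) (G : topologicalGroupType)
    (d : measure_display) (T : measurableType d)
    (mu : {sigma_finite_measure set T -> \bar R})
    (phi : nonsingular_action G mu)
    (G_polish : polish R G)
    (G_nonarch : non_archimedean G)
    (G_roelcke : roelcke_precompact G) :
  (exists (I : countType) (W : I -> MALG mu)
      (winv : forall i, invariant_element phi (W i)),
    [/\ forall i j : I, i != j -> (W i `&` W j)%O = \bot%O,
        malg_class mu (\bigcup_(i in [set: I]) malg_set (W i)) = \top%O
      & forall i : I,
          exists (V : openSubgroup G) (d' : measure_display)
            (X : measurableType d') (nu : probability X R)
            (alpha : nonsingular_action (subgroup_type V) nu),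
          [/\ countable [set: lcosets V],
              preserves_measure alpha nu
            & forall s : coset_section V,
                exists2 beta : nonsingular_action G (ind_measure V nu),
                  is_induced s alpha beta
                & isomorphic_actions (restrict_action (winv i))
                    (fun g b => beta g b)]])
  /\
  (exists nu : {sigma_finite_measure set T -> \bar R},
    [/\ nu `<< mu, mu `<< nu & preserves_measure phi nu]).
Proof.
have [G_separable _] := G_polish.
have [W [WB Wd WT]] := block_sequence phi G_separable G_nonarch G_roelcke.
split; last first.
  have /choice[N WN] : forall n, exists N, is_invariant_measure_on phi (W n) N.
    move=> n; have [->|[_ _ _ //]] := WB n.
    by exists (@mzero d T R); exact: invariant_measure_bot.
  exact: (invariant_measure_sum Wd WT WN).
(* The bottom elements are discarded: a null piece is not induced from an action on a probability
   space. *)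
pose I := {n : nat | `[< is_block phi (W n) >]}.
have blockW (i : I) : is_block phi (W (val i)) by apply/asboolP; exact: (valP i).
have winv (i : I) : invariant_element phi (W (val i)) by case: (blockW i).
exists I, (fun i => W (val i)), winv; split.
- by move=> i j ij; exact: Wd.
- rewrite -WT; apply/malg_class_aeP.
  + by apply: countable_bigcupT_measurable => // i; exact: measurable_malg_set.
  + by apply: bigcup_measurable => n _; exact: measurable_malg_set.
  (* The representatives of the countably many discarded pieces have null union. *)
  have /ae_foralln : forall n, \forall x \ae mu, W n = \bot%O -> ~ malg_set (W n) x.
    move=> n; have [/malg_bot_aeP|nW] := eqVneq (W n) \bot%O.
      by apply: filterS => x + _.
    by apply: filterE => x W0; rewrite W0 eqxx in nW.
  apply: filterS => x Wx; split => [[i _ ix]|[n _ nx]]; first by exists (val i).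
  have bn : `[< is_block phi (W n) >].
    by apply/asboolP; have [/Wx//|] := WB n.
  by exists (exist _ n bn).
- move=> i; have [_ _ [V [d' [X [nu [alpha [cV apres ind]]]]]] _] := blockW i.
  exists V, d', X, nu, alpha; split => // s.
  by have [beta bind biso] := ind s; exists beta.
Qed.
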